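(* Let $\Theta\subseteq\mathbb{R}^q$, $\theta_0\in\Theta$, $\alpha\in(0,1)$. For each sample size $T$ let $g_T(\cdot)$ be an $\mathbb{R}^k$-valued stochastic process on $\Theta$ whose distribution is described by a probability measure $P\in\mathcal{P}_0$, where $\mathcal{P}_0$ is a family of distributions consistent with the null; to each $P\in\mathcal{P}_0$ are associated a deterministic mean function $m_T=m_{T,P}:\Theta\to\mathbb{R}^k$ with $m_T(\theta_0)=0$ and a mean-zero Gaussian process $G=G_P$ with covariance function $\Sigma=\Sigma_P$. Suppose: (1) $\displaystyle\lim_{T\to\infty}\sup_{P\in\mathcal{P}_0}\sup_{f\in BL_1}\left|E[f(g_T-m_T)]-E[f(G)]\right|=0$; (2) for some finite $\bar\lambda>0$, $$1/\bar\lambda\le\inf_{P\in\mathcal{P}_0}\inf_{\theta\in\Theta}\lambda_{\min}(\Sigma(\theta,\theta))\le\sup_{P\in\mathcal{P}_0}\sup_{\theta\in\Theta}\lambda_{\max}(\Sigma(\theta,\theta))\le\bar\lambda;$$ (3) there is an estimator $\widehat\Sigma(\cdot,\cdot)$ such that for any $\varepsilon>0$, $\displaystyle\lim_{T\to\infty}\sup_{P\in\mathcal{P}_0}P\left\{\sup_{\theta,\tilde\theta}\|\widehat\Sigma(\theta,\tilde\theta)-\Sigma(\theta,\tilde\theta)\|>\varepsilon\right\}=0$; (4) the real-valued functional $R(\xi,h(\cdot),\Sigma(\cdot,\cdot))$ is defined for all $\xi\in\mathbb{R}^k$, all $h:\Theta\to\mathbb{R}^k$ with $h(\theta_0)=0$,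 and all covariance functions $\Sigma$ whose eigenvalues satisfy a bound $1/\bar\lambda\le\inf_\theta\lambda_{\min}(\Sigma(\theta,\theta))\le\sup_\theta\lambda_{\max}(\Sigma(\theta,\theta))\le\bar\lambda$ with finite $\bar\lambda>0$; and for any fixed $C>0$ (and any such $\bar\lambda$), $R(\xi,h,\Sigma)$ is bounded and Lipschitz in $\xi$, $h$ and $\Sigma$ over the set of such $(\xi,h,\Sigma)$ with $\xi'\Sigma(\theta_0,\theta_0)^{-1}\xi\le C$. Let $$h_T(\theta)=g_T(\theta)-\widehat\Sigma(\theta,\theta_0)\widehat\Sigma(\theta_0,\theta_0)^{-1}g_T(\theta_0),$$ $$c_\alpha(h_T,\widehat\Sigma)=\inf\left\{c: P^*\{\xi: R(\xi,h_T(\cdot),\widehat\Sigma(\cdot,\cdot))\le c\}\ge1-\alpha\right\},$$ where, under $P^*$, $\xi\sim N(0,\widehat\Sigma(\theta_0,\theta_0))$ with $(h_T,\widehat\Sigma)$ held fixed. Then for any $\varepsilon>0$, $$\lim_{T\to\infty}\sup_{P\in\mathcal{P}_0}P\left\{R(g_T(\theta_0),h_T,\widehat\Sigma)>c_\alpha(h_T,\widehat\Sigma)+\varepsilon\right\}\le\alpha.$$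
   Context: $\lambda_{\min}(A)$, $\lambda_{\max}(A)$ are the minimal and maximal eigenvalues of $A$; $\|\cdot\|$ is the Euclidean norm for vectors and the operator norm for matrices. $BL_1$ is the set of real functionals (on the space of functions $\Theta\to\mathbb{R}^k$ with the sup norm) with Lipschitz constant and supremum norm bounded above by one; expectations are understood with the usual measurability conventions for weak convergence of stochastic processes (van der Vaart and Wellner). Lipschitz continuity in (4) is with respect to $\|\xi_1-\xi_2\|$, $\sup_\theta\|h_1(\theta)-h_2(\theta)\|$ and $\sup_{\theta,\tilde\theta}\|\Sigma_1(\theta,\tilde\theta)-\Sigma_2(\theta,\tilde\theta)\|$. The dependence of $m_T$, $G$, $\Sigma$ on $P$ is suppressed. The estimator $\widehat\Sigma$ is computed from the data and takes values in covariance functions; on the event (whose probability tends to zero uniformly over $\mathcal{P}_0$ by (2) and (3)) where $\widehat\Sigma$ violates every eigenvalue bound as in (4), the statistic may be defined arbitrarily. The limit in the conclusion is to be read as a limit superior. *)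

(* Defs.v *)
From HB Require Import structures.
From mathcomp Require Import all_boot all_order all_algebra.
From mathcomp Require Import all_classical all_reals all_analysis.
From mathcomp Require Import measurable_realfun.

Set Implicit Arguments.
Unset Strict Implicit.
Unset Printing Implicit Defensive.

Import Order.TTheory GRing.Theory Num.Theory.
Import numFieldNormedType.Exports.
Local Open Scope classical_set_scope.
Local Open Scope ring_scope.

(* The library norm `|x| on matrices is the entrywise maximum, hence the
   Euclidean and operator norms below. *)
Definition enorm (R : realType) (k : nat) (x : 'cV[R]_k) : R :=
  Num.sqrt (\sum_i x i 0 ^+ 2).

Definition opnorm (R : realType) (m n : nat) (A : 'M[R]_(m, n)) : R :=
  sup [set enorm (A *m x) | x in [set x | enorm x <= 1]].

(* Only used at symmetric matrices, where left eigenvectors (the library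
   convention) and right eigenvectors have the same eigenvalues, all real. *)
Definition lambda_min (R : realType) (k : nat) (A : 'M[R]_k) : R :=
  inf [set a | eigenvalue A a].

Definition lambda_max (R : realType) (k : nat) (A : 'M[R]_k) : R :=
  sup [set a | eigenvalue A a].

(* Sup-norm distances are extended: functions on S need not be bounded. *)
Definition fdist (R : realType) (S : Type) (k : nat) (h1 h2 : S -> 'cV[R]_k)
    : \bar R :=
  ereal_sup [set (enorm (h1 s - h2 s))%:E | s in setT].

Definition kdist (R : realType) (S : Type) (k : nat)
    (V1 V2 : S -> S -> 'M[R]_k) : \bar R :=
  ereal_sup [set (opnorm (V1 s t - V2 s t))%:E | s in setT & t in setT].

Definition covariance_function (R : realType) (S : Type) (k : nat)
    (V : S -> S -> 'M[R]_k) : Prop :=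
  (forall s t, V s t = (V t s)^T) /\
  (forall (n : nat) (s : 'I_n -> S) (a : 'I_n -> 'cV[R]_k),
     0 <= \sum_i \sum_j ((a i)^T *m V (s i) (s j) *m a j) 0 0).

Definition eig_bounded (R : realType) (S : Type) (k : nat) (lam : R)
    (V : S -> S -> 'M[R]_k) : Prop :=
  ((lam^-1)%:E <= ereal_inf [set (lambda_min (V s s))%:E | s in setT])%E /\
  (ereal_sup [set (lambda_max (V s s))%:E | s in setT] <= lam%:E)%E.

Definition BL1 (R : realType) (S : Type) (k : nat)
    : set ((S -> 'cV[R]_k) -> R) :=
  [set f | (forall x, `|f x| <= 1) /\
           (forall x y, ((`|f x - f y|)%:E <= fdist x y)%E)].

(* Outer expectation: infimum of E U over measurable U >= X, with values in
   the extended reals, for which E U is defined (possibly infinite). *)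
Definition outer_expectation (R : realType) (d : measure_display)
    (W : measurableType d) (P : probability W R) (X : W -> R) : \bar R :=
  ereal_inf [set (\int[P]_w U w)%E | U in
    [set U : W -> \bar R |
      [/\ measurable_fun setT U,
          ((\int[P]_w U^\+ w)%E +? - (\int[P]_w U^\- w)%E)%E &
          forall w, ((X w)%:E <= U w)%E]]].

(* N(0, v) on the line; the library's normal_prob 0 0 is not the point mass,
   so the degenerate case is separate. *)
Definition centered_normal (R : realType) (v : R) (B : set R) : \bar R :=
  if v == 0 then \d_(0 : R) B else normal_prob 0 (Num.sqrt v) B.

Definition borelV (R : realType) (k : nat) :=
  g_sigma_algebraType (@open 'cV[R]_k).

(* mu is the law N(0, V): a' xi ~ N(0, a' V a) for every a. *)
Definition normal_law (R : realType) (k : nat) (V : 'M[R]_k)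
    (mu : probability (borelV R k) R) : Prop :=
  forall (a : 'cV[R]_k) (B : set R), measurable B ->
    mu [set x : 'cV[R]_k | B ((a^T *m x) 0 0)] =
    centered_normal ((a^T *m V *m a) 0 0) B.

(* The law N(0, V) when V is a covariance matrix, and a point mass when no
   such law exists. *)
Definition normal_cV (R : realType) (k : nat) (V : 'M[R]_k)
    : probability (borelV R k) R :=
  xget (\d_((0 : 'cV[R]_k) : borelV R k) : probability (borelV R k) R) (normal_law V).

(* Gaussianity of the finite-dimensional distributions: every finite linear
   combination of coordinates of G is normal, with the variance given by V. *)
Definition centered_gaussian_process (R : realType) (S : Type) (k : nat)
    (d : measure_display) (W : measurableType d) (Q : probability W R)
    (G : W -> S -> 'cV[R]_k) (V : S -> S -> 'M[R]_k) : Prop :=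
  covariance_function V /\
  forall (n : nat) (s : 'I_n -> S) (a : 'I_n -> 'cV[R]_k),
    let X := fun w => \sum_i ((a i)^T *m G w (s i)) 0 0 in
    measurable_fun setT X /\
    forall B : set R, measurable B ->
      Q (X @^-1` B) =
      centered_normal (\sum_i \sum_j ((a i)^T *m V (s i) (s j) *m a j) 0 0) B.

(* The standing convention on the limit in weak convergence of processes:
   G is Borel measurable and tight for the topology of uniform convergence
   (the Euclidean and entrywise-maximum norms on R^k give the same one). *)
Definition tight_borel (R : realType) (S : choiceType) (k : nat)
    (d : measure_display) (W : measurableType d) (Q : probability W R)
    (G : W -> S -> 'cV[R]_k) : Prop :=
  (forall U : set {uniform S -> 'cV[R]_k}, open U -> measurable (G @^-1` U)) /\
  (forall e : R, 0 < e -> exists K : set {uniform S -> 'cV[R]_k},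
     compact K /\ ((1 - e)%:E <= Q (G @^-1` K))%E).

(* invmx A is A itself for singular A; here the eigenvalue bound makes
   V(s0, s0) invertible. *)
Definition stat_dom (R : realType) (S : Type) (k : nat) (s0 : S) (lam C : R)
    : set ('cV[R]_k * (S -> 'cV[R]_k) * (S -> S -> 'M[R]_k)) :=
  [set p | [/\ p.1.2 s0 = 0, covariance_function p.2, eig_bounded lam p.2 &
               (p.1.1^T *m invmx (p.2 s0 s0) *m p.1.1) 0 0 <= C]].

Definition bounded_lipschitz_stat (R : realType) (S : Type) (k : nat) (s0 : S)
    (stat : 'cV[R]_k -> (S -> 'cV[R]_k) -> (S -> S -> 'M[R]_k) -> R) : Prop :=
  forall C lam : R, 0 < C -> 0 < lam ->
  exists K : R, 0 < K /\
    (forall xi h V, stat_dom s0 lam C (xi, h, V) -> `|stat xi h V| <= K) /\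
    (forall xi1 h1 V1 xi2 h2 V2,
       stat_dom s0 lam C (xi1, h1, V1) -> stat_dom s0 lam C (xi2, h2, V2) ->
       ((`|stat xi1 h1 V1 - stat xi2 h2 V2|)%:E <=
        K%:E * ((enorm (xi1 - xi2))%:E + fdist h1 h2 + kdist V1 V2))%E).

Definition hproc (R : realType) (S : Type) (k : nat) (s0 : S)
    (g : S -> 'cV[R]_k) (V : S -> S -> 'M[R]_k) : S -> 'cV[R]_k :=
  fun s => g s - V s s0 *m invmx (V s0 s0) *m g s0.

Definition critical_value (R : realType) (S : Type) (k : nat) (s0 : S)
    (alpha : R)
    (stat : 'cV[R]_k -> (S -> 'cV[R]_k) -> (S -> S -> 'M[R]_k) -> R)
    (h : S -> 'cV[R]_k) (V : S -> S -> 'M[R]_k) : R :=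
  inf [set c : R | ((1 - alpha)%:E <=
    normal_cV (V s0 s0) [set xi : 'cV[R]_k | (stat xi h V <= c)%R])%E].

(* Main.v *)
(* The residual process h = G - Sigma(., s0) Sigma(s0, s0)^-1 G(s0) of the limit
   is independent of xi = G(s0), so that the p-value p(xi, h) of R(xi, h, Sigma)
   given h satisfies P(p <= b) <= b. Smoothed at scale eps, and with xi truncated
   to a ball, p is a Lipschitz functional of G, hence so is the test functional
   f = 1{p <= alpha + 3 eta} + 1{xi large} once the indicators are replaced by
   ramps; a multiple of f lies in BL_1. If Sigmahat is close to Sigma and the
   statistic exceeds its critical value by eps, then f(g_T - m_T) >= 1: either
   g_T(s0) is large or its p-value is at most alpha + 3 eta. Markov's inequality
   for outer expectations and the weak convergence then bound the rejection
   probability by E f(G) up to a small error.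

   Independence is available only for finite-dimensional marginals, as an
   identity between expectations of cosines. It is extended first to bounded
   Lipschitz functions of finitely many coordinates, since the bounded pointwise
   closure of the span of the functions cos(<t, x> + c) contains the indicators
   of boxes, and then to functionals of h, since tightness reduces h to a finite
   net. The laws N(0, Sigmahat) and N(0, Sigma) are compared by writing
   Sigmahat = A Sigma A' with A close to the identity. *)
Require Import Defs.
From HB Require Import structures.
From mathcomp Require Import all_boot all_order all_algebra.
From mathcomp Require Import all_classical all_reals all_analysis.
From mathcomp Require Import measurable_realfun.
From mathcomp Require Import ring lra.

Set Implicit Arguments.
Unset Strict Implicit.
Unset Printing Implicit Defensive.

Import Order.TTheory GRing.Theory Num.Theory.
Import numFieldNormedType.Exports.
Local Open Scope classical_set_scope.
Local Open Scope ring_scope.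

(** The convergence is uniform over the null family only for functionals in BL_1. The Lipschitz
    constant of the test functional, the truncation radius and the admissible error of Sigmahat are
    therefore fixed from the statistic, the eigenvalue bound, alpha, eps and eta, before P and T are
    given. This is why indicators become ramps and why tail bounds are uniform over all variances
    below a common bound. The mean m_T is not assumed bounded or convergent. It is absorbed because
    m_T(theta_0) = 0: the residual of g_T - m_T plus m_T is the residual of g_T. The functional adds
    m_T back, and once h is held fixed, h + m_T is just another fixed function. The final level
    alpha + 7 eta is made up of eta for the error of Sigmahat, 3 eta for the p-value (outliers under
    both normal laws and the change of covariance), eta for the width of the ramp, eta for large
    g_T(theta_0), and eta for the weak convergence. *)

(** * Expectations of bounded functions and normal laws *)

Section BoundedExpectation.
Context {R : realType} {d : measure_display} {W : measurableType d}.
Implicit Types (P : probability W R) (f : W -> R).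

(** The bound is pointwise, so membership does not depend on a probability and gives integrability
    under all of them at once. *)
Definition bmeas f :=
  measurable_fun setT f /\ exists B : R, forall w, `|f w| <= B.

Lemma bmeas_integrable P f : bmeas f -> P.-integrable setT (EFin \o f).
Proof.
move=> [mf [B fB]]; apply: measurable_bounded_integrable => //.
  exact: (le_lt_trans (probability_le1 P _)) (ltry _).
exists B; split; first exact: num_real.
by move=> x Bx w _; exact: le_trans (fB w) (ltW Bx).
Qed.

Lemma bmeas_cst (c : R) : bmeas (cst c : W -> R).
Proof. by split => //; exists `|c|. Qed.

Lemma bmeasD f g : bmeas f -> bmeas g -> bmeas (fun w => f w + g w).
Proof.
move=> [mf [B fB]] [mg [C gC]]; split; first exact: measurable_funD.
by exists (B + C) => w; rewrite (le_trans (ler_normD _ _))// lerD.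
Qed.

Lemma bmeasM f g : bmeas f -> bmeas g -> bmeas (fun w => f w * g w).
Proof.
move=> [mf [B fB]] [mg [C gC]]; split; first exact: measurable_funM.
by exists (B * C) => w; rewrite normrM ler_pM.
Qed.

Lemma bmeasZ c f : bmeas f -> bmeas (fun w => c * f w).
Proof. exact: bmeasM (bmeas_cst c). Qed.

Lemma bmeasB f g : bmeas f -> bmeas g -> bmeas (fun w => f w - g w).
Proof.
move=> hf [mg [C gC]]; apply: bmeasD => //; split.
  exact: measurableT_comp mg.
by exists C => w; rewrite normrN.
Qed.

Lemma bmeas_indic (A : set W) : measurable A -> bmeas (\1_A : W -> R).
Proof.
move=> mA; split; first exact: measurable_indic.
by exists 1 => w; rewrite indicE; case: (w \in A); rewrite ?normr1 ?normr0.
Qed.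

Lemma Rintegral_probability_cst P c : \int[P]_w c = c.
Proof.
rewrite Rintegral_cst//.
by have -> : (P : {measure set W -> \bar R}) setT = 1%E := probability_setT P;
  rewrite mulr1.
Qed.

Lemma Rintegral_le_mono P f g : bmeas f -> bmeas g -> (forall w, f w <= g w) ->
  \int[P]_w f w <= \int[P]_w g w.
Proof.
by move=> hf hg fg; apply: le_Rintegral => //; exact: bmeas_integrable.
Qed.

Lemma Rintegral_le_cst P f c : bmeas f -> (forall w, f w <= c) ->
  \int[P]_w f w <= c.
Proof.
move=> hf fc; rewrite -[leRHS](Rintegral_probability_cst P).
by apply: Rintegral_le_mono => //; exact: bmeas_cst.
Qed.

Lemma Rintegral_indicT P (A : set W) : measurable A ->
  \int[P]_w (\1_A w : R) = fine (P A).
Proof. by move=> mA; rewrite /Rintegral integral_indic// setIT. Qed.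

Lemma Rintegral_le_indic P f (A : set W) a b : measurable A -> bmeas f ->
  (forall w, f w <= a + b * \1_A w) -> \int[P]_w f w <= a + b * fine (P A).
Proof.
move=> mA hf fab; rewrite -Rintegral_indicT// -[X in X + _](Rintegral_probability_cst P).
rewrite -RintegralZl//; last exact/bmeas_integrable/bmeas_indic.
rewrite -RintegralD//.
- apply: Rintegral_le_mono => //; apply: bmeasD; first exact: bmeas_cst.
  exact/bmeasZ/bmeas_indic.
- exact/bmeas_integrable/bmeas_cst.
- exact/(@bmeas_integrable P (fun w => b * \1_A w))/bmeasZ/bmeas_indic.
Qed.

Lemma cvg_Rintegral_bounded P (F : nat -> W -> R) f B :
  (forall n, measurable_fun setT (F n)) -> (forall n w, `|F n w| <= B) ->
  (forall w, F n w @[n --> \oo] --> f w) ->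
  measurable_fun setT f /\ \int[P]_w F n w @[n --> \oo] --> \int[P]_w f w.
Proof.
move=> mF FB Ff.
have mf : measurable_fun setT f.
  by apply: (measurable_fun_cvg mF) => w _; exact: Ff.
split=> //.
have fB w : `|f w| <= B.
  have cf : `|F n w| @[n --> \oo] --> `|f w| by apply: cvg_norm; exact: Ff.
  rewrite -(cvg_lim _ cf)//; apply: limr_le; first by apply/cvg_ex; exists `|f w|.
  exact: nearW.
have [] := @dominated_convergence _ _ _ P setT measurableT
  (fun n w => (F n w)%:E) (fun w => (f w)%:E) (cst B%:E).
- by move=> n; exact/measurable_EFinP.
- exact/measurable_EFinP.
- by apply: aeW => w _; apply/cvg_EFin; [exact: nearW|exact: Ff].
- by apply: (@bmeas_integrable P (cst B)); exact: bmeas_cst.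
- by apply: aeW => w n _ /=; rewrite lee_fin.
move=> intf _ h; apply: fine_cvg; rewrite fineK//.
exact: integrable_fin_num.
Qed.

End BoundedExpectation.
Arguments bmeas_cst {R d W} c.

Section ProductProbability.
Context {R : realType} {d1 d2 : measure_display}.
Context {W1 : measurableType d1} {W2 : measurableType d2}.
Variables (P1 : probability W1 R) (P2 : probability W2 R).

Definition prod_prob : set (W1 * W2) -> \bar R := (P1 \x P2)%E.

HB.instance Definition _ := Measure.on prod_prob.

Let prod_prob_setT : prod_prob setT = 1%E.
Proof.
rewrite /prod_prob -setXTT [LHS]product_measure1E//.
transitivity (P1 setT * P2 setT)%E => //.
by rewrite !probability_setT mule1.
Qed.

HB.instance Definition _ :=
  Measure_isProbability.Build _ _ _ prod_prob prod_prob_setT.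

(** Tonelli's theorem for real-valued integrals. The measurability of the inner integral is also
    used alone, to see that a partial integral is an admissible integrand. *)
Lemma Rintegral_prod_ge0 (f : W1 * W2 -> R) : bmeas f -> (forall z, 0 <= f z) ->
  (forall x, bmeas (fun y => f (x, y))) /\
  bmeas (fun x => \int[P2]_y f (x, y)) /\
  \int[prod_prob]_z f z = \int[P1]_x \int[P2]_y f (x, y).
Proof.
move=> [mf [B fB]] f0.
have bf x : bmeas (fun y => f (x, y)).
  by split; [exact: measurableT_comp mf _|exists B].
have fin x : (\int[P2]_y (f (x, y))%:E)%E = (\int[P2]_y f (x, y))%:E.
  by rewrite /Rintegral fineK//; apply/integrable_fin_num/bmeas_integrable.
have mF : measurable_fun setT (fun x => \int[P2]_y f (x, y)).
  apply/measurable_EFinP.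
  have := @measurable_fun_fubini_tonelli_F _ _ _ _ _ P2 (EFin \o f).
  rewrite /fubini_F/=; under eq_fun do rewrite fin.
  by apply=> //; exact/measurable_EFinP.
split=> //; split.
  split=> //; exists B => x; apply: le_trans (le_normr_Rintegral _ _) _ => //.
    exact: bmeas_integrable.
  apply: Rintegral_le_cst => //; split; last by exists B => y; rewrite normr_id.
  by apply: measurableT_comp => //; exact: (bf x).1.
rewrite /Rintegral; congr fine.
rewrite [LHS]fubini_tonelli1//=; last exact/measurable_EFinP.
by apply: eq_integral => x _; rewrite /fubini_F/= fin.
Qed.

End ProductProbability.

Section NormalLaws.
Context {R : realType}.
Notation mu := (@lebesgue_measure R).
Implicit Types (f : R -> R) (a b m s u v x : R).

Definition normalP m s : probability (measurableTypeR R) R := normal_prob m s.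

(** The normal law is dominated by Lebesgue measure, and its Radon-Nikodym derivative agrees almost
    everywhere with [normal_pdf], both having the same integral over every measurable set. *)
Lemma integral_normalP m s f : bmeas f ->
  (\int[normalP m s]_x (f x)%:E = \int[mu]_x (f x * normal_pdf m s x)%:E)%E.
Proof.
move=> bf; have [mf _] := bf; have dom := normal_prob_dominates m s.
rewrite -(Radon_Nikodym_change_of_variables dom)//=; last first.
  exact: (@bmeas_integrable _ _ _ (normal_prob m s) f bf).
apply: ae_eq_integral => //.
- apply: emeasurable_funM; first exact/measurable_EFinP.
  by apply: (measurable_int mu); exact: Radon_Nikodym_integrable.
- apply/measurable_EFinP/measurable_funM => //; exact: measurable_normal_pdf.
- under [X in ae_eq _ _ _ X]eq_fun do rewrite EFinM.
  apply: ae_eqe_mul2l => /=.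
  rewrite Radon_NikodymE//=.
  case: cid => /= h [h1 h2 h3].
  apply: integral_ae_eq => //=.
  + by apply/measurable_EFinP; exact: measurable_normal_pdf.
  + by move=> E _ mE; rewrite -h3.
Qed.

(** Completing the square: the joint density of the first summand x and the sum u is the marginal
    density of the sum times the conditional density of x given u. Here [a], [b], [r] are standard
    deviations. *)
Lemma normal_pdfM a b u x : 0 < a -> 0 < b ->
  let r := Num.sqrt (a ^+ 2 + b ^+ 2) in
  normal_pdf 0 a x * normal_pdf 0 b (u - x) =
  normal_pdf 0 r u * normal_pdf (u * a ^+ 2 / r ^+ 2) (a * b / r) x.
Proof.
move=> a0 b0 r; have r0 : 0 < r by rewrite sqrtr_gt0 addr_gt0 ?exprn_gt0.
have r2 : r ^+ 2 = a ^+ 2 + b ^+ 2 by rewrite sqr_sqrtr// addr_ge0 ?sqr_ge0.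
have ab0 : a ^+ 2 + b ^+ 2 != 0 by rewrite -r2 gt_eqF// exprn_gt0.
have s0 : 0 < a * b / r by rewrite divr_gt0 ?mulr_gt0.
rewrite !normal_pdfE ?gt_eqF// mulrACA [RHS]mulrACA; congr (_ * _).
  rewrite /normal_peak -!invfM -!sqrtrM ?mulrn_wge0 ?mulr_ge0 ?sqr_ge0 ?pi_ge0 ?(ltW r0) ?(ltW a0)//.
  congr (_ ^-1); congr Num.sqrt; rewrite expr_div_n exprMn r2.
  by field.
rewrite /normal_fun -!expRD; congr expR; rewrite expr_div_n exprMn r2.
by field; rewrite ab0 !gt_eqF.
Qed.

Lemma ge0_integral_shift f x : continuous f -> (forall u, 0 <= f u) ->
  (\int[mu]_u (f u)%:E = \int[mu]_y (f (x + y))%:E)%E.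
Proof.
move=> cf f0.
have dF : (fun y : R => x + y)^`()%classic = cst 1.
  by apply/funext => y; rewrite derive1E deriveD// derive_cst derive_id add0r.
rewrite (@increasing_ge0_integration_by_substitutionT R (fun y => x + y) f)//.
- by apply: eq_integral => y _; rewrite dF /= !fctE /= mulr1.
- by move=> y z yz; rewrite ltrD2l.
- by rewrite dF => ?; exact: cvg_cst.
- by rewrite dF; exact: is_cvg_cst.
- by rewrite dF; exact: is_cvg_cst.
- exact: cvg_addrl_Ny.
- exact: cvg_addrl.
Qed.

(** After the substitution u = x + y and an exchange of integrals, [normal_pdfM] leaves in x only a
    conditional density, which integrates to 1. *)
Lemma normal_convolution a b f : 0 < a -> 0 < b ->
  continuous f -> bmeas f -> (forall u, 0 <= f u) ->
  (\int[normalP 0 a]_x (\int[normalP 0 b]_y f (x + y))%:E =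
   \int[normalP 0 (Num.sqrt (a ^+ 2 + b ^+ 2))]_u (f u)%:E)%E.
Proof.
move=> a0 b0 cf bf f0; set r := Num.sqrt _.
have shift_bf x : bmeas (fun y => f (x + y)).
  split; last by have [B fB] := bf.2; exists B.
  by apply: measurableT_comp => //; [exact: bf.1|exact: measurable_funD].
have cpdf s : 0 < s -> continuous (normal_pdf 0 s).
  by move=> s0; apply: continuous_normal_pdf; rewrite gt_eqF.
have inner x : (\int[normalP 0 b]_y f (x + y))%:E =
    (\int[mu]_u (f u * normal_pdf 0 b (u - x))%:E)%E.
  rewrite /Rintegral fineK; last first.
    exact: (integrable_fin_num measurableT (@bmeas_integrable _ _ _ (normalP 0 b) _ (shift_bf x))).
  rewrite (integral_normalP 0 b (shift_bf x)).
  rewrite (@ge0_integral_shift (fun u => f u * normal_pdf 0 b (u - x)) x).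
  - by apply: eq_integral => y _; rewrite addrAC subrr add0r.
  - move=> u; apply: cvgM; first exact: cf.
    apply: (@continuous_comp _ _ _ (fun u => u - x) (normal_pdf 0 b)).
      by apply: (@cvgB _ R^o); [exact: cvg_id|exact: cvg_cst].
    exact: (cpdf b b0).
  - by move=> u; rewrite mulr_ge0// normal_pdf_ge0.
have mpdf2 : measurable_fun setT (fun z : R * R =>
    (normal_pdf 0 a z.1 * (f z.2 * normal_pdf 0 b (z.2 - z.1)))%:E).
  apply/measurable_EFinP; apply: measurable_funM.
    by apply: measurableT_comp => //; exact: measurable_normal_pdf.
  apply: measurable_funM.
    by apply: measurableT_comp => //; exact: bf.1.
  apply: (measurableT_comp (measurable_normal_pdf 0 b)).
  exact: measurable_funB.
have binner : bmeas (fun x => \int[normalP 0 b]_y f (x + y)).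
  have [mf [B fB]] := bf.
  have := @Rintegral_prod_ge0 _ _ _ _ _ (normalP 0 a)
    (normalP 0 b) (fun z => f (z.1 + z.2)).
  case=> //; last by move=> _ [].
  split; last by exists B.
  by apply: measurableT_comp => //; exact: measurable_funD.
rewrite [LHS]integral_normalP//.
transitivity (\int[mu]_x \int[mu]_u
    (normal_pdf 0 a x * (f u * normal_pdf 0 b (u - x)))%:E)%E.
  apply: eq_integral => x _; rewrite mulrC EFinM inner.
  under [RHS]eq_integral do rewrite EFinM.
  rewrite ge0_integralZl//.
  - apply/measurable_EFinP/measurable_funM; first exact: bf.1.
    by apply: measurableT_comp; [exact: measurable_normal_pdf|exact: measurable_funB].
  - by move=> u _; rewrite lee_fin mulr_ge0// normal_pdf_ge0.
  - by rewrite lee_fin normal_pdf_ge0.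
rewrite (fubini_tonelli (m1 := mu) (m2 := mu) _ mpdf2)/=; last first.
  by move=> z; rewrite lee_fin !mulr_ge0// normal_pdf_ge0.
rewrite [RHS]integral_normalP//.
apply: eq_integral => u _.
under eq_integral.
  move=> x _; rewrite mulrCA normal_pdfM//= mulrA EFinM; over.
rewrite ge0_integralZl//=.
- by rewrite integral_normal_pdf mule1.
- by apply/measurable_EFinP; exact: measurable_normal_pdf.
- by move=> x _; rewrite lee_fin normal_pdf_ge0.
- by rewrite lee_fin mulr_ge0// normal_pdf_ge0.
Qed.

(** [centered_normal] as a probability measure, so that one can integrate against it, the degenerate
    case included. *)
Definition normalN v : probability (measurableTypeR R) R :=
  if v == 0 then (\d_(0 : measurableTypeR R) : probability (measurableTypeR R) R)
  else normalP 0 (Num.sqrt v).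

Lemma centered_normalE v B : centered_normal v B = normalN v B.
Proof. by rewrite /centered_normal /normalN; case: ifP. Qed.

Lemma Rintegral_dirac0 f : bmeas f ->
  \int[(\d_(0 : measurableTypeR R) : probability (measurableTypeR R) R)]_x f x = f 0.
Proof.
move=> [mf _]; rewrite /Rintegral integral_dirac//.
  by rewrite diracT mul1e.
exact/measurable_EFinP.
Qed.

Lemma normalN_convolution u v f : 0 <= u -> 0 <= v ->
  continuous f -> bmeas f -> (forall x, 0 <= f x) ->
  \int[normalN u]_x \int[normalN v]_y f (x + y) = \int[normalN (u + v)]_x f x.
Proof.
move=> u0 v0 cf bf f0.
have shift_bf x : bmeas (fun y => f (x + y)).
  split; last by have [B fB] := bf.2; exists B.
  by apply: measurableT_comp => //; [exact: bf.1|exact: measurable_funD].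
rewrite /normalN; have [->|un0] := eqVneq u 0.
  rewrite Rintegral_dirac0; first by rewrite add0r; under eq_Rintegral do rewrite add0r.
  rewrite -/(normalN v).
  have [mf [B fB]] := bf.
  (* Only the measurability and boundedness of the partial integral are wanted; the first factor of
     the product is a dummy. *)
  have := @Rintegral_prod_ge0 _ _ _ _ _ (normalN v) (normalN v) (fun z => f (z.1 + z.2)).
  case=> //; last by move=> _ [].
  split; last by exists B.
  by apply: measurableT_comp => //; exact: measurable_funD.
have u_gt0 : 0 < u by rewrite lt_neqAle eq_sym un0.
have [->|vn0] := eqVneq v 0.
  under eq_Rintegral do rewrite Rintegral_dirac0// addr0.
  by rewrite addr0 (negbTE un0).
have v_gt0 : 0 < v by rewrite lt_neqAle eq_sym vn0.
have a0 : 0 < Num.sqrt u by rewrite sqrtr_gt0.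
have b0 : 0 < Num.sqrt v by rewrite sqrtr_gt0.
have := congr1 fine (normal_convolution a0 b0 cf bf f0).
rewrite (gt_eqF (addr_gt0 u_gt0 v_gt0)).
rewrite (sqr_sqrtr u0).
rewrite (sqr_sqrtr v0).
move=> h.
rewrite /Rintegral.
exact: h.
Qed.

End NormalLaws.

Section NormalRandomVariables.
Context {R : realType}.

Definition has_normal_law {d} {W : measurableType d} (P : probability W R)
    (X : W -> R) (v : R) :=
  measurable_fun setT X /\
  forall B : set R, measurable B -> P (X @^-1` B) = centered_normal v B.

Lemma Rintegral_normal_law d (W : measurableType d) (P : probability W R)
    (X : W -> R) v (f : R -> R) :
  has_normal_law P X v -> bmeas f -> \int[P]_w f (X w) = \int[normalN v]_x f x.
Proof.
move=> [mX0 lawX] bf.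
have mX1 : @measurable_fun _ _ W (measurableTypeR R) setT X := mX0.
pose X' : {mfun W >-> measurableTypeR R} := HB.pack X (isMeasurableFun.Build _ _ W (measurableTypeR R) X mX1).
have mX : measurable_fun setT X' by [].
rewrite /Rintegral; congr fine.
transitivity (\int[distribution P X']_y (f y)%:E)%E.
  rewrite integral_distribution//.
  - by apply/measurable_EFinP; exact: bf.1.
  - apply: (@bmeas_integrable _ _ _ P (f \o X')); split.
      exact: measurableT_comp bf.1 mX.
    by have [B fB] := bf.2; exists B => w; exact: fB.
apply: eq_measure_integral => B mB _.
transitivity (centered_normal v B); last exact: centered_normalE.
by rewrite -lawX.
Qed.

Lemma cos_bmeas d (W : measurableType d) (X : W -> R) :
  measurable_fun setT X -> bmeas (fun w => cos (X w)).
Proof.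
move=> mX; split; last by exists 1 => w; exact: cos_max.
apply: measurableT_comp mX; apply: continuous_measurable_fun.
exact: continuous_cos.
Qed.

Lemma cos_affine_bmeas (c : R) : bmeas (fun x : R => cos (x + c)).
Proof. by apply: cos_bmeas; exact: measurable_funD. Qed.

(** The value for independent copies. It will be compared with a pair on a single space whose sum
    has variance u + v. *)
Lemma Rintegral_cos_normal_sum d1 d2 (W1 : measurableType d1)
    (W2 : measurableType d2) (P1 : probability W1 R) (P2 : probability W2 R)
    (X : W1 -> R) (Y : W2 -> R) u v c : 0 <= u -> 0 <= v ->
  has_normal_law P1 X u -> has_normal_law P2 Y v ->
  \int[prod_prob P1 P2]_z cos (X z.1 + Y z.2 + c) =
  \int[normalN (u + v)]_x cos (x + c).
Proof.
move=> u0 v0 lX lY.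
(* [1 + cos] is nonnegative, so that Tonelli's theorem applies. *)
pose f x := 1 + cos (x + c).
have bf : bmeas f by apply: bmeasD; [exact: bmeas_cst|exact: cos_affine_bmeas].
have f0 x : 0 <= f x.
  by have := cos_geN1 (x + c); rewrite /f; lra.
have cf : continuous f.
  move=> x; apply: cvgD; first exact: cvg_cst.
  apply: (@continuous_comp _ _ _ (fun x => x + c) cos); last exact: continuous_cos.
  by apply: (@cvgD _ R^o); [exact: cvg_id|exact: cvg_cst].
have [mX _] := lX; have [mY _] := lY.
have mXY : measurable_fun setT (fun z : W1 * W2 => X z.1 + Y z.2).
  by apply: measurable_funD; exact: measurableT_comp.
have bXY : bmeas (fun z : W1 * W2 => cos (X z.1 + Y z.2 + c)).
  by apply: cos_bmeas; exact: measurable_funD.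
have eqE d' (W' : measurableType d') (P' : probability W' R) (g : W' -> R) :
    bmeas g -> \int[P']_w (1 + g w) = 1 + \int[P']_w g w.
  move=> bg; rewrite RintegralD//; first by rewrite Rintegral_probability_cst.
  - exact/bmeas_integrable/bmeas_cst.
  - exact: bmeas_integrable.
apply: (@addrI _ 1); rewrite -!eqE//; last exact: cos_affine_bmeas.
rewrite -(normalN_convolution u0 v0 cf bf f0).
have [_ [_ ->]] := @Rintegral_prod_ge0 _ _ _ _ _ P1 P2
  (fun z => f (X z.1 + Y z.2)) (bmeasD (bmeas_cst 1) bXY) (fun z => f0 _).
have shift_bf (x : R) : bmeas (fun y : R => f (x + y)).
  split; last by have [B fB] := bf.2; exists B.
  by apply: measurableT_comp => //; [exact: bf.1|exact: measurable_funD].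
transitivity (\int[P1]_x \int[normalN v]_y f (X x + y)).
  by apply: eq_Rintegral => x _; exact: (Rintegral_normal_law lY (shift_bf (X x))).
apply: (@Rintegral_normal_law _ _ _ _ _ (fun x => \int[normalN v]_y f (x + y)) lX).
have [mf [B fB]] := bf.
have := @Rintegral_prod_ge0 _ _ _ _ _ (normalN v) (normalN v) (fun z => f (z.1 + z.2)).
case=> //; last by move=> _ [].
split; last by exists B.
by apply: measurableT_comp => //; exact: measurable_funD.
Qed.

(** After cancellation the claim is t <= s exp(D). Since exp(D) >= 1 + D and D >= ((t/s)^2 - 1)/2,
    it follows from (t/s - 1)^2 >= 0. The lemma makes the tails of N(0, v) comparable for all v
    below a bound. *)
Lemma normal_pdf_le (s t x : R) : 0 < s -> s <= t -> t <= `|x| ->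
  normal_pdf 0 s x <= normal_pdf 0 t x.
Proof.
move=> s0 st tx; have t0 : 0 < t by exact: lt_le_trans st.
rewrite !normal_pdfE ?gt_eqF// /normal_fun /normal_peak subr0.
have peakE (r : R) : 0 < r ->
    (Num.sqrt (r ^+ 2 * pi *+ 2))^-1 = (Num.sqrt (pi *+ 2))^-1 * r^-1.
  move=> r0; rewrite -mulrnAr sqrtrM ?sqr_ge0// sqrtr_sqr gtr0_norm//.
  by rewrite invfM mulrC.
rewrite !peakE// -!mulrA ler_wpM2l ?invr_ge0 ?sqrtr_ge0//.
pose D := x ^+ 2 / (s ^+ 2 *+ 2) - x ^+ 2 / (t ^+ 2 *+ 2).
have -> : expR (- x ^+ 2 / (s ^+ 2 *+ 2)) =
    expR (- x ^+ 2 / (t ^+ 2 *+ 2)) * (expR D)^-1.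
  by rewrite -expRN -expRD /D; congr expR; lra.
rewrite mulrCA [leRHS]mulrC ler_wpM2l ?expR_ge0// -invfM lef_pV2 ?posrE//; last first.
  by rewrite mulr_gt0 ?expR_gt0.
apply: le_trans (_ : s * (1 + D) <= _); last first.
  by rewrite ler_pM2l// expR_ge1Dx.
have x2 : t ^+ 2 <= x ^+ 2.
  by rewrite -[leRHS]real_normK ?num_real// lerXn2r// ?nnegrE ltW.
have DE : D = x ^+ 2 * ((s ^+ 2 *+ 2)^-1 - (t ^+ 2 *+ 2)^-1) by rewrite /D; ring.
have st2 : 0 <= (s ^+ 2 *+ 2)^-1 - (t ^+ 2 *+ 2)^-1.
  rewrite subr_ge0 lef_pV2 ?posrE ?pmulrn_lgt0 ?exprn_gt0//.
  by rewrite lerMn2r/= lerXn2r// ?nnegrE ltW.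
have : t ^+ 2 * ((s ^+ 2 *+ 2)^-1 - (t ^+ 2 *+ 2)^-1) <= D by rewrite DE ler_wpM2r.
have -> : t ^+ 2 * ((s ^+ 2 *+ 2)^-1 - (t ^+ 2 *+ 2)^-1) = (t / s) ^+ 2 / 2 - 1 / 2.
  by field; rewrite !gt_eqF.
move=> DD; rewrite -ler_pdivrMl// mulrC.
by have := sqr_ge0 (t / s - 1); rewrite sqrrB1 ; lra.
Qed.

(** One threshold serves all variances up to [v0]. Beyond sqrt(v0) every density lies below that of
    N(0, v0), whose tails vanish by continuity from above; the threshold is the larger of the two
    radii. *)
Lemma centered_normal_tail (v0 eta : R) : 0 < v0 -> 0 < eta ->
  exists2 M : R, 0 < M & forall v M', 0 <= v <= v0 -> M <= M' ->
    (centered_normal v [set x : R | (M' < `|x|)%R] <= eta%:E)%E.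
Proof.
move=> v00 eta0; pose t := Num.sqrt v0.
have t0 : 0 < t by rewrite sqrtr_gt0.
have mA (M : R) : measurable [set x : R | M < `|x|].
  have -> : [set x : R | M < `|x|] = setT `&` (fun x : R => `|x|) @^-1` `]M, +oo[%classic.
    by rewrite setTI; apply/seteqP; split => x /=; rewrite in_itv/= andbT.
  have mn : measurable_fun setT (fun x : R => `|x|) by exact: measurableT_comp.
  by apply: mn => //; exact: measurable_itv.
pose A (n : nat) : set R := [set x | n%:R < `|x|].
have capA : \bigcap_n A n = set0.
  rewrite -subset0 => x /(_ (Num.truncn `|x|).+1 I) h.
  by have := lt_trans (h : _ < `|x|) (truncnS_gt _); rewrite ltxx.
have : normal_prob 0 t (A n) @[n --> \oo] --> normal_prob 0 t (\bigcap_n A n).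
  apply: nonincreasing_cvg_mu => //.
  - apply: (le_lt_trans (probability_le1 (normal_prob 0 t) (mA _))); exact: ltry.
  - by move=> n; exact: mA.
  - by rewrite capA; exact: measurable0.
  - move=> m n mn; apply/subsetPset => x /=; apply: le_lt_trans.
    by rewrite ler_nat.
rewrite capA measure0 => /fine_cvg/cvgrPdist_lt/(_ _ eta0)[N _ /(_ N (leqnn _))] /=.
rewrite sub0r normrN => tailN.
exists (Num.max t N%:R); first by rewrite lt_max t0.
move=> v M' /andP[v_ge0 vv0]; rewrite ge_max => /andP[tM' NM'].
rewrite /centered_normal; have [_|vn0] := eqVneq v 0.
  by rewrite diracE memNset ?lee_fin ?ltW//= normr0; apply/negP; rewrite -leNgt; lra.
have v_gt0 : 0 < v by rewrite lt_neqAle eq_sym vn0.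
apply: (@le_trans _ _ (normal_prob 0 t [set x : R | (M' < `|x|)%R])).
  apply: ge0_le_integral => //.
  - exact: mA.
  - by move=> x _; rewrite lee_fin normal_pdf_ge0.
  - by apply/measurable_funTS/measurable_EFinP; exact: measurable_normal_pdf.
  - by apply/measurable_funTS/measurable_EFinP; exact: measurable_normal_pdf.
  - move=> x /= M'x; rewrite lee_fin; apply: normal_pdf_le.
    + by rewrite sqrtr_gt0.
    + by apply: ler_wsqrtr.
    + exact: le_trans tM' (ltW M'x).
apply: (@le_trans _ _ (normal_prob 0 t (A N))).
  apply: le_measure; rewrite ?inE//; [exact: mA|exact: mA|].
  by move=> x /=; exact: le_lt_trans.
rewrite -(@fineK _ (normal_prob 0 t (A N))) ?fin_num_measure//; last exact: mA.
by rewrite lee_fin ltW// (le_lt_trans (ler_norm _)).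
Qed.

End NormalRandomVariables.

(** * The Cramer-Wold device *)

Section TrigClosure.
Context {R : realType} {I : finType}.
Implicit Types (F G : (I -> R) -> R) (x t : I -> R) (a c : R).

(* These functions have expectations determined by the characteristic function.
   The class is stable under products since cos a * cos b is a half-sum of
   cosines. *)
Inductive trig_closure : ((I -> R) -> R) -> Prop :=
| trig_cos t c : trig_closure (fun x => cos (\sum_i t i * x i + c))
| trig_add F G : trig_closure F -> trig_closure G ->
    trig_closure (fun x => F x + G x)
| trig_scale a F : trig_closure F -> trig_closure (fun x => a * F x)
| trig_lim (F : nat -> (I -> R) -> R) G B :
    (forall n, trig_closure (F n)) -> (forall n x, `|F n x| <= B) ->
    (forall x, F n x @[n --> \oo] --> G x) -> trig_closure G.

Lemma trig_bounded F : trig_closure F -> exists B : R, forall x, `|F x| <= B.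
Proof.
elim=> [t c|{}F G _ [B FB] _ [C GC]|a {}F _ [B FB]|Fn G B _ _ FnB FG].
- by exists 1 => x; exact: cos_max.
- by exists (B + C) => x; rewrite (le_trans (ler_normD _ _))// lerD.
- by exists (`|a| * B) => x; rewrite normrM ler_wpM2l.
- exists B => x; have cf : `|Fn n x| @[n --> \oo] --> `|G x|.
    by apply: cvg_norm; exact: FG.
  rewrite -(cvg_lim _ cf)//; apply: limr_le; first by apply/cvg_ex; exists `|G x|.
  exact: nearW.
Qed.

Lemma trig_cst a : trig_closure (fun=> a).
Proof.
have := trig_scale a (trig_cos (fun=> 0) 0); congr trig_closure.
apply/funext => x; rewrite big1 ?addr0 ?cos0 ?mulr1// => i _.
by rewrite mul0r.
Qed.

Lemma trig_mul F G : trig_closure F -> trig_closure G ->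
  trig_closure (fun x => F x * G x).
Proof.
move=> tF; elim: tF G => [t c|F1 F2 _ IH1 _ IH2|a {}F _ IH|Fn {}F B tFn IH FnB FnF] G tG.
- elim: tG => [s e|G1 G2 _ IH1 _ IH2|a {}G _ IH|Gn {}G B _ IH GnB GnG].
  + have := trig_scale (2^-1) (trig_add (trig_cos (fun i => t i + s i) (c + e))
      (trig_cos (fun i => t i - s i) (c - e))).
    congr trig_closure; apply/funext => x.
    have -> : \sum_i (t i + s i) * x i + (c + e) =
        (\sum_i t i * x i + c) + (\sum_i s i * x i + e).
      by rewrite addrACA -big_split/=; congr (_ + _); apply: eq_bigr => i _; rewrite mulrDl.
    have -> : \sum_i (t i - s i) * x i + (c - e) =
        (\sum_i t i * x i + c) - (\sum_i s i * x i + e).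
      rewrite opprD addrACA -sumrB; congr (_ + _); apply: eq_bigr => i _.
      by rewrite mulrBl.
    by rewrite cosD cosB; field.
  + have := trig_add IH1 IH2; congr trig_closure; apply/funext => x.
    by rewrite mulrDr.
  + have := trig_scale a IH; congr trig_closure; apply/funext => x.
    by rewrite mulrCA.
  + apply: (trig_lim (B := B) IH) => [n x|x].
      by rewrite normrM -[leRHS]mul1r ler_pM//; exact: cos_max.
    by apply: cvgM; [exact: cvg_cst|exact: GnG].
- have := trig_add (IH1 _ tG) (IH2 _ tG); congr trig_closure; apply/funext => x.
  by rewrite mulrDl.
- have := trig_scale a (IH _ tG); congr trig_closure; apply/funext => x.
  by rewrite mulrA.
- have [C GC] := trig_bounded tG.
  apply: (trig_lim (B := B * C) (fun n => IH n _ tG)) => [n x|x].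
    by rewrite normrM ler_pM.
  by apply: cvgM; [exact: FnF|exact: cvg_cst].
Qed.

Lemma trig_sum (J : Type) (s : seq J) (F : J -> (I -> R) -> R) :
  (forall j, trig_closure (F j)) -> trig_closure (fun x => \sum_(j <- s) F j x).
Proof.
move=> tF; elim: s => [|j s IH].
  by have := trig_cst 0; congr trig_closure; apply/funext => x; rewrite big_nil.
have := trig_add (tF j) IH; congr trig_closure; apply/funext => x.
by rewrite big_cons.
Qed.

End TrigClosure.

(* The iterates of (3u - u^3)/2 converge on [-1, 1] to the sign function. *)
Section SignIterates.
Context {R : realType}.
Implicit Types u : R.

Definition sign_step u := (3 * u - u ^+ 3) / 2.

Lemma sign_iter_bound u n : 0 < u -> u <= 1 ->
  u <= iter n sign_step u /\ iter n sign_step u <= 1.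
Proof.
move=> u0 u1; elim: n => [//|n [IH1 IH2]] /=.
set v := iter n _ u in IH1 IH2 *; rewrite /sign_step.
have v0 : 0 < v by lra.
split; first by apply: le_trans IH1 _; nra.
rewrite -subr_ge0.
have <- : (1 - v) ^+ 2 * (v + 2) / 2 = 1 - (3 * v - v ^+ 3) / 2 by field.
by rewrite divr_ge0// mulr_ge0 ?sqr_ge0//; lra.
Qed.

Lemma sign_iterN u n : iter n sign_step (- u) = - iter n sign_step u.
Proof. by elim: n => //= n ->; rewrite /sign_step; field. Qed.

Lemma sign_step_fixpoint u : 0 < u -> sign_step u = u -> u = 1.
Proof.
rewrite /sign_step => u0 ll; have : u * (1 - u) * (1 + u) = 0.
  have -> : u * (1 - u) * (1 + u) = 2 * ((3 * u - u ^+ 3) / 2 - u) by field.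
  by rewrite ll subrr mulr0.
by move=> /eqP; rewrite !mulf_eq0 => /orP[/orP[]|] /eqP; lra.
Qed.

(** The iterates increase and stay below 1, so they converge; by continuity the limit is a positive
    fixed point. *)
Lemma sign_iter_cvg_gt0 u : 0 < u -> u <= 1 -> iter n sign_step u @[n --> \oo] --> (1 : R).
Proof.
move=> u0 u1; set v := fun n => iter n sign_step u.
have vb n : u <= v n /\ v n <= 1 by exact: sign_iter_bound.
have ndv : nondecreasing_seq v.
  apply/nondecreasing_seqP => n; rewrite /v /= -/(v n) /sign_step.
  have [h1 h2] := vb n; have : 0 < v n by lra.
  by move: h2; generalize (v n) => z; nra.
have cv : cvgn v.
  by apply: nondecreasing_is_cvgn => //; exists 1 => _ [n _ <-]; exact: (vb n).2.
set l := limn v in cv; have vl : v n @[n --> \oo] --> l by exact: cv.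
have lu : u <= l by apply: limr_ge => //; apply: nearW => n; exact: (vb n).1.
have ll : sign_step l = l.
  have h1 : sign_step (v n) @[n --> \oo] --> sign_step l.
    apply: (cvg_comp v sign_step vl); apply: cvgM; last exact: cvg_cst.
    apply: cvgB; last exact: exprn_continuous.
    by apply: cvgM; [exact: cvg_cst|exact: cvg_id].
  have h2 : v n.+1 @[n --> \oo] --> l by rewrite (@cvg_shiftS _ v).
  by rewrite -[LHS](cvg_lim _ h1)// -[RHS](cvg_lim _ h2).
have l1 : l = 1 by apply: sign_step_fixpoint => //; exact: lt_le_trans lu.
by rewrite -l1.
Qed.

Lemma sign_iter_cvg u : -1 <= u <= 1 ->
  iter n sign_step u @[n --> \oo] --> Num.sg u.
Proof.
move=> /andP[uN1 u1]; have [u0|u0|->] := ltgtP u 0.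
- rewrite ltr0_sg// -[u]opprK; under eq_fun do rewrite sign_iterN.
  by apply: cvgN; apply: sign_iter_cvg_gt0; lra.
- by rewrite gtr0_sg//; exact: sign_iter_cvg_gt0.
- rewrite sgr0; suff h n : iter n sign_step (0 : R) = 0.
    by under eq_fun do rewrite h; exact: cvg_cst.
  by elim: n => //= n ->; rewrite /sign_step; field.
Qed.

Lemma sign_iter_le1 u n : -1 <= u <= 1 -> `|iter n sign_step u| <= 1.
Proof.
move=> /andP[uN1 u1]; have [u0|u0|->] := ltgtP u 0.
- rewrite -[u]opprK sign_iterN normrN ler_norml.
  by have [] := @sign_iter_bound (- u) n; lra.
- by rewrite ler_norml; have [] := @sign_iter_bound u n; lra.
- suff -> : iter n sign_step (0 : R) = 0 by rewrite normr0.
  by elim: n => //= n ->; rewrite /sign_step; field.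
Qed.

End SignIterates.

Section TrigDense.
Context {R : realType} {I : finType}.
Implicit Types (F G : (I -> R) -> R) (x t : I -> R) (a b c : R) (i : I).

Lemma trig_sin i a c : trig_closure (fun x => sin (a * (x i - c))).
Proof.
have := @trig_cos R I (fun j => if j == i then a else 0) (- (a * c) - pi / 2).
congr trig_closure; apply/funext => x.
rewrite (bigD1 i)//= eqxx big1 ?addr0; last first.
  by move=> j /negbTE ->; rewrite mul0r.
by rewrite addrA cosBpihalf mulrBr.
Qed.

Lemma trig_sign_iter n F : trig_closure F ->
  trig_closure (fun x => iter n sign_step (F x)).
Proof.
move=> tF; elim: n => [//|n IH].
have := trig_add (trig_scale (3 / 2) IH)
  (trig_scale (- 2^-1) (trig_mul IH (trig_mul IH IH))).
congr trig_closure; apply/funext => x /=.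
by move: (iter n _ _) => v; rewrite /sign_step; field.
Qed.

Lemma trig_sg_sin i a c : trig_closure (fun x => Num.sg (sin (a * (x i - c)))).
Proof.
have sinb (y : R) : -1 <= sin y <= 1 by rewrite sin_geN1 sin_le1.
apply: (@trig_lim _ _ (fun n x => iter n sign_step (sin (a * (x i - c)))) _ 1).
- by move=> n; apply: trig_sign_iter; exact: trig_sin.
- by move=> n x; exact: sign_iter_le1.
- by move=> x; exact: sign_iter_cvg.
Qed.

Lemma sg_sin (y : R) : `|y| < pi -> Num.sg (sin y) = Num.sg y.
Proof.
have [y0|y0|->] := ltgtP y 0; last by rewrite sin0.
- rewrite ltr0_norm// => ypi; rewrite [RHS]ltr0_sg// ltr0_sg// -oppr_gt0 -sinN.
  by apply: sin_gt0_pi; rewrite oppr_gt0 y0.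
- rewrite gtr0_norm// => ypi; rewrite [RHS]gtr0_sg// gtr0_sg//.
  by apply: sin_gt0_pi; rewrite y0.
Qed.

(** The sine has the sign of its argument only on (-pi, pi). Dividing the argument by n + 1 brings
    any given point into that interval, so the sequence is eventually constant at each point. *)
Lemma trig_sg i c : trig_closure (fun x => Num.sg (x i - c)).
Proof.
apply: (@trig_lim _ _ (fun n x => Num.sg (sin (n.+1%:R^-1 * (x i - c)))) _ 1).
- by move=> n; exact: trig_sg_sin.
- by move=> n x; rewrite normr_sg; case: (_ != _); rewrite ?lexx ?ler01.
- move=> x; apply: cvg_near_cst; exists (Num.truncn `|x i - c|) => // n /= hn.
  rewrite sg_sin; last first.
    rewrite normrM ger0_norm ?invr_ge0// mulrC ltr_pdivrMr//.
    apply: (lt_le_trans (truncnS_gt _)); rewrite -[leLHS]mul1r ler_pM//.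
      by have := pi_ge2 R; lra.
    by rewrite ler_nat ltnS.
  by rewrite sgrM gtr0_sg ?invr_gt0// mul1r.
Qed.

(** For a sign s, (s^2 - s)/2 is the indicator of s = -1. It yields x_i < b directly and a <= x_i as
    a complement. *)
Lemma trig_indic i a b :
  trig_closure (fun x => ((a <= x i) && (x i < b))%:R).
Proof.
have h c := trig_mul (trig_sg i c) (trig_sg i c).
have := trig_mul
  (trig_add (trig_cst 1) (trig_scale (- 2^-1)
     (trig_add (h a) (trig_scale (-1) (trig_sg i a)))))
  (trig_scale (2^-1) (trig_add (h b) (trig_scale (-1) (trig_sg i b)))).
congr trig_closure; apply/funext => x.
have e1 : 1 + - 2^-1 * (Num.sg (x i - a) * Num.sg (x i - a) +
    -1 * Num.sg (x i - a)) = (a <= x i)%R%:R.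
  case: sgrP; rewrite ?subr_gt0 ?subr_lt0.
  - by move=> /eqP; rewrite subr_eq0 => /eqP ->; rewrite lexx/=; field.
  - by move=> ax; rewrite (ltW ax)/=; field.
  - by move=> xa; rewrite leNgt xa/=; field.
have e2 : 2^-1 * (Num.sg (x i - b) * Num.sg (x i - b) +
    -1 * Num.sg (x i - b)) = (x i < b)%R%:R.
  case: sgrP; rewrite ?subr_gt0 ?subr_lt0.
  - by move=> /eqP; rewrite subr_eq0 => /eqP ->; rewrite ltxx/=; field.
  - by move=> bx; rewrite ltNge (ltW bx)/=; field.
  - by move=> -> /=; field.
by rewrite e1 e2 -natrM mulnb.
Qed.

Definition upd x i c : I -> R := fun j => if j == i then c else x j.

Definition grid_pt (M j : nat) : R := j%:R / M%:R - M%:R.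

(** Rounds coordinate [i] down to a grid of 2 M^2 cells of width 1/M covering [-M, M), with value 0
    outside. Each term is a function that no longer reads coordinate [i] times the indicator of a
    cell, so [trig_mul] applies. *)
Definition grid_approx F i (M : nat) x : R :=
  \sum_(j < (M * M).*2) F (upd x i (grid_pt M j)) *
    ((grid_pt M j <= x i) && (x i < grid_pt M j.+1))%:R.

(** The cell number is the integer part of (y + M) M. The sign guard excludes negative values, which
    [Num.truncn] sends to 0. *)
Lemma grid_ptP M j (y : R) : (0 < M)%N ->
  (grid_pt M j <= y) && (y < grid_pt M j.+1) =
  (0 <= (y + M%:R) * M%:R) && (Num.truncn ((y + M%:R) * M%:R) == j).
Proof.
move=> M0; have M0' : 0 < M%:R :> R by rewrite ltr0n.
rewrite /grid_pt lerBlDr ltrBrDr ler_pdivrMr// ltr_pdivlMr//.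
have [y0|y0] := leP 0 ((y + M%:R) * M%:R); first by rewrite truncn_eq.
by apply/negbTE; rewrite negb_and -ltNge (lt_le_trans y0).
Qed.

Lemma grid_approxE F i M x : (0 < M)%N ->
  let y := (x i + M%:R) * M%:R in
  grid_approx F i M x =
  if (0 <= y) && (Num.truncn y < (M * M).*2)%N
  then F (upd x i (grid_pt M (Num.truncn y))) else 0.
Proof.
move=> M0 y; rewrite /grid_approx; case: ifPn => [/andP[y0 yM]|].
  rewrite (bigD1 (Ordinal yM))//= grid_ptP// -/y y0 eqxx mulr1 big1 ?addr0//.
  move=> j jy; rewrite grid_ptP// -/y y0/=.
  by rewrite eq_sym (_ : (_ == _) = false) ?mulr0//; apply: contraNF jy => /eqP jy; apply/eqP/val_inj.
move=> yM; rewrite big1// => j _; rewrite grid_ptP// -/y.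
case: (0 <= y) yM => //=; last by rewrite mulr0.
by case: eqP => [->|]; [rewrite ltn_ord|rewrite mulr0].
Qed.

Lemma grid_approx_cvg F i x L :
  (forall c, `|F x - F (upd x i c)| <= L * `|x i - c|) ->
  grid_approx F i n.+1 x @[n --> \oo] --> F x.
Proof.
move=> FL; apply/cvgrPdist_lt => e e0.
near=> n; set M := n.+1.
have M0 : 0 < M%:R :> R by rewrite ltr0n.
have xM : `|x i| < M%:R.
  apply: (lt_le_trans (truncnS_gt _)); rewrite ler_nat ltnS; near: n.
  exact: nbhs_infty_ge.
have /andP[x1 x2] : - M%:R < x i < M%:R by rewrite -ltr_norml.
have y0 : 0 <= (x i + M%:R) * M%:R by rewrite mulr_ge0//; lra.
rewrite grid_approxE//= y0 /=.
have -> : (Num.truncn ((x i + M%:R) * M%:R) < (M * M).*2)%N.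
  rewrite -(ltr_nat R); apply: (@le_lt_trans _ _ ((x i + M%:R) * M%:R)).
    by rewrite truncn_le.
  by rewrite -mul2n !natrM mulrA ltr_pM2r//; lra.
apply: (le_lt_trans (FL _)).
set j := Num.truncn _.
have /andP[j1 j2] : (grid_pt M j <= x i) && (x i < grid_pt M j.+1).
  by rewrite grid_ptP// y0 eqxx.
have jj : grid_pt M j.+1 = grid_pt M j + M%:R^-1.
  by rewrite /grid_pt -(natr1 j); field; rewrite gt_eqF.
rewrite ger0_norm ?subr_ge0//.
apply: (@le_lt_trans _ _ (`|L| * M%:R^-1)).
  apply: (le_trans (ler_wpM2r _ (ler_norm L))); first by rewrite subr_ge0.
  by rewrite ler_wpM2l//; lra.
rewrite ltr_pdivrMr// mulrC -ltr_pdivrMr//.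
apply: (lt_le_trans (truncnS_gt _)); rewrite ler_nat ltnS; near: n.
exact: nbhs_infty_ge.
Unshelve. all: by end_near. Qed.

Lemma trig_lipschitz_on n (J : {set I}) F B L : (#|J| <= n)%N ->
  (forall x, `|F x| <= B) ->
  (forall x y, `|F x - F y| <= L * \sum_i `|x i - y i|) ->
  (forall x y, {in J, x =1 y} -> F x = F y) ->
  trig_closure F.
Proof.
elim: n J F => [|n IH] J F Jn FB FL FJ.
  have J0 : J = finset.set0 by apply/eqP; rewrite -cards_eq0 -leqn0.
  have -> : F = fun=> F (fun=> 0); last exact: trig_cst.
  by apply/funext => x; apply: FJ => i; rewrite J0 inE.
have [J0|[i iJ]] := set_0Vmem J.
  by apply: (IH J) => //; rewrite J0 cards0.
have B0 : 0 <= B by exact: le_trans (FB (fun=> 0)).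
have updl x y c : \sum_j `|upd x i c j - upd y i c j| <= \sum_j `|x j - y j|.
  by apply: ler_sum => j _; rewrite /upd; case: ifP => // _; rewrite subrr normr0.
(* A negative constant forces F to be constant, hence to depend on no coordinate. *)
have [L0|L0] := leP 0 L; last first.
  apply: (IH finset.set0); rewrite ?cards0// => x y _.
  apply/eqP; rewrite -subr_eq0 -normr_le0; apply: le_trans (FL _ _) _.
  by rewrite mulr_le0_ge0 ?(ltW L0)// sumr_ge0.
apply: (@trig_lim _ _ (fun n => grid_approx F i n.+1) _ B).
- move=> m; apply: trig_sum => j; apply: trig_mul; last exact: trig_indic.
  apply: (IH (J :\ i)) => [|x|x y|x y xy].
  + by move: Jn; rewrite (cardsD1 i) iJ.
  + exact: FB.
  + by apply: le_trans (FL _ _) _; rewrite ler_wpM2l.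
  + apply: FJ => k kJ; rewrite /upd; case: eqP => // /eqP ki.
    by apply: xy; rewrite !inE ki.
- move=> m x; rewrite grid_approxE//=; case: ifP => _; first exact: FB.
  by rewrite normr0.
- move=> x; apply: (@grid_approx_cvg _ _ _ L) => c.
  apply: le_trans (FL _ _) _; rewrite (bigD1 i)//= /upd eqxx big1 ?addr0//.
  by move=> j /negbTE ->; rewrite subrr normr0.
Qed.

Lemma trig_lipschitz F B L : (forall x, `|F x| <= B) ->
  (forall x y, `|F x - F y| <= L * \sum_i `|x i - y i|) ->
  trig_closure F.
Proof.
move=> FB FL; apply: (@trig_lipschitz_on _ [set: I]%SET _ B L) => // x y xy.
by congr F; apply/funext => i; apply: xy.
Qed.

End TrigDense.

Section CramerWold.
Context {R : realType} {I : finType}.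

Lemma trig_closure_bmeas d (W : measurableType d) (X : W -> I -> R) F :
  (forall i, measurable_fun setT (X ^~ i)) ->
  trig_closure F -> bmeas (fun w => F (X w)).
Proof.
move=> mX tF; split; last first.
  by have [B FB] := trig_bounded tF; exists B => w; exact: FB.
elim: tF => [t c|F1 F2 _ IH1 _ IH2|a {}F _ IH|Fn G B _ IH FnB FnG].
- apply: (cos_bmeas _).1; apply: measurable_funD => //.
  by apply: measurable_sum => i; exact: measurable_funM.
- exact: measurable_funD.
- exact: measurable_funM.
- by apply: (measurable_fun_cvg IH) => w _; exact: FnG.
Qed.

(** Equality of expectations is given for cosines; it survives sums and multiples by linearity and
    bounded pointwise limits by dominated convergence, hence holds on all of [trig_closure]. *)
Theorem cramer_wold d1 d2 (W1 : measurableType d1) (W2 : measurableType d2)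
    (P1 : probability W1 R) (P2 : probability W2 R)
    (X1 : W1 -> I -> R) (X2 : W2 -> I -> R) F B L :
  (forall i, measurable_fun setT (X1 ^~ i)) ->
  (forall i, measurable_fun setT (X2 ^~ i)) ->
  (forall t c, \int[P1]_w cos (\sum_i t i * X1 w i + c) =
               \int[P2]_w cos (\sum_i t i * X2 w i + c)) ->
  (forall x, `|F x| <= B) ->
  (forall x y, `|F x - F y| <= L * \sum_i `|x i - y i|) ->
  [/\ bmeas (fun w => F (X1 w)), bmeas (fun w => F (X2 w)) &
      \int[P1]_w F (X1 w) = \int[P2]_w F (X2 w)].
Proof.
move=> mX1 mX2 eqcos FB FL; have tF := trig_lipschitz FB FL.
split; [exact: trig_closure_bmeas tF|exact: trig_closure_bmeas tF|].
elim: tF {FB FL} => [t c|F1 F2 t1 IH1 t2 IH2|a {}F tF IH|Fn G C tF IH FnB FnG].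
- exact: eqcos.
- have b1 := bmeas_integrable _ (trig_closure_bmeas _ t1).
  have b2 := bmeas_integrable _ (trig_closure_bmeas _ t2).
  by rewrite !RintegralD ?IH1 ?IH2//; [exact: b1|exact: b2|exact: b1|exact: b2].
- have b := bmeas_integrable _ (trig_closure_bmeas _ tF).
  by rewrite !RintegralZl ?IH//; exact: b.
- have [_ h1] := @cvg_Rintegral_bounded _ _ _ P1 (fun n w => Fn n (X1 w))
    (fun w => G (X1 w)) C (fun n => (trig_closure_bmeas mX1 (tF n)).1)
    (fun n w => FnB n _) (fun w => FnG _).
  have [_ h2] := @cvg_Rintegral_bounded _ _ _ P2 (fun n w => Fn n (X2 w))
    (fun w => G (X2 w)) C (fun n => (trig_closure_bmeas mX2 (tF n)).1)
    (fun n w => FnB n _) (fun w => FnG _).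
  have h3 : \int[P1]_w Fn n (X1 w) @[n --> \oo] --> \int[P2]_w G (X2 w).
    by under eq_fun do rewrite IH.
  by rewrite -[LHS](cvg_lim _ h1)// -[RHS](cvg_lim _ h3).
Qed.

End CramerWold.

(** * Matrix norms and eigenvalue bounds *)

Section MatrixNorms.
Context {R : realType}.

Lemma mxnorm_entry m n (A : 'M[R]_(m, n)) i j : `|A i j| <= `|A|.
Proof.
rewrite [leRHS]/Num.norm/= mx_normrE; apply/bigmax_geP; right => /=.
by exists (i, j).
Qed.

Lemma mxnorm_le m n (A : 'M[R]_(m, n)) c : 0 <= c ->
  (forall i j, `|A i j| <= c) -> `|A| <= c.
Proof.
move=> c0 Ac; rewrite [leLHS]/Num.norm/= mx_normrE.
by apply: bigmax_le => // -[i j] _; exact: Ac.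
Qed.

Lemma mxnorm_tr m n (A : 'M[R]_(m, n)) : `|A^T| = `|A|.
Proof.
apply/eqP; rewrite eq_le; apply/andP; split; apply: mxnorm_le => // i j.
  by rewrite mxE mxnorm_entry.
by have := mxnorm_entry A^T j i; rewrite mxE.
Qed.

(** The entrywise maximum is submultiplicative only up to the inner dimension; this is one source of
    the powers of k in later constants. *)
Lemma mxnorm_mul m n p (A : 'M[R]_(m, n)) (B : 'M[R]_(n, p)) :
  `|A *m B| <= n%:R * `|A| * `|B|.
Proof.
apply: mxnorm_le => [|i j]; first by rewrite !mulr_ge0.
rewrite mxE; apply: (le_trans (ler_norm_sum _ _ _)).
apply: (@le_trans _ _ (\sum_(l < n) `|A| * `|B|)).
  by apply: ler_sum => l _; rewrite normrM ler_pM ?mxnorm_entry.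
by rewrite sumr_const card_ord -[leLHS]mulr_natl mulrA.
Qed.

Lemma mxnorm_le_enorm k (x : 'cV[R]_k) : `|x| <= enorm x.
Proof.
apply: mxnorm_le => [|i j]; first exact: sqrtr_ge0.
rewrite ord1 -sqrtr_sqr ler_wsqrtr// (bigD1 i)//= lerDl.
by apply: sumr_ge0 => ? _; exact: sqr_ge0.
Qed.

Lemma enorm_le_mxnorm k (x : 'cV[R]_k) : enorm x <= k%:R * `|x|.
Proof.
rewrite /enorm -[leRHS]ger0_norm ?mulr_ge0// -sqrtr_sqr ler_wsqrtr//.
apply: (@le_trans _ _ (\sum_(i < k) `|x| ^+ 2)).
  apply: ler_sum => i _; rewrite -[leLHS]real_normK ?num_real//.
  by rewrite lerXn2r// ?nnegrE// mxnorm_entry.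
rewrite sumr_const card_ord -[leLHS]mulr_natl exprMn ler_wpM2r ?sqr_ge0//.
by rewrite -natrX ler_nat; case: k x => // k x; rewrite expnS leq_pmulr.
Qed.

Lemma enorm_mulmx_le m n (A : 'M[R]_(m, n)) (x : 'cV[R]_n) : enorm x <= 1 ->
  enorm (A *m x) <= m%:R * n%:R * `|A|.
Proof.
move=> x1; apply: (le_trans (enorm_le_mxnorm _)); rewrite -mulrA ler_wpM2l//.
apply: (le_trans (mxnorm_mul _ _)); rewrite -[leRHS]mulr1 ler_wpM2l ?mulr_ge0//.
exact: le_trans (mxnorm_le_enorm _) x1.
Qed.

Lemma enorm0 k : enorm (0 : 'cV[R]_k) = 0.
Proof. by rewrite /enorm big1 ?sqrtr0// => i _; rewrite mxE expr0n. Qed.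

Lemma opnorm_le_mxnorm m n (A : 'M[R]_(m, n)) :
  opnorm A <= m%:R * n%:R * `|A|.
Proof.
apply: ge_sup; last by move=> _ [x /= x1 <-]; exact: enorm_mulmx_le.
by exists (enorm (A *m 0)), 0 => //=; rewrite enorm0.
Qed.

Lemma mxnorm_le_opnorm m n (A : 'M[R]_(m, n)) : `|A| <= opnorm A.
Proof.
have ub : has_ubound [set enorm (A *m x) | x in [set x | enorm x <= 1]].
  by exists (m%:R * n%:R * `|A|) => _ [x /= x1 <-]; exact: enorm_mulmx_le.
apply: mxnorm_le => [|i j].
  apply: (le_trans _ (ub_le_sup ub (_ : _ (enorm (A *m 0))))).
    exact: sqrtr_ge0.
  by exists 0 => //=; rewrite enorm0.
pose e : 'cV[R]_n := delta_mx j 0.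
have -> : A i j = (A *m e) i 0 by rewrite -colE mxE.
apply: (le_trans (mxnorm_entry _ _ _)); apply: (le_trans (mxnorm_le_enorm _)).
apply: ub_le_sup => //; exists e => //=.
rewrite /enorm (bigD1 j)//= big1 ?addr0; last first.
  by move=> l /negbTE lj; rewrite mxE lj expr0n.
by rewrite mxE !eqxx expr1n sqrtr1.
Qed.

End MatrixNorms.

Section Rayleigh.
Context {R : realType} {n : nat}.
Implicit Types (A B : 'M[R]_n) (u v : 'rV[R]_n).

Lemma mxDE m p (X Y : 'M[R]_(m, p)) i j : (X + Y) i j = X i j + Y i j.
Proof. by rewrite mxE. Qed.

Lemma mxBE m p (X Y : 'M[R]_(m, p)) i j : (X - Y) i j = X i j - Y i j.
Proof. by rewrite !mxE. Qed.

Lemma mxZE m p (a : R) (X : 'M[R]_(m, p)) i j : (a *: X) i j = a * X i j.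
Proof. by rewrite mxE. Qed.

Lemma dot_ge0 m (v : 'rV[R]_m) : 0 <= (v *m v^T) 0 0.
Proof. by rewrite mxE sumr_ge0// => i _; rewrite mxE -expr2 sqr_ge0. Qed.

Lemma dot_eq0 m (v : 'rV[R]_m) : (v *m v^T) 0 0 = 0 -> v = 0.
Proof.
rewrite mxE => /eqP; rewrite psumr_eq0 => [|i _]; last by rewrite mxE -expr2 sqr_ge0.
move=> /allP h; apply/rowP => i; have := h i (mem_index_enum _).
by rewrite !mxE mulf_eq0 orbb => /eqP.
Qed.

Lemma form_sym A u v : A^T = A -> (u *m A *m v^T) 0 0 = (v *m A *m u^T) 0 0.
Proof.
move=> sA; have -> : (u *m A *m v^T) = (v *m A *m u^T)^T.
  by rewrite !trmx_mul trmxK sA mulmxA.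
by rewrite mxE.
Qed.

Lemma psd_form_null B u v : B^T = B -> (forall v, 0 <= (v *m B *m v^T) 0 0) ->
  (u *m B *m u^T) 0 0 = 0 -> (u *m B *m v^T) 0 0 = 0.
Proof.
move=> sB B0 u0; set b := LHS; set q := (v *m B *m v^T) 0 0.
have q0 : 0 <= q by exact: B0.
have ht (t : R) : 0 <= 2 * t * b + t ^+ 2 * q.
  have := B0 (u + t *: v); rewrite linearD linearZ/= !mulmxDl !mulmxDr.
  rewrite -!scalemxAl -!scalemxAr !(mxDE, mxZE) u0 -/b (form_sym v u sB) -/b -/q.
  by move=> h; apply: le_trans h _; rewrite le_eqVlt; apply/orP; left; apply/eqP; ring.
(* The minimiser of the quadratic is -b/q; the denominator q + 1 also covers q = 0. *)
have := ht (- b / (q + 1)).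
have -> : 2 * (- b / (q + 1)) * b + (- b / (q + 1)) ^+ 2 * q =
    - (b ^+ 2 * ((q + 2) / (q + 1) ^+ 2)).
  by field; rewrite gt_eqF// ltr_wpDl.
rewrite oppr_ge0 pmulr_lle0; last first.
  by rewrite divr_gt0 ?exprn_gt0//; lra.
by move=> b2; apply/eqP; rewrite -sqrf_eq0 eq_le b2 sqr_ge0.
Qed.

Lemma form_continuous A : continuous (fun v => (v *m A *m v^T) 0 0).
Proof.
have -> : (fun v => (v *m A *m v^T) 0 0) =
    (fun v => \sum_j (\sum_i v 0 i * A i j) * v 0 j).
  by apply/funext => v; rewrite mxE; apply: eq_bigr => j _; rewrite !mxE.
have h j : continuous (fun v : 'rV[R]_n => \sum_i v 0 i * A i j).
  apply: continuous_big => [|i _ u]; first exact: add_continuous.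
  by apply: cvgM; [exact: (nbhs_filter u)|exact: coord_continuous|exact: (@cvg_cst _ _ _ _ (nbhs_filter u))].
apply: continuous_big => [|j _ v]; first exact: add_continuous.
by apply: cvgM; [exact: (nbhs_filter v)|exact: h|exact: coord_continuous].
Qed.

(** The quadratic form attains its minimum a over the compact unit sphere, at c say. Then A - a is
    positive semidefinite with a null form at c, which makes c an eigenvector. *)
Lemma rayleigh A : (0 < n)%N -> A^T = A -> exists2 a : R,
  eigenvalue A a & forall v, a * (v *m v^T) 0 0 <= (v *m A *m v^T) 0 0.
Proof.
move=> n0 sA; pose N v := (v *m v^T) 0 0.
pose S := [set v : 'rV[R]_n | N v = 1].
have cN : continuous N.
  have -> : N = (fun v => (v *m 1%:M *m v^T) 0 0).
    by apply/funext => v; rewrite mulmx1.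
  exact: form_continuous.
have S0 : S !=set0.
  exists (delta_mx 0 (Ordinal n0)); rewrite /S/= /N trmx_delta mul_delta_mx.
  by rewrite mxE.
have cS : compact S.
  apply: bounded_closed_compact.
    exists 1; split; first exact: num_real.
    move=> M M1 v /= v1; apply: le_trans (ltW M1); apply: mxnorm_le => // i j.
    rewrite ord1 -sqrtr_sqr -[leRHS]sqrtr1 ler_wsqrtr// -v1 /N mxE (bigD1 j)//=.
    rewrite mxE -expr2 lerDl sumr_ge0// => l _.
    by rewrite mxE -expr2 sqr_ge0.
  have -> : S = N @^-1` [set 1] by [].
  by apply: closed_comp; [move=> *; exact: cN|exact: closed_eq].
have [c cS' cmin] := EVT_min_rV S0 cS (continuous_subspaceT (@form_continuous A)).
set a := (c *m A *m c^T) 0 0 in cmin.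
have aN v : a * N v <= (v *m A *m v^T) 0 0.
  have [Nv0|Nv0] := eqVneq (N v) 0.
    by rewrite (dot_eq0 Nv0) /N !mul0mx !mxE mulr0.
  have Nv : 0 < N v by rewrite lt_neqAle eq_sym Nv0 dot_ge0.
  pose s := (Num.sqrt (N v))^-1.
  have s2 : s ^+ 2 = (N v)^-1 by rewrite exprVn sqr_sqrtr// ltW.
  have := cmin (s *: v).
  rewrite inE /S/= /N linearZ/= -!scalemxAl -!scalemxAr !scalerA -expr2 s2 mxZE.
  rewrite -/(N v) mulVf// => /(_ erefl).
  by rewrite mxZE ler_pdivlMl// mulrC.
exists a => //; apply/eigenvalueP; exists c; last first.
  apply/eqP => c0; move: cS'; rewrite inE /S/= /N c0 mul0mx mxE => /eqP.
  by rewrite eq_sym oner_eq0.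
pose B := A - a%:M.
have formB v : (v *m B *m v^T) 0 0 = (v *m A *m v^T) 0 0 - a * N v.
  by rewrite /B mulmxBr mulmxBl mul_mx_scalar -scalemxAl mxBE mxZE.
have sB : B^T = B by rewrite /B linearB/= sA tr_scalar_mx.
have B0 v : 0 <= (v *m B *m v^T) 0 0 by rewrite formB subr_ge0.
have cB : (c *m B *m c^T) 0 0 = 0.
  by move: cS'; rewrite inE formB /S/= => ->; rewrite mulr1 subrr.
(* Tested against the vector c B itself, the vanishing of the form says that c B has norm 0. *)
have := psd_form_null (c *m B) sB B0 cB => /dot_eq0/eqP.
by rewrite /B mulmxBr mul_mx_scalar subr_eq0 => /eqP.
Qed.

End Rayleigh.

Section EigenBounds.
Context {R : realType}.

Lemma dot_ge_sqr k (v : 'rV[R]_k) : `|v| ^+ 2 <= (v *m v^T) 0 0.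
Proof.
have N0 := dot_ge0 v.
rewrite -[leRHS]sqr_sqrtr// lerXn2r// ?nnegrE// ?sqrtr_ge0//.
apply: mxnorm_le => [|i j]; first exact: sqrtr_ge0.
rewrite ord1 -sqrtr_sqr ler_wsqrtr// mxE (bigD1 j)//= mxE -expr2 lerDl.
by apply: sumr_ge0 => l _; rewrite mxE -expr2 sqr_ge0.
Qed.

Lemma form_norm_le k (A : 'M[R]_k) (v : 'rV[R]_k) :
  `|(v *m A *m v^T) 0 0| <= k%:R ^+ 2 * `|A| * (v *m v^T) 0 0.
Proof.
apply: (le_trans (mxnorm_entry _ _ _)); apply: (le_trans (mxnorm_mul _ _)).
rewrite mxnorm_tr.
apply: (@le_trans _ _ (k%:R * (k%:R * `|v| * `|A|) * `|v|)).
  by rewrite ler_wpM2r// ler_wpM2l// mxnorm_mul.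
have -> : k%:R * (k%:R * `|v| * `|A|) * `|v| = k%:R ^+ 2 * `|A| * `|v| ^+ 2 by ring.
by rewrite ler_wpM2l ?mulr_ge0// dot_ge_sqr.
Qed.

Lemma lambda_min_form k (A : 'M[R]_k) (v : 'rV[R]_k) : (0 < k)%N -> A^T = A ->
  eigenvalue A (lambda_min A) /\
  lambda_min A * (v *m v^T) 0 0 <= (v *m A *m v^T) 0 0.
Proof.
move=> k0 sA; have [a eva aN] := rayleigh k0 sA.
suff -> : lambda_min A = a by [].
have lbA : lbound [set a | eigenvalue A a] a.
  move=> b /= /eigenvalueP[u uA un0].
  have Nu : 0 < (u *m u^T) 0 0.
    rewrite lt_neqAle dot_ge0 andbT eq_sym; apply: contra_neq un0.
    exact: dot_eq0.
  by have := aN u; rewrite uA -scalemxAl mxZE ler_pM2r.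
apply/eqP; rewrite eq_le; apply/andP; split.
  by apply: ge_inf => //; exists a.
by apply: lb_le_inf => //; exists a.
Qed.

Lemma lambda_max_form k (A : 'M[R]_k) (v : 'rV[R]_k) : (0 < k)%N -> A^T = A ->
  eigenvalue A (lambda_max A) /\
  (v *m A *m v^T) 0 0 <= lambda_max A * (v *m v^T) 0 0.
Proof.
move=> k0 sA; have sNA : (- A)^T = - A by rewrite linearN/= sA.
have [a /eigenvalueP[w wA wn0] aN] := rayleigh k0 sNA.
have aN' (u : 'rV[R]_k) : (u *m A *m u^T) 0 0 <= - a * (u *m u^T) 0 0.
  have := aN u; rewrite mulmxN mulNmx [leRHS]mxE; lra.
have eva : eigenvalue A (- a).
  apply/eigenvalueP; exists w => //.
  by rewrite scaleNr -wA mulmxN opprK.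
suff -> : lambda_max A = - a by [].
have ubA : ubound [set a | eigenvalue A a] (- a).
  move=> b /= /eigenvalueP[u uA un0].
  have Nu : 0 < (u *m u^T) 0 0.
    rewrite lt_neqAle dot_ge0 andbT eq_sym; apply: contra_neq un0.
    exact: dot_eq0.
  by have := aN' u; rewrite uA -scalemxAl mxZE ler_pM2r.
apply/eqP; rewrite eq_le; apply/andP; split.
  by apply: ge_sup => //; exists (- a).
by apply: ub_le_sup => //; exists (- a).
Qed.

Context {S : Type} {k : nat}.
Implicit Types (V : S -> S -> 'M[R]_k) (lam : R).

(** In dimension 0 there are no eigenvalues and [inf] of the empty set is 0, which contradicts the
    positive lower bound. *)
Lemma eig_bounded_dim V lam (s : S) : 0 < lam -> eig_bounded lam V -> (0 < k)%N.
Proof.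
case: k V => // V lam0 [h _].
have : ((lam^-1)%:E <= (lambda_min (V s s))%:E)%E.
  by apply: le_trans h _; apply: ereal_inf_lbound; exists s.
rewrite lee_fin /lambda_min (_ : [set a | eigenvalue (V s s) a] = set0) ?inf0.
  by rewrite invr_le0 leNgt lam0.
rewrite -subset0 => a /= /eigenvalueP[v _ /eqP]; apply.
exact: thinmx0.
Qed.

Lemma cov_sym V s : covariance_function V -> (V s s)^T = V s s.
Proof. by move=> [h _]; rewrite -h. Qed.

(** The eigenvalue bounds in the Loewner order. In this form they pass to perturbations and bound
    the inverse without reference to eigenvalues. *)
Definition form_bounded lam (A : 'M[R]_k) := forall v : 'rV[R]_k,
  lam^-1 * (v *m v^T) 0 0 <= (v *m A *m v^T) 0 0 <= lam * (v *m v^T) 0 0.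

Lemma eig_bounded_form V lam s : 0 < lam -> covariance_function V ->
  eig_bounded lam V -> form_bounded lam (V s s).
Proof.
move=> lam0 cV eV v; have k0 := eig_bounded_dim s lam0 eV; have [e1 e2] := eV.
have [_ h1] := lambda_min_form v k0 (cov_sym s cV).
have [_ h2] := lambda_max_form v k0 (cov_sym s cV).
apply/andP; split.
- apply: le_trans h1; rewrite ler_wpM2r ?dot_ge0// -lee_fin.
  by apply: le_trans e1 _; apply: ereal_inf_lbound; exists s.
- apply: le_trans h2 _; rewrite ler_wpM2r ?dot_ge0// -lee_fin.
  by apply: le_trans e2; apply: ereal_sup_ubound; exists s.
Qed.

Lemma form_bounded_eig V lam : (0 < k)%N -> covariance_function V ->
  (forall s, form_bounded lam (V s s)) -> eig_bounded lam V.
Proof.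
move=> k0 cV fV; split.
- apply: le_ereal_inf_tmp => _ [s _ <-]; rewrite lee_fin.
  have [/eigenvalueP[u uA un0] _] := lambda_min_form 0 k0 (cov_sym s cV).
  have Nu : 0 < (u *m u^T) 0 0.
    rewrite lt_neqAle dot_ge0 andbT eq_sym; apply: contra_neq un0.
    exact: dot_eq0.
  by have /andP[+ _] := fV s u; rewrite uA -scalemxAl mxZE ler_pM2r.
- apply: ge_ereal_sup => _ [s _ <-]; rewrite lee_fin.
  have [/eigenvalueP[u uA un0] _] := lambda_max_form 0 k0 (cov_sym s cV).
  have Nu : 0 < (u *m u^T) 0 0.
    rewrite lt_neqAle dot_ge0 andbT eq_sym; apply: contra_neq un0.
    exact: dot_eq0.
  by have /andP[_ +] := fV s u; rewrite uA -scalemxAl mxZE ler_pM2r.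
Qed.

(** Doubling the bound leaves room for a form of size 1/(2 lam) below and lam above. *)
Lemma form_bounded_perturb lam (A B : 'M[R]_k) : 0 < lam -> form_bounded lam A ->
  k%:R ^+ 2 * `|B - A| <= (2 * lam)^-1 -> k%:R ^+ 2 * `|B - A| <= lam ->
  form_bounded (2 * lam) B.
Proof.
move=> lam0 fA h1 h2 v; have /andP[a1 a2] := fA v.
have N0 := dot_ge0 v; set N := (v *m v^T) 0 0 in N0 a1 a2 *.
have -> : v *m B *m v^T = v *m A *m v^T + v *m (B - A) *m v^T.
  by rewrite mulmxBr mulmxBl addrC subrK.
rewrite mxDE; have := form_norm_le (B - A) v; rewrite -/N.
set X := (v *m _ *m _) 0 0 in a1 a2 *; set Y := (v *m (B - A) *m _) 0 0.
rewrite ler_norml => /andP[y1 y2].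
have e1 := ler_wpM2r N0 h1; have e2 := ler_wpM2r N0 h2.
have il : lam^-1 = 2 * (2 * lam)^-1 by field; rewrite gt_eqF.
rewrite il in a1; set z := (2 * lam)^-1 * N in e1 *.
have e3 : 2 * z <= X by rewrite /z mulrA.
have e4 : 2 * lam * N = lam * N + lam * N by ring.
by apply/andP; split; lra.
Qed.

Lemma form_bounded_unit lam (A : 'M[R]_k) : 0 < lam -> form_bounded lam A ->
  A \in unitmx.
Proof.
move=> lam0 fA; rewrite -row_free_unit; apply/row_freeP.
suff : row_free A by move=> /row_freeP.
apply: inj_row_free => v vA; apply: dot_eq0; apply/eqP.
rewrite eq_le dot_ge0 andbT.
have /andP[+ _] := fA v; rewrite vA mul0mx [leRHS]mxE.
by rewrite pmulr_rle0// invr_gt0.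
Qed.

(** Row i of the inverse, v, satisfies v A = e_i. Hence |v|^2 / lam <= v A v' = v_i <= |v|. *)
Lemma form_bounded_invmx lam (A : 'M[R]_k) : 0 < lam -> form_bounded lam A ->
  `|invmx A| <= lam.
Proof.
move=> lam0 fA; have uA := form_bounded_unit lam0 fA.
apply: mxnorm_le => [|i j]; first exact: ltW.
pose v := row i (invmx A).
have vA : v *m A = delta_mx 0 i by rewrite -row_mul mulVmx// row1.
have : (v *m A *m v^T) 0 0 <= `|v|.
  by rewrite vA -rowE mxE; apply: le_trans (ler_norm _) _; rewrite mxE mxnorm_entry.
have /andP[h _] := fA v; move=> /(le_trans h).
have := dot_ge_sqr v; set N := (v *m v^T) 0 0 => vN.
rewrite ler_pdivrMl// => /(le_trans vN); rewrite expr2.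
have -> : invmx A i j = v 0 j by rewrite mxE.
have [v0|v0] := eqVneq `|v| 0.
  by move=> _; apply: (le_trans (mxnorm_entry _ _ _)); rewrite v0 ltW.
by rewrite ler_pM2r ?lt_neqAle ?normr_ge0 ?andbT 1?eq_sym//; apply: le_trans (mxnorm_entry _ _ _).
Qed.

Lemma cov_pair_ge0 V s t (x y : 'cV[R]_k) : covariance_function V ->
  0 <= (x^T *m V s s *m x) 0 0 + (y^T *m V t t *m y) 0 0 +
       2 * (x^T *m V s t *m y) 0 0.
Proof.
move=> [sV pV].
have := pV 2%N (fun i => if i == 0 then s else t) (fun i => if i == 0 then x else y).
rewrite !big_ord_recl !big_ord0 /= !addr0.
have -> : y^T *m V t s *m x = (x^T *m V s t *m y)^T.
  by rewrite !trmx_mul trmxK -sV mulmxA.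
by rewrite [(_^T) 0 0]mxE; lra.
Qed.

Lemma form_delta (A : 'M[R]_k) i j :
  ((delta_mx i 0 : 'cV[R]_k)^T *m A *m (delta_mx j 0 : 'cV[R]_k)) 0 0 = A i j.
Proof. by rewrite trmx_delta -rowE -colE !mxE. Qed.

(** Positivity at the two points s, t with vectors e_i and e_j or -e_j bounds twice the cross entry
    by the sum of two diagonal entries. *)
Lemma cov_entry_le lam V s t : 0 < lam -> covariance_function V ->
  form_bounded lam (V s s) -> form_bounded lam (V t t) -> `|V s t| <= lam.
Proof.
move=> lam0 cV fs ft; apply: mxnorm_le => [|i j]; first exact: ltW.
have diag A l : form_bounded lam A -> A l l <= lam.
  move=> /(_ (delta_mx 0 l)) /andP[_]; rewrite trmx_delta.
  have := form_delta A l l; rewrite trmx_delta => ->.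
  by rewrite mul_delta_mx mxE !eqxx mulr1.
have h1 := cov_pair_ge0 s t (delta_mx i 0) (delta_mx j 0) cV.
have eN (A : 'M[R]_k) (x y : 'cV[R]_k) :
    (x^T *m A *m (- y)) 0 0 = - (x^T *m A *m y) 0 0.
  by rewrite mulmxN mxE.
have eNN (A : 'M[R]_k) (y : 'cV[R]_k) :
    ((- y)^T *m A *m (- y)) 0 0 = (y^T *m A *m y) 0 0.
  by rewrite eN linearN/= !mulNmx mxE opprK.
have h2 (y : 'cV[R]_k) := cov_pair_ge0 s t (delta_mx i 0) (- y) cV.
have {}h2 := h2 (delta_mx j 0).
rewrite !form_delta in h1; rewrite eNN eN !form_delta in h2.
by have := diag _ i fs; have := diag _ j ft; rewrite ler_norml; lra.
Qed.

End EigenBounds.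

Section Congruence.
Context {R : realType} {k : nat}.

HB.instance Definition _ := Complete.on 'M[R]_k.

(* With A = 1 + Y B and B the inverse of Sig, A Sig A^T = Sig + 2 Y + Y B Y; the
   equation 2 Y + Y B Y = D is solved by a contraction. *)
Lemma congruence_near (B D : 'M[R]_k) lam r : B^T = B -> D^T = D ->
  `|B| <= lam -> 0 < r -> k%:R ^+ 2 * lam * r <= 2^-1 -> `|D| <= r ->
  exists Y : 'M[R]_k, [/\ Y^T = Y, `|Y| <= r & Y + Y + Y *m B *m Y = D].
Proof.
move=> sB sD Bl r0 kr Dr.
pose U := [set Y : 'M[R]_k | `|Y| <= r].
pose f (Y : 'M[R]_k) := 2^-1 *: (D - Y *m B *m Y).
have lam0 : 0 <= lam by exact: le_trans Bl.
have mul3 (X Z : 'M[R]_k) : `|X *m B *m Z| <= k%:R ^+ 2 * lam * `|X| * `|Z|.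
  apply: (le_trans (mxnorm_mul _ _)); rewrite ler_wpM2r//.
  rewrite expr2 -!mulrA ler_wpM2l//; apply: (le_trans (mxnorm_mul _ _)).
  by rewrite -mulrA ler_wpM2l// mulrC ler_wpM2r.
have fU : {homo f : Y / U Y >-> U Y}.
  move=> Y Yr; rewrite /U/= /f normrZ gtr0_norm ?invr_gt0//.
  have h : `|Y *m B *m Y| <= 2^-1 * r.
    apply: (le_trans (mul3 _ _)); apply: (@le_trans _ _ (k%:R ^+ 2 * lam * r * r)).
      by rewrite ler_pM// ?mulr_ge0// ler_wpM2l// mulr_ge0.
    by rewrite ler_pM2r.
  have := ler_normB D (Y *m B *m Y); lra.
have ctr : is_contraction (mkfun fU).
  have h2 : (0 : R) <= 2^-1 by [].
  exists (NngNum h2); split; first by rewrite /=; lra.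
  move=> [X Z] /= [Xr Zr].
  rewrite /f -scalerBr normrZ gtr0_norm ?invr_gt0//.
  have -> : D - X *m B *m X - (D - Z *m B *m Z) =
      - (X *m B *m (X - Z)) - (X - Z) *m B *m Z.
    by rewrite mulmxBr !mulmxBl !opprB addrC subrKA [RHS]addrC subrKA.
  have hX : `|X *m B *m (X - Z)| <= 2^-1 * `|X - Z|.
    apply: (le_trans (mul3 _ _)); rewrite ler_wpM2r//; apply: le_trans kr.
    by rewrite ler_wpM2l// mulr_ge0.
  have hZ : `|(X - Z) *m B *m Z| <= 2^-1 * `|X - Z|.
    apply: (le_trans (mul3 _ _)); rewrite mulrAC ler_wpM2r//; apply: le_trans kr.
    by rewrite ler_wpM2l// mulr_ge0.
  have := ler_normB (- (X *m B *m (X - Z))) ((X - Z) *m B *m Z).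
  by rewrite normrN; lra.
have cU : closed U.
  have -> : U = (fun Y : 'M[R]_k => `|Y|) @^-1` [set x | x <= r] by [].
  by apply: closed_comp => [Y _|]; [exact: norm_continuous|exact: closed_le].
have [|Y Yr Yf] := banach_fixed_point ctr cU.
  by exists 0; rewrite /U/= normr0 ltW.
(* B and D are symmetric, so the transpose solves the same fixed-point equation; uniqueness
   applies. *)
have sY : Y^T = Y.
  apply: (contraction_fixpoint_unique ctr) => //; first by rewrite /U/= mxnorm_tr.
  rewrite [in LHS]Yf /= /f linearZ/= linearB/= !trmx_mul sB sD.
  by rewrite mulmxA.
exists Y; split=> //.
have : 2 *: Y = D - Y *m B *m Y.
  by rewrite [in LHS]Yf /= /f scalerA divff ?scale1r.
by rewrite scaler_nat mulr2n => ->; rewrite subrK.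
Qed.

(** If X has law N(0, Sig), then A X has law N(0, V) and is close to X. This couples the two laws on
    one space without matrix square roots. *)
Lemma congruence_factor (Sig V : 'M[R]_k) lam r : Sig^T = Sig -> V^T = V ->
  Sig \in unitmx -> `|invmx Sig| <= lam -> 0 < r ->
  k%:R ^+ 2 * lam * r <= 2^-1 -> `|V - Sig| <= r ->
  exists A : 'M[R]_k, A *m Sig *m A^T = V /\ `|A - 1%:M| <= k%:R * r * lam.
Proof.
move=> sS sV uS Bl r0 kr Vr.
have sB : (invmx Sig)^T = invmx Sig by rewrite trmx_inv sS.
have sD : (V - Sig)^T = V - Sig by rewrite linearB/= sS sV.
have [Y [sY Yr YD]] := congruence_near sB sD Bl r0 kr Vr.
exists (1%:M + Y *m invmx Sig); split.
  rewrite linearD/= trmx1 trmx_mul sB sY mulmxDl mul1mx mulmxDr mulmx1.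
  rewrite -mulmxA mulVmx// mulmx1 mulmxDl mulmxA mulmxV// mul1mx mulmxA.
  by rewrite -(subrK Sig V) -YD [RHS]addrC !addrA.
rewrite addrC addrA addNr add0r; apply: (le_trans (mxnorm_mul _ _)).
by rewrite -!mulrA ler_wpM2l// ler_pM.
Qed.

End Congruence.

(** * Smoothed p-values *)

Section Ramp.
Context {R : realType}.
Implicit Types (t u : R).

Definition ramp t : R := Num.min 1 (Num.max 0 t).

Lemma ramp_ge0 t : 0 <= ramp t.
Proof. by rewrite /ramp le_min ler01 le_max lexx. Qed.

Lemma ramp_le1 t : ramp t <= 1.
Proof. by rewrite /ramp ge_min lexx. Qed.

Lemma ramp_eq0 t : t <= 0 -> ramp t = 0.
Proof. by move=> t0; rewrite /ramp max_l// min_r. Qed.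

Lemma ramp_eq1 t : 1 <= t -> ramp t = 1.
Proof. by move=> t1; rewrite /ramp max_r ?min_l//; lra. Qed.

Lemma dist_max_le a b c d e : `|a - c| <= e -> `|b - d| <= e ->
  `|Num.max a b - Num.max c d| <= e :> R.
Proof.
rewrite !ler_distl => /andP[a1 a2] /andP[b1 b2].
have [ab|ab] := leP a b; have [cd|cd] := leP c d; lra.
Qed.

Lemma dist_min_le a b c d e : `|a - c| <= e -> `|b - d| <= e ->
  `|Num.min a b - Num.min c d| <= e :> R.
Proof.
rewrite !ler_distl => /andP[a1 a2] /andP[b1 b2].
have [ab|ab] := leP a b; have [cd|cd] := leP c d; lra.
Qed.

Lemma ramp_lip t u : `|ramp t - ramp u| <= `|t - u|.
Proof.
apply: dist_min_le; first by rewrite subrr normr0.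
by apply: dist_max_le => //; rewrite subrr normr0.
Qed.

Lemma lipschitz_measurable (F : R -> R) (L : R) :
  (forall x y, `|F x - F y| <= L * `|x - y|) -> measurable_fun setT F.
Proof.
move=> FL; apply: continuous_measurable_fun => x.
apply/cvgrPdist_lt => e e0; near=> y.
apply: (le_lt_trans (FL x y)); apply: (@le_lt_trans _ _ ((`|L| + 1) * `|x - y|)).
  by rewrite ler_wpM2r//; have := ler_norm L; lra.
have L0 : 0 < `|L| + 1 by rewrite ltr_wpDl.
rewrite mulrC -ltr_pdivlMr//; near: y.
by apply/nbhs_ballP; exists (e / (`|L| + 1)) => //=; rewrite divr_gt0.
Unshelve. all: by end_near. Qed.

End Ramp.

Section PValue.
Context {R : realType} {d : measure_display} {W : measurableType d}.
Variables (P : probability W R) (r : W -> R) (eps eta b : R).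
Hypotheses (br : bmeas r) (eps0 : 0 < eps) (eta0 : 0 < eta) (b0 : 0 <= b).

(* A smoothed P(r > c): the integrand vanishes for [r <= c - eps] and is 1 for
   [r >= c - eps / 2]. *)
Definition pval (c : R) : R := \int[P]_w ramp ((r w - c + eps) / (eps / 2)).

Lemma ramp_bmeas (f : W -> R) : measurable_fun setT f -> bmeas (fun w => ramp (f w)).
Proof.
move=> mf; split; last first.
  by exists 1 => w; rewrite ger0_norm ?ramp_ge0// ramp_le1.
apply: (measurableT_comp _ mf); apply: (@lipschitz_measurable _ _ 1) => x y.
by rewrite mul1r ramp_lip.
Qed.

Lemma pval_integrand_bmeas c : bmeas (fun w => ramp ((r w - c + eps) / (eps / 2))).
Proof.
have [mr _] := br.
apply: ramp_bmeas; apply: measurable_funM => //; apply: measurable_funD => //.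
exact: measurable_funB.
Qed.

Lemma pval_lip c c' : `|pval c - pval c'| <= 2 / eps * `|c - c'|.
Proof.
have bc := bmeas_integrable P (pval_integrand_bmeas c).
have bc' := bmeas_integrable P (pval_integrand_bmeas c').
rewrite /pval -RintegralB//; apply: (le_trans (le_normr_Rintegral _ _)) => //.
  exact: (integrableB _ bc bc').
apply: Rintegral_le_cst.
  have [mf [B fB]] := bmeasB (pval_integrand_bmeas c) (pval_integrand_bmeas c').
  by split; [exact: measurableT_comp|exists B => w; rewrite normr_id].
move=> w; apply: (le_trans (ramp_lip _ _)).
have -> : (r w - c + eps) / (eps / 2) - (r w - c' + eps) / (eps / 2) = 2 / eps * (c' - c).
  by field; rewrite gt_eqF.
by rewrite normrM ger0_norm ?divr_ge0 ?(ltW eps0)// distrC.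
Qed.

Lemma pval_tail c : fine (P [set w | c - eps / 2 <= r w]) <= pval c.
Proof.
have mA : measurable [set w | c - eps / 2 <= r w].
  have -> : [set w | c - eps / 2 <= r w] = setT `&` r @^-1` `[c - eps / 2, +oo[%classic.
    by rewrite setTI; apply/seteqP; split => x /=; rewrite in_itv/= andbT.
  by apply: br.1.
rewrite -Rintegral_indicT//; apply: Rintegral_le_mono.
- exact: bmeas_indic.
- exact: pval_integrand_bmeas.
- move=> w; rewrite indicE; case: (boolP (w \in _)); last by rewrite ramp_ge0.
  rewrite inE /= => cw; rewrite ramp_eq1// ler_pdivlMr ?divr_gt0//; lra.
Qed.

(** The integrand vanishes unless the p-value at r(w) is below b. In that case r(w) - eps/2 lies in
    C, the set of c with P(r >= c) <= b, so r(w) >= inf C + eps/2. The smoothing margin thus exceeds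
    some c1 in C even if the infimum is not attained, and the event lies in {r >= c1}, of
    probability at most b. The case b >= 1 is separate because C need not be bounded below there. *)
Lemma pvalue_bound : \int[P]_w ramp ((b - pval (r w)) / eta) <= b.
Proof.
have mA (c : R) : measurable [set w | c <= r w].
  have -> : [set w | c <= r w] = setT `&` r @^-1` `[c, +oo[%classic.
    by rewrite setTI; apply/seteqP; split => x /=; rewrite in_itv/= andbT.
  by apply: br.1.
have brp : bmeas (fun w => ramp ((b - pval (r w)) / eta)).
  apply: ramp_bmeas; apply: measurable_funM => //; apply: measurable_funB => //.
  apply: (measurableT_comp (lipschitz_measurable pval_lip)); exact: br.1.
have [b1|b1] := leP 1 b.
  by apply: Rintegral_le_cst => // w; apply: le_trans b1; exact: ramp_le1.
pose C := [set c : R | fine (P [set w | c <= r w]) <= b].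
have pC w : pval (r w) < b -> C (r w - eps / 2).
  by move=> pb; rewrite /C/=; apply: le_trans (ltW pb); exact: pval_tail.
have [K rK] := br.2.
have lbC : lbound C (- K).
  move=> c; rewrite /C/= leNgt => Cc; rewrite leNgt; apply: contra Cc => cK.
  have -> : [set w | c <= r w] = setT.
    apply/seteqP; split => // w _ /=; have := rK w; rewrite ler_norml => /andP[h _].
    by apply: le_trans h; exact: ltW.
  by have -> : (P : {measure set W -> \bar R}) setT = 1%E := probability_setT P.
have [C0|/set0P C0] := eqVneq C set0.
  apply: Rintegral_le_cst => // w; rewrite ramp_eq0//.
  rewrite pmulr_lle0 ?invr_gt0// subr_le0 leNgt; apply/negP => /pC.
  by rewrite C0.
have [c1 Cc1 c1inf] := inf_adherent (divr_gt0 eps0 (ltr0Sn R 1)) (conj C0 (ex_intro _ _ lbC)).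
apply: (@le_trans _ _ (0 + 1 * fine (P [set w | c1 <= r w]))); last first.
  by rewrite add0r mul1r.
apply: Rintegral_le_indic => // w; rewrite add0r mul1r indicE.
have [pb|pb] := ltP (pval (r w)) b; last first.
  rewrite ramp_eq0; first by rewrite ler0n.
  by rewrite pmulr_lle0 ?invr_gt0// subr_le0.
rewrite mem_set ?ramp_le1//=.
have : inf C <= r w - eps / 2 by apply: ge_inf; [by exists (- K)|exact: pC].
lra.
Qed.

End PValue.

(** * Decoupling under tightness *)

Section L1Lipschitz.
Context {R : realType} {I : finType}.
Implicit Types (F G : (I -> R) -> R) (L M : R).

Definition l1_lip L F := forall x y, `|F x - F y| <= L * \sum_i `|x i - y i|.

Lemma l1_lip_cst L c : 0 <= L -> l1_lip L (fun=> c).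
Proof. by move=> L0 x y; rewrite subrr normr0 mulr_ge0 ?sumr_ge0. Qed.

Lemma l1_lip_add L M F G : l1_lip L F -> l1_lip M G ->
  l1_lip (L + M) (fun x => F x + G x).
Proof.
move=> FL GM x y; rewrite opprD addrACA mulrDl.
by apply: (le_trans (ler_normD _ _)); rewrite lerD.
Qed.

Lemma l1_lip_scale L c F : l1_lip L F -> l1_lip (`|c| * L) (fun x => c * F x).
Proof. by move=> FL x y; rewrite -mulrBr normrM -mulrA ler_wpM2l. Qed.

Lemma l1_lip_min L F G : l1_lip L F -> l1_lip L G ->
  l1_lip L (fun x => Num.min (F x) (G x)).
Proof. by move=> FL GL x y; apply: dist_min_le. Qed.

Lemma l1_lip_bigmin (J : Type) (s : seq J) L c (F : J -> (I -> R) -> R) :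
  0 <= L -> (forall j, l1_lip L (F j)) ->
  l1_lip L (fun x => \big[Num.min/c]_(j <- s) F j x).
Proof.
move=> L0 FL; elim: s => [|j s IH] x y.
  by rewrite !big_nil; exact: l1_lip_cst.
by rewrite !big_cons; apply: dist_min_le; [exact: FL|exact: IH].
Qed.

Lemma l1_lip_bigmax (J : Type) (s : seq J) L c (F : J -> (I -> R) -> R) :
  0 <= L -> (forall j, l1_lip L (F j)) ->
  l1_lip L (fun x => \big[Num.max/c]_(j <- s) F j x).
Proof.
move=> L0 FL; elim: s => [|j s IH] x y.
  by rewrite !big_nil; exact: l1_lip_cst.
by rewrite !big_cons; apply: dist_max_le; [exact: FL|exact: IH].
Qed.

End L1Lipschitz.

Lemma colv_dist_le {R : realType} {I : finType} k (f : 'I_k -> I)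
    (x y : I -> R) : injective f ->
  `|(\col_a x (f a)) - (\col_a y (f a))| <= \sum_i `|x i - y i| :> R.
Proof.
move=> fi; apply: mxnorm_le => [|a j]; first exact: sumr_ge0.
by rewrite !mxE (bigD1 (f a))//= lerDl sumr_ge0.
Qed.

Section Decoupling.
Context {R : realType} {S : Type} {k : nat} (s0 : S).
Notation vec := ('cV[R]_k).
Implicit Types (x : vec) (h : S -> vec).

(** The uniform distance may be infinite or not attained, hence the first alternative and the slack
    [delta]. Distances of at least 1 need no finer comparison, since [Psi] below has values in
    [0, 1] and L >= 1. *)
Lemma separating_point (h h' : S -> vec) (delta : R) : 0 < delta ->
  exists s, 1 <= `|h s - h' s| \/
    forall t, `|h t - h' t| <= `|h s - h' s| + delta.
Proof.
move=> delta0.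
have [[s s1]|ns] := pselect (exists s, 1 <= `|h s - h' s|).
  by exists s; left.
have ub : has_sup (range (fun s => `|h s - h' s|)).
  split; first by exists `|h s0 - h' s0|, s0.
  exists 1 => _ [s _ <-]; rewrite leNgt; apply/negP => /ltW s1.
  by apply: ns; exists s.
have [_ [s _ <-] hs] := sup_adherent delta0 ub.
exists s; right => t; rewrite -lerBlDr; apply: le_trans (ltW hs).
by rewrite lerD2r; apply: (ub_le_sup ub.2); exists t.
Qed.

Context {d : measure_display} {W : measurableType d} (Q : probability W R).
Variables (xi : W -> vec) (H : W -> S -> vec) (Psi : vec -> (S -> vec) -> R).
Variables (L b : R).

Hypothesis mxi : forall a, measurable_fun setT (fun w => xi w a 0).
Hypothesis mH : forall s a, measurable_fun setT (fun w => H w s a 0).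
(* Independence of xi and the finite-dimensional marginals of the Gaussian H,
   stated through the variances of linear combinations. *)
Hypothesis indep : forall n (s : 'I_n -> S) (t : 'I_k -> R) (u : 'I_n -> 'I_k -> R),
  exists v1 v2, [/\ 0 <= v1, 0 <= v2,
    has_normal_law Q (fun w => \sum_a t a * xi w a 0) v1,
    has_normal_law Q (fun w => \sum_j \sum_a u j a * H w (s j) a 0) v2 &
    has_normal_law Q (fun w => \sum_a t a * xi w a 0 +
      \sum_j \sum_a u j a * H w (s j) a 0) (v1 + v2)].
Hypothesis tight : forall e delta : R, 0 < e -> 0 < delta ->
  exists n (y : 'I_n -> S -> vec) (A : set W),
    [/\ measurable A, fine (Q (~` A)) <= e &
        forall w, A w -> exists i, forall s, `|H w s - y i s| <= delta].
Hypothesis L1 : 1 <= L.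
Hypothesis Psi01 : forall x h, 0 <= Psi x h <= 1.
Hypothesis PsiL : forall x x' h h' (D : R), (forall s, `|h s - h' s| <= D) ->
  `|Psi x h - Psi x' h'| <= L * (`|x - x'| + D).
Hypothesis mPsi : measurable_fun setT (fun w => Psi (xi w) (H w)).
Hypothesis mPsix : forall h, measurable_fun setT (fun w => Psi (xi w) h).
Hypothesis Psib : forall h, \int[Q]_w Psi (xi w) h <= b.

Let L0 : 0 <= L. Proof. exact: le_trans L1. Qed.

Section Net.
Variables (n : nat) (y : 'I_n -> S -> vec) (pt : 'I_n * 'I_n -> S).
Let I := ('I_k + ('I_n * 'I_n) * 'I_k)%type.

Definition evals x h (i : I) : R :=
  match i with inl a => x a 0 | inr (j, a) => h (pt j) a 0 end.

(* A McShane-type extension of [Psi x (y i)] from the net: it approximates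
   [Psi] uniformly near the net but reads [h] only at the points [pt j], which
   separate the [y i]. *)
Definition net_fun (z : I -> R) : R :=
  \big[Num.min/1]_(i : 'I_n) (Psi (\col_a z (inl a)) (y i) +
    L * Num.min 1 (\big[Num.max/0]_(j : 'I_n * 'I_n)
      `|(\col_a z (inr (j, a))) - y i (pt j)|)).

Lemma net_fun_lip : l1_lip (L + L) net_fun.
Proof.
apply: l1_lip_bigmin => [|i]; first by rewrite addr_ge0.
apply: l1_lip_add => [z z'|].
  apply: (le_trans (PsiL (D := 0) _ _ _)).
    by move=> s; rewrite subrr normr0.
  by rewrite addr0 ler_wpM2l// colv_dist_le// => a a' [].
have := @l1_lip_scale R I 1 L; rewrite (ger0_norm L0) mulr1; apply.
apply: l1_lip_min; first exact: l1_lip_cst.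
apply: l1_lip_bigmax => // j z z'; rewrite mul1r.
apply: (le_trans (ler_dist_dist _ _)).
rewrite [X in `|X|](_ : _ = (\col_a z (inr (j, a))) - \col_a z' (inr (j, a))).
  by apply: colv_dist_le => a a' [].
by rewrite opprB addrA subrK.
Qed.

Lemma net_fun_ge0 z : 0 <= net_fun z.
Proof.
rewrite /net_fun; apply: le_bigmin => // i _.
have /andP[P0 _] := Psi01 (\col_a z (inl a)) (y i).
rewrite addr_ge0// mulr_ge0// le_min ler01/=.
exact: bigmax_ge_id.
Qed.

Lemma col_evals x h : (\col_a evals x h (inl a)) = x.
Proof. by apply/colP => a; rewrite mxE. Qed.

Lemma col_evals_pt x h j : (\col_a evals x h (inr (j, a))) = h (pt j).
Proof. by apply/colP => a; rewrite mxE. Qed.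

Variable delta : R.
Hypothesis delta0 : 0 < delta.
Hypothesis sep : forall i j, 1 <= `|y i (pt (i, j)) - y j (pt (i, j))| \/
  forall t, `|y i t - y j t| <= `|y i (pt (i, j)) - y j (pt (i, j))| + delta.

Lemma net_fun_upper x h i : (forall s, `|h s - y i s| <= delta) ->
  net_fun (evals x h) <= Psi x h + 2 * (L * delta).
Proof.
move=> hy; rewrite /net_fun; apply: (@le_trans _ _ (Psi x (y i) + L * delta)).
  apply: (bigmin_inf i) => //; rewrite col_evals lerD2l ler_wpM2l// ge_min.
  apply/orP; right; apply: bigmax_le => [|j _]; first exact: ltW.
  by rewrite col_evals_pt.
have : `|Psi x h - Psi x (y i)| <= L * (`|x - x| + delta) by exact: PsiL.
by rewrite subrr normr0 add0r ler_norml; lra.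
Qed.

(** Each term of the minimum is bounded below. If the penalty for y_j is saturated, the term is
    already at least L >= 1. Otherwise the deviation m at the separating point gives |y_i - y_j| <=
    m + delta there, so |h - y_j| <= m + 3 delta everywhere, unless the points are 1 apart and L (m
    + delta) >= 1. *)
Lemma net_fun_lower x h i : (forall s, `|h s - y i s| <= delta) ->
  Psi x h <= net_fun (evals x h) + 3 * (L * delta).
Proof.
move=> hy; have Ld : 0 <= L * delta by rewrite mulr_ge0// ltW.
have /andP[P0 P1] := Psi01 x h.
rewrite -lerBlDr /net_fun; apply: le_bigmin => [|j _]; first lra.
set m := \big[Num.max/0]_(_ | _) _.
rewrite col_evals; set s := pt (i, j).
have /andP[Pj0 _] := Psi01 x (y j).
have ms : `|h s - y j s| <= m.
  by rewrite /m; apply: le_trans (le_bigmax _ _ (i, j)); rewrite col_evals_pt.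
have dm : `|y i s - y j s| <= m + delta.
  have := ler_distD (h s) (y i s) (y j s); rewrite (distrC (y i s) (h s)).
  by have := hy s; lra.
have lra1 (p q ld l : R) : p <= 1 -> 0 <= q -> 1 <= l -> 0 <= ld -> p - 3 * ld <= q + l.
  by move=> *; lra.
have [m1|m1] := leP 1 m; first by rewrite mulr1; exact: lra1.
have [d1|d1] := sep i j.
  have := ler_wpM2l L0 (le_trans d1 dm); rewrite mulr1 mulrDr => Lm.
  have lra2 (p q ld l lm : R) : p <= 1 -> 0 <= q -> 1 <= l -> 0 <= ld ->
    l <= lm + ld -> p - 3 * ld <= q + lm by move=> *; lra.
  exact: lra2 Lm.
have : `|Psi x h - Psi x (y j)| <= L * (`|x - x| + (m + 3 * delta)).
  apply: PsiL => t; apply: (le_trans (ler_distD (y i t) _ _)).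
  by have := d1 t; have := hy t; rewrite -/s; lra.
rewrite subrr normr0 add0r mulrDr mulrCA => /(le_trans (ler_norm _)).
have lra3 (p q ld lm : R) : p - q <= lm + 3 * ld -> p - 3 * ld <= q + lm.
  by move=> *; lra.
exact: lra3.
Qed.

End Net.

(** Both sides are the integral of a shifted cosine under N(0, v1 + v2): on the left by [indep], on
    the right by convolution. In the product, H is read from the first coordinate and xi from the
    second. *)
Lemma evals_cos n (pt : 'I_n * 'I_n -> S) t c :
  \int[Q]_w cos (\sum_i t i * evals pt (xi w) (H w) i + c) =
  \int[prod_prob Q Q]_z cos (\sum_i t i * evals pt (xi z.2) (H z.1) i + c).
Proof.
pose J : finType := ('I_n * 'I_n)%type.
pose s (j : 'I_#|J|) := pt (enum_val j).
pose u (j : 'I_#|J|) a := t (inr (enum_val j, a)).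
have [v1 [v2 [v10 v20 l1 l2 l12]]] := indep s (fun a => t (inl a)) u.
have sumE x h : \sum_i t i * evals pt x h i =
    \sum_a t (inl a) * x a 0 + \sum_j \sum_a u j a * h (s j) a 0.
  rewrite big_sumType/=; congr (_ + _).
  transitivity (\sum_(j : J) \sum_a t (inr (j, a)) * h (pt j) a 0).
    by rewrite pair_big; apply: eq_bigr => -[j a].
  by rewrite (reindex enum_val (onW_bij _ (enum_val_bij J))).
under eq_Rintegral do rewrite sumE.
under [RHS]eq_Rintegral do rewrite sumE.
rewrite (Rintegral_normal_law l12 (cos_affine_bmeas c)) addrC.
rewrite -(Rintegral_cos_normal_sum c v20 v10 l2 l1).
by apply: eq_Rintegral => z _; rewrite [X in X + c]addrC.
Qed.

(** [net_fun] reads finitely many coordinates, so its expectation is unchanged when H and xi are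
    replaced by independent copies. Tonelli then puts the integral over xi inside, where h is fixed
    and [Psib] applies. *)
Lemma decoupling : \int[Q]_w Psi (xi w) (H w) <= b.
Proof.
(* The errors are 3 L delta and 2 L delta from the two comparisons with the net, and e/7 twice from
   the complement of A: in all e. *)
apply/ler_addgt0Pr => e e0; pose delta := e / (7 * L).
have L_gt0 : 0 < L by exact: lt_le_trans L1.
have delta0 : 0 < delta by rewrite divr_gt0// mulr_gt0.
have Ld : L * delta = e / 7 by rewrite /delta; field; rewrite gt_eqF.
have [n [y [A [mA QA HA]]]] := tight (divr_gt0 e0 (ltr0n R 7)) delta0.
have /choice[pt sep] (ij : 'I_n * 'I_n) := separating_point (y ij.1) (y ij.2) delta0.
have {}sep : forall i j, 1 <= `|y i (pt (i, j)) - y j (pt (i, j))| \/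
    forall t, `|y i t - y j t| <= `|y i (pt (i, j)) - y j (pt (i, j))| + delta.
  by move=> i j; exact: (sep (i, j)).
pose N := net_fun y pt.
have mX1 i : measurable_fun setT (fun w => evals pt (xi w) (H w) i).
  by case: i => [a|[j a]] /=; [exact: mxi|exact: mH].
have mX2 i : measurable_fun setT (fun z : W * W => evals pt (xi z.2) (H z.1) i).
  case: i => [a|[j a]] /=.
    exact: (measurableT_comp (mxi a)).
  exact: (measurableT_comp (mH _ a)).
have N1 z : `|N z| <= 1.
  by rewrite ger0_norm ?net_fun_ge0// bigmin_le_id.
have [bX1 bX2 EX] := cramer_wold (P1 := Q) (P2 := prod_prob Q Q)
  (X1 := fun w => evals pt (xi w) (H w)) (X2 := fun z => evals pt (xi z.2) (H z.1))
  mX1 mX2 (evals_cos pt) N1 (net_fun_lip y pt).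
have mAC : measurable (~` A) by exact: measurableC.
have bPsi : bmeas (fun w => Psi (xi w) (H w)).
  split=> //; exists 1 => w; have /andP[P0 P1] := Psi01 (xi w) (H w).
  by rewrite ger0_norm.
have bPsix h : bmeas (fun w => Psi (xi w) h).
  split=> //; exists 1 => w; have /andP[P0 P1] := Psi01 (xi w) h.
  by rewrite ger0_norm.
have step1 : \int[Q]_w Psi (xi w) (H w) <=
    \int[Q]_w N (evals pt (xi w) (H w)) + (3 * (L * delta) + e / 7).
  rewrite -lerBlDl -RintegralB//; [|exact: bmeas_integrable..].
  apply: (@le_trans _ _ (3 * (L * delta) + 1 * fine (Q (~` A)))); last first.
    by rewrite mul1r lerD2l.
  apply: Rintegral_le_indic => //; first exact: bmeasB.
  move=> w; rewrite mul1r indicE.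
  have [Aw|nAw] := boolP (w \in ~` A); rewrite /= ?mulr1n ?mulr0n.
    have /andP[_ P1] := Psi01 (xi w) (H w).
    have := net_fun_ge0 y pt (evals pt (xi w) (H w)).
    by rewrite -/N Ld; lra.
  have [|i iP] := HA w; first by apply: contrapT => nA; move/negP: nAw; apply; exact: mem_set.
  by have := net_fun_lower delta0 sep (xi w) iP; rewrite -/N Ld; lra.
have [bN [bNN EN]] := Rintegral_prod_ge0 Q Q bX2 (fun z => net_fun_ge0 y pt _).
have step2 : \int[Q]_w N (evals pt (xi w) (H w)) <= b + 2 * (L * delta) + e / 7.
  rewrite EX -/N EN.
  apply: (@le_trans _ _ (b + 2 * (L * delta) + 1 * fine (Q (~` A)))); last first.
    by rewrite mul1r lerD2l.
  have b_ge0 : 0 <= b.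
    apply: le_trans (Psib (fun=> 0)); apply: Rintegral_ge0 => w _.
    by have /andP[] := Psi01 (xi w) (fun=> 0).
  apply: Rintegral_le_indic => // w; rewrite mul1r indicE.
  have [Aw|nAw] := boolP (w \in ~` A); rewrite /= ?mulr1n ?mulr0n.
    apply: (@le_trans _ _ 1); last by rewrite Ld; lra.
    by apply: Rintegral_le_cst => [|w']; [exact: bN|exact: le_trans (ler_norm _) (N1 _)].
  have [|i iP] := HA w; first by apply: contrapT => nA; move/negP: nAw; apply; exact: mem_set.
  rewrite addr0; apply: (@le_trans _ _ (\int[Q]_w' (Psi (xi w') (H w) + 2 * (L * delta)))).
    apply: Rintegral_le_mono => [||w']; first exact: bN.
      by apply: bmeasD => //; exact: bmeas_cst.
    exact: net_fun_upper.
  rewrite RintegralD//; first by rewrite Rintegral_probability_cst lerD2r.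
    exact: bmeas_integrable.
  exact/bmeas_integrable/bmeas_cst.
rewrite Ld in step1 step2; lra.
Qed.

End Decoupling.

(** * Uniform topology on functions and tight processes *)

Section UniformSpace.
Context {R : realType} {S : choiceType} {k : nat}.
Notation vec := ('cV[R]_k).
Notation unif := {uniform S -> vec}.

Lemma nbhs_uniform_ball (f : unif) (e : R) : 0 < e ->
  nbhs f [set h : unif | forall s, `|(f : S -> vec) s - h s| < e].
Proof.
move=> e0; apply/uniform_nbhs; exists [set xy | `|xy.1 - xy.2| < e]; split.
  rewrite -entourage_ballE; exists e => //= -[x y] /=.
  by rewrite -ball_normE.
by move=> h hf s; exact: hf.
Qed.

(** Makes compact sets closed, so that their preimages under a Borel process are measurable. *)
Lemma uniform_hausdorff : hausdorff_space unif.
Proof.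
move=> f g cfg; apply/funext => s; apply/eqP; rewrite -subr_eq0 -normr_le0.
apply/ler_addgt0Pr => e e0; rewrite add0r.
have e2 : 0 < e / 2 by rewrite divr_gt0.
have [h [fh gh]] := cfg _ _ (nbhs_uniform_ball f e2) (nbhs_uniform_ball g e2).
apply: (le_trans (ler_distD (h s) _ _)); rewrite (distrC (h s)).
by rewrite ltW// [ltRHS]splitr ltrD.
Qed.

(** The net serves a whole open neighbourhood of K, whose preimage under the process is the
    measurable event that [decoupling] asks for. *)
Lemma uniform_compact_net (K : set unif) (delta : R) : compact K -> 0 < delta ->
  exists n (y : 'I_n -> S -> vec) (U : set unif),
    [/\ open U, K `<=` U &
        forall h : S -> vec, U h -> exists i, forall s, `|h s - y i s| <= delta].
Proof.
pose T : ptopologicalType := HB.pack unif (isPointed.Build unif (fun=> 0)).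
move=> cK0 delta0; have cK : @cover_compact T K by rewrite -compact_cover.
pose f (g : unif) : set unif :=
  interior [set h : unif | forall s, `|(g : S -> vec) s - h s| < delta].
have [||D _ KD] := cK _ setT f.
- by move=> g _; exact: open_interior.
- by move=> g _; exists g => //; exact: nbhs_uniform_ball.
pose l : seq unif := finmap.enum_fset D.
exists (size l), (fun i => (nth ((fun=> 0) : unif) l i : S -> vec)), (\bigcup_(g in [set g : unif | g \in l]) f g).
split.
- by apply: bigcup_open => g _; exact: open_interior.
- exact: KD.
- move=> h [g gD] /interior_subset /= gh.
  have gi : (index g l < size l)%N by rewrite index_mem.
  exists (Ordinal gi) => s /=; rewrite nth_index// distrC ltW//; exact: gh.
Qed.

Lemma uniform_lip_open (X : normedModType R) (F : (S -> vec) -> X) (L : R)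
    (B : set X) :
  (forall (g h : S -> vec) D, (forall s, `|g s - h s| <= D) -> `|F g - F h| <= L * D) ->
  open B -> open (F @^-1` B : set unif).
Proof.
move=> FL oB; rewrite openE => g /= gB.
have /nbhs_ballP[e e0 eB] : nbhs (F g) B by exact: open_nbhs_nbhs.
have L0 : 0 < `|L| + 1 by rewrite ltr_wpDl.
have d0 : 0 < e / (`|L| + 1) by rewrite divr_gt0.
apply: filterS (nbhs_uniform_ball g d0) => h gh; apply: eB.
rewrite -ball_normE /ball_/=.
apply: (@le_lt_trans _ _ (L * (e / (`|L| + 1)))).
  by apply: FL => s; exact: ltW.
rewrite mulrCA -[ltRHS]mulr1 ltr_pM2l// ltr_pdivrMr// mul1r.
by have := ler_norm L; lra.
Qed.

Context {d : measure_display} {W : measurableType d} (Q : probability W R).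
Variable G : W -> S -> vec.
Hypothesis tG : tight_borel Q G.

Lemma tight_lip_measurable (F : (S -> vec) -> R) (L : R) :
  (forall (g h : S -> vec) D, (forall s, `|g s - h s| <= D) -> `|F g - F h| <= L * D) ->
  measurable_fun setT (fun w => F (G w)).
Proof.
move=> FL; apply: (measurability _ (RGenOpens.measurableE R)).
move=> _ [_ [a [b' ->] <-]]; rewrite setTI.
apply: (tG.1 (F @^-1` `]a, b'[%classic : set unif)).
by apply: (uniform_lip_open FL); exact: interval_open.
Qed.

Lemma tight_net (e delta : R) : 0 < e -> 0 < delta ->
  exists n (y : 'I_n -> S -> vec) (A : set W),
    [/\ measurable A, fine (Q (~` A)) <= e &
        forall w, A w -> exists i, forall s, `|G w s - y i s| <= delta].
Proof.
move=> e0 delta0; have [K [cK QK]] := tG.2 _ e0.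
have [n [y [U [oU KU Uy]]]] := uniform_compact_net cK delta0.
have mA : measurable (G @^-1` U) by exact: tG.1.
exists n, y, (G @^-1` U); split=> //; last by move=> w /Uy.
have mK : measurable (G @^-1` K).
  rewrite -[X in measurable X]setCK; apply: measurableC; rewrite preimage_setC.
  by apply: tG.1; apply: closed_openC; exact: compact_closed uniform_hausdorff cK.
have : ((1 - e)%:E <= Q (G @^-1` U))%E.
  by apply: (le_trans QK); apply: le_measure; rewrite ?inE// => w; exact: KU.
rewrite probability_setC// -(@fineK _ (Q (G @^-1` U))) ?fin_num_measure//.
by rewrite -EFinB /= lee_fin; lra.
Qed.

End UniformSpace.

(** * The test functional of the limit process *)

Section GaussianProjection.
Context {R : realType} {S : choiceType} {k : nat} (s0 : S).
Notation vec := ('cV[R]_k).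
Context {d : measure_display} {W : measurableType d} (Q : probability W R).
Variables (G : W -> S -> vec) (V : S -> S -> 'M[R]_k).
Hypothesis gp : centered_gaussian_process Q G V.
Hypothesis V0unit : V s0 s0 \in unitmx.

Let cV : covariance_function V := gp.1.

Definition cov_form n (s : 'I_n -> S) (a b : 'I_n -> vec) : R :=
  \sum_i \sum_j ((a i)^T *m V (s i) (s j) *m b j) 0 0.

Lemma gp_normal n (s : 'I_n -> S) (a : 'I_n -> vec) :
  has_normal_law Q (fun w => \sum_i ((a i)^T *m G w (s i)) 0 0) (cov_form s a a).
Proof. exact: gp.2 n s a. Qed.

Lemma gp_coord s a : measurable_fun setT (fun w => G w s a 0).
Proof.
have [mX _] := gp_normal (fun _ : 'I_1 => s) (fun=> delta_mx a 0).
apply: eq_measurable_fun mX => w _.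
by rewrite big_ord1 trmx_delta -rowE mxE.
Qed.

Lemma gp_normal1 (a : vec) :
  has_normal_law Q (fun w => (a^T *m G w s0) 0 0) ((a^T *m V s0 s0 *m a) 0 0).
Proof.
have := gp_normal (fun _ : 'I_1 => s0) (fun=> a).
rewrite /cov_form !big_ord1; congr (has_normal_law Q _ _).
by apply/funext => w; rewrite big_ord1.
Qed.

Lemma cov_formDl n (s : 'I_n -> S) a a' b :
  cov_form s (fun i => a i + a' i) b = cov_form s a b + cov_form s a' b.
Proof.
rewrite /cov_form -big_split; apply: eq_bigr => i _; rewrite -big_split.
by apply: eq_bigr => j _; rewrite linearD/= !mulmxDl mxE.
Qed.

Lemma cov_formC n (s : 'I_n -> S) a b : cov_form s a b = cov_form s b a.
Proof.
rewrite /cov_form exchange_big; apply: eq_bigr => j _; apply: eq_bigr => i _.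
have -> : (a i)^T *m V (s i) (s j) *m b j = ((b j)^T *m V (s j) (s i) *m a i)^T.
  by rewrite !trmx_mul trmxK -cV.1 mulmxA.
by rewrite mxE.
Qed.

Lemma cov_formDr n (s : 'I_n -> S) a b b' :
  cov_form s a (fun i => b i + b' i) = cov_form s a b + cov_form s a b'.
Proof. by rewrite !(cov_formC _ a) cov_formDl. Qed.

(** The coefficient in the regression of G(s) on G(s0). *)
Definition proj_coef s : 'M[R]_k := V s s0 *m invmx (V s0 s0).

(** Convertible to [hproc s0 g V], so that results on [residual] apply to the process in the theorem
    as they stand. *)
Definition residual (g : S -> vec) : S -> vec := fun s => g s - proj_coef s *m g s0.

Definition cons_ord T n (x : T) (f : 'I_n -> T) (i : 'I_n.+1) : T :=
  if unlift ord0 i is Some j then f j else x.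

Lemma cons_ord0 T n (x : T) (f : 'I_n -> T) : cons_ord x f ord0 = x.
Proof. by rewrite /cons_ord unlift_none. Qed.

Lemma cons_ordS T n (x : T) (f : 'I_n -> T) j : cons_ord x f (lift ord0 j) = f j.
Proof. by rewrite /cons_ord liftK. Qed.

(* Additivity of the variances is the independence of [G s0] and the residual. *)
Lemma residual_indep n (s : 'I_n -> S) (t : 'I_k -> R) (u : 'I_n -> 'I_k -> R) :
  exists v1 v2, [/\ 0 <= v1, 0 <= v2,
    has_normal_law Q (fun w => \sum_a t a * G w s0 a 0) v1,
    has_normal_law Q (fun w => \sum_j \sum_a u j a * residual (G w) (s j) a 0) v2 &
    has_normal_law Q (fun w => \sum_a t a * G w s0 a 0 +
      \sum_j \sum_a u j a * residual (G w) (s j) a 0) (v1 + v2)].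
Proof.
(* Both combinations are written over the common points s0, s_1, ..., s_n; expanding the residuals
   collects their regression terms at s0. *)
pose p := cons_ord s0 s.
pose tt : vec := \col_a t a.
pose uu j : vec := \col_a u j a.
pose a1 := cons_ord tt (fun _ : 'I_n => 0).
pose a2 := cons_ord (- \sum_j (proj_coef (s j))^T *m uu j) uu.
have tE (x : vec) : \sum_a t a * x a 0 = (tt^T *m x) 0 0.
  by rewrite mxE; apply: eq_bigr => a _; rewrite !mxE.
have uE j (x : vec) : \sum_a u j a * x a 0 = ((uu j)^T *m x) 0 0.
  by rewrite mxE; apply: eq_bigr => a _; rewrite !mxE.
have e1 w : \sum_a t a * G w s0 a 0 = \sum_i ((a1 i)^T *m G w (p i)) 0 0.
  rewrite tE big_ord_recl /a1 /p !cons_ord0 [X in _ = _ + X]big1 ?addr0//.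
  by move=> j _; rewrite !cons_ordS trmx0 mul0mx mxE.
have e2 w : \sum_j \sum_a u j a * residual (G w) (s j) a 0 =
    \sum_i ((a2 i)^T *m G w (p i)) 0 0.
  rewrite big_ord_recl /a2 /p !cons_ord0 linearN/= mulNmx mxE linear_sum mulmx_suml.
  rewrite summxE -sumrN -big_split/=; apply: eq_bigr => j _.
  rewrite uE !cons_ordS /residual mulmxBr mxBE trmx_mul trmxK mulmxA addrC.
  by [].
(* The covariance of G(s0) with the residual at s_j is V(s0, s_j) - V(s0, s0) V(s0, s0)^-1 V(s0,
   s_j) = 0. *)
have orth : cov_form p a1 a2 = 0.
  rewrite /cov_form big_ord_recl [X in _ + X]big1 ?addr0; last first.
    move=> i _; rewrite big1// => j _.
    by rewrite /a1 cons_ordS trmx0 !mul0mx mxE.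
  rewrite big_ord_recl /a1 /a2 /p !cons_ord0 mulmxN mxE mulmx_sumr summxE -sumrN.
  rewrite -big_split/= big1// => j _; rewrite !cons_ordS.
  have -> : (proj_coef (s j))^T = invmx (V s0 s0) *m V s0 (s j).
    by rewrite /proj_coef trmx_mul trmx_inv -!cV.1.
  by rewrite !mulmxA mulmxK// addNr.
have orth' : cov_form p a2 a1 = 0 by rewrite cov_formC.
have v_ge0 a : 0 <= cov_form p a a by exact: cV.2.
exists (cov_form p a1 a1), (cov_form p a2 a2); split => //.
- have := gp_normal p a1; congr (has_normal_law Q _ _).
  by apply/funext => w; rewrite e1.
- have := gp_normal p a2; congr (has_normal_law Q _ _).
  by apply/funext => w; rewrite e2.
- have := gp_normal p (fun i => a1 i + a2 i).
  rewrite cov_formDl !cov_formDr orth orth' addr0 add0r.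
  congr (has_normal_law Q _ _); apply/funext => w; rewrite e1 e2 -big_split/=.
  by apply: eq_bigr => i _; rewrite linearD/= mulmxDl mxE.
Qed.

End GaussianProjection.

Lemma pval_dist {R : realType} {d} {W : measurableType d} (P : probability W R)
    (r r' : W -> R) eps rho c c' : 0 < eps -> bmeas r -> bmeas r' ->
  (forall w, `|r w - r' w| <= rho) ->
  `|pval P r eps c - pval P r' eps c'| <= 2 / eps * (rho + `|c - c'|).
Proof.
move=> eps0 br br' rr'.
have b1 := pval_integrand_bmeas eps br c.
have b2 := pval_integrand_bmeas eps br' c'.
have i1 := bmeas_integrable P b1; have i2 := bmeas_integrable P b2.
rewrite /pval -RintegralB//; apply: (le_trans (le_normr_Rintegral _ _)) => //.
  exact: (integrableB _ i1 i2).
apply: Rintegral_le_cst.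
  have [mf [B fB]] := bmeasB b1 b2.
  by split; [exact: measurableT_comp|exists B => w; rewrite normr_id].
move=> w; apply: (le_trans (ramp_lip _ _)).
have -> : (r w - c + eps) / (eps / 2) - (r' w - c' + eps) / (eps / 2) =
    2 / eps * ((r w - r' w) - (c - c')).
  by field; rewrite gt_eqF.
rewrite normrM ger0_norm ?divr_ge0 ?(ltW eps0)// ler_wpM2l ?divr_ge0 ?(ltW eps0)//.
by apply: (le_trans (ler_normB _ _)); rewrite lerD2r.
Qed.

Section LimitTest.
Context {R : realType} {S : choiceType} {k : nat} (s0 : S).
Notation vec := ('cV[R]_k).
Context {d : measure_display} {W : measurableType d} (Q : probability W R).
Variables (G : W -> S -> vec) (V : S -> S -> 'M[R]_k).
Hypothesis gp : centered_gaussian_process Q G V.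
Hypothesis tG : tight_borel Q G.
Hypothesis V0unit : V s0 s0 \in unitmx.
Variable c : R.
Hypothesis coef_le : forall s, `|proj_coef s0 V s| <= c.
Variables (St : vec -> (S -> vec) -> R) (K : R).
Hypothesis StB : forall x h, `|St x h| <= K.
Hypothesis StL : forall x x' h h' D, (forall s, `|h s - h' s| <= D) ->
  `|St x h - St x' h'| <= K * (`|x - x'| + D).
Variables (mm : S -> vec) (eps eta b : R).
Hypotheses (eps0 : 0 < eps) (eta0 : 0 < eta) (b0 : 0 <= b).

Let K0 : 0 <= K.
Proof. exact: le_trans (StB 0 (fun=> 0)). Qed.

Definition limit_pval x h : R := pval Q (fun w => St (G w s0) h) eps (St x h).

(** The functional receives a centred process, whereas the p-value concerns the uncentred one; [mm]
    restores the mean. *)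
Definition limit_test x h : R :=
  ramp ((b - limit_pval x (fun s => h s + mm s)) / eta).

Definition limit_functional (g : S -> vec) : R :=
  limit_test (g s0) (residual s0 V g).

(** The p-value has slope 4 K / eps, half from the statistic under the integral and half from its
    threshold, and the outer ramp divides by [eta]. The summand 1 secures the condition L >= 1 of
    [decoupling]. *)
Definition test_const : R := 1 + 4 * K / (eps * eta).

Lemma test_const_ge1 : 1 <= test_const.
Proof. by rewrite lerDl divr_ge0// ?mulr_ge0// ltW. Qed.

Lemma stat_bmeas h : bmeas (fun w => St (G w s0) h).
Proof.
split; last by exists K.
apply: (tight_lip_measurable tG (F := fun g => St (g s0) h) (L := K)) => g g' D gg'.
apply: (le_trans (StL (D := 0) _ _ _)); first by move=> s; rewrite subrr normr0.
by rewrite addr0 ler_wpM2l.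
Qed.

Lemma limit_pval_lip x x' h h' D : (forall s, `|h s - h' s| <= D) ->
  `|limit_pval x h - limit_pval x' h'| <= 4 * K / eps * (`|x - x'| + D).
Proof.
move=> hh'; have D0 : 0 <= D by exact: le_trans (hh' s0).
apply: (le_trans (@pval_dist _ _ _ _ _ _ _ (K * D) _ _ eps0 (stat_bmeas h) (stat_bmeas h') _)).
  by move=> w; apply: (le_trans (StL _ _ hh')); rewrite subrr normr0 add0r.
have -> : 4 * K / eps * (`|x - x'| + D) = 2 / eps * (2 * (K * (`|x - x'| + D))).
  by field; rewrite gt_eqF.
rewrite ler_wpM2l ?divr_ge0 ?(ltW eps0)//.
have := StL x x' hh'; have : 0 <= K * `|x - x'| by rewrite mulr_ge0.
by rewrite mulrDr; lra.
Qed.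

Lemma limit_test_lip x x' h h' D : (forall s, `|h s - h' s| <= D) ->
  `|limit_test x h - limit_test x' h'| <= test_const * (`|x - x'| + D).
Proof.
move=> hh'; have D0 : 0 <= D by exact: le_trans (hh' s0).
apply: (le_trans (ramp_lip _ _)).
rewrite -mulrBl normrM (ger0_norm (x := eta^-1)) ?invr_ge0 ?(ltW eta0)//.
rewrite opprB [X in `|X|]addrC subrKA distrC ler_pdivrMr//.
apply: (le_trans (limit_pval_lip (D := D) _ _ _)).
  by move=> s; rewrite opprD addrACA subrr addr0.
have tE : test_const * eta = eta + 4 * K / eps.
  by rewrite /test_const; field; rewrite !gt_eqF.
rewrite [leRHS]mulrAC tE ler_wpM2r ?addr_ge0//.
by rewrite lerDr ltW.
Qed.

Lemma residual_lip (g g' : S -> vec) D : (forall s, `|g s - g' s| <= D) ->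
  forall s, `|residual s0 V g s - residual s0 V g' s| <= (1 + k%:R * c) * D.
Proof.
move=> gg' s.
have -> : residual s0 V g s - residual s0 V g' s =
    (g s - g' s) - proj_coef s0 V s *m (g s0 - g' s0).
  by rewrite /residual mulmxBr opprB [in RHS]opprB addrACA [RHS]addrACA [- g' s + _]addrC.
apply: (le_trans (ler_normB _ _)); rewrite mulrDl mul1r lerD//.
apply: (le_trans (mxnorm_mul _ _)); rewrite -!mulrA ler_wpM2l//.
by rewrite ler_pM.
Qed.

Lemma limit_functional_lip (g g' : S -> vec) D : (forall s, `|g s - g' s| <= D) ->
  `|limit_functional g - limit_functional g'| <= test_const * (2 + k%:R * c) * D.
Proof.
move=> gg'; apply: (le_trans (limit_test_lip _ _ (residual_lip gg'))).
have t0 : 0 <= test_const by exact: le_trans test_const_ge1.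
rewrite -mulrA ler_wpM2l//.
have -> : (2 + k%:R * c) * D = D + (1 + k%:R * c) * D by ring.
by rewrite lerD2r.
Qed.

(** [decoupling] with xi = G(s0) and H the residual, which inherits the finite nets of G because it
    is a Lipschitz image of G. For fixed h the function h + mm is fixed too, so [pvalue_bound] holds
    whatever the mean. *)
Lemma limit_functional_bound : \int[Q]_w limit_functional (G w) <= b.
Proof.
have c0 : 0 <= c by exact: le_trans (coef_le s0).
have stc h : measurable_fun setT (fun w => limit_test (G w s0) h).
  apply: (tight_lip_measurable tG (F := fun g => limit_test (g s0) h) (L := test_const)).
  move=> g g' D gg'; apply: (le_trans (limit_test_lip (D := 0) _ _ _)).
    by move=> s; rewrite subrr normr0.
  by rewrite addr0 ler_wpM2l//; exact: le_trans test_const_ge1.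
apply: (decoupling s0 (L := test_const) (xi := fun w => G w s0)
  (H := fun w => residual s0 V (G w))).
- by move=> a; exact: gp_coord gp s0 a.
- move=> s a; rewrite /residual.
  under eq_fun do rewrite !mxE.
  apply: measurable_funB; first exact: gp_coord gp s a.
  apply: measurable_sum => j; apply: measurable_funM => //; exact: gp_coord gp s0 j.
- by move=> n s t u; exact: (residual_indep gp V0unit s t u).
- move=> e delta e0 delta0.
  have C0 : 0 < 1 + k%:R * c by rewrite ltr_wpDr// mulr_ge0.
  have [n [y [A [mA QA HA]]]] := tight_net tG e0 (divr_gt0 delta0 C0).
  exists n, (fun i => residual s0 V (y i)), A; split => // w /HA[i iy].
  exists i => s; apply: (le_trans (residual_lip iy s)).
  by rewrite mulrC divfK// gt_eqF.
- exact: test_const_ge1.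
- by move=> x h; rewrite ramp_ge0 ramp_le1.
- exact: limit_test_lip.
- apply: (tight_lip_measurable tG (F := limit_functional)
    (L := test_const * (2 + k%:R * c))); exact: limit_functional_lip.
- exact: stc.
- by move=> h; exact: (@pvalue_bound _ _ _ Q _ _ _ _ (stat_bmeas (fun s => h s + mm s)) eps0 eta0 b0).
Qed.

End LimitTest.

(** * Critical values *)

Section BorelVectors.
Context {R : realType} {k : nat}.

Lemma borelV_lip_measurable (F : 'cV[R]_k -> R) (L : R) :
  (forall x y, `|F x - F y| <= L * `|x - y|) ->
  measurable_fun setT (F : borelV R k -> R).
Proof.
move=> FL; apply: (measurability _ (RGenOpens.measurableE R)).
move=> _ [_ [a [b ->] <-]]; rewrite setTI; apply: sub_sigma_algebra.
rewrite openE => x /= xB.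
have /nbhs_ballP[e e0 eB] : nbhs (F x) `]a, b[%classic.
  by apply: open_nbhs_nbhs; split=> //; exact: interval_open.
have L0 : 0 < `|L| + 1 by rewrite ltr_wpDl.
apply/nbhs_ballP; exists (e / (`|L| + 1)) => /=; first by rewrite divr_gt0.
move=> y; rewrite -ball_normE /= ltr_pdivlMr// => xy; apply: eB.
rewrite /ball/=; apply: (le_lt_trans (FL x y)); apply: le_lt_trans xy.
by rewrite mulrC ler_wpM2l//; have := ler_norm L; lra.
Qed.

Lemma borelV_coord i : measurable_fun setT (fun x : borelV R k => (x : 'cV[R]_k) i 0).
Proof.
apply: (@borelV_lip_measurable (fun x => x i 0) 1) => x y.
by rewrite mul1r; have := mxnorm_entry (x - y) i 0; rewrite !mxE.
Qed.

End BorelVectors.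

Section NormalVectors.
Context {R : realType} {S : choiceType} {k : nat} (s0 : S).
Notation vec := ('cV[R]_k).
Context {d : measure_display} {W : measurableType d} (Q : probability W R).
Variables (G : W -> S -> vec) (V : S -> S -> 'M[R]_k).
Hypothesis gp : centered_gaussian_process Q G V.
Hypothesis tG : tight_borel Q G.
Variables (A Vh : 'M[R]_k).
Hypothesis AV : A *m V s0 s0 *m A^T = Vh.

Let X w : borelV R k := (A *m G w s0 : vec).

Let mX : measurable_fun setT X.
Proof.
have e : @measurable _ (borelV R k) = <<s @open vec >> by [].
refine (@measurability _ _ W (borelV R k) setT X (@open vec) e _).
move=> _ [B oB <-]; rewrite setTI.
apply: (tG.1 ((fun g : S -> vec => A *m g s0) @^-1` B)).
apply: (uniform_lip_open (L := k%:R * `|A|)) oB => g h D gh.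
rewrite -mulmxBr; apply: (le_trans (mxnorm_mul _ _)).
by rewrite ler_wpM2l// mulr_ge0.
Qed.

(** [normal_cV] is a choice by [xget], so it is normal as soon as some probability has the required
    law; the law of A G(s0) is one. *)
Lemma normal_cV_law : normal_law Vh (normal_cV Vh).
Proof.
pose X' : {mfun W >-> borelV R k} :=
  HB.pack X (isMeasurableFun.Build _ _ W (borelV R k) X mX).
pose mu : probability (borelV R k) R := distribution Q X'.
suff : normal_law Vh mu by move=> h; apply: xgetPex; exists mu.
move=> a B mB.
have [_ h] := gp_normal1 s0 gp (A^T *m a).
have := h B mB; rewrite -AV trmx_mul trmxK !mulmxA => <-.
rewrite /mu /distribution /pushforward /=; congr (Q _).
by apply/funext => w; rewrite /X' /= /X !mulmxA.
Qed.

(** [normal_law] prescribes only the laws of linear forms. [cramer_wold] turns this into equality of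
    expectations of bounded Lipschitz functions. *)
Lemma normal_cV_Rintegral (F : vec -> R) (B L : R) : 0 <= L ->
  (forall x, `|F x| <= B) -> (forall x y, `|F x - F y| <= L * `|x - y|) ->
  [/\ bmeas (F : borelV R k -> R), bmeas (fun w => F (A *m G w s0)) &
    \int[normal_cV Vh]_x F x = \int[Q]_w F (A *m G w s0)].
Proof.
move=> L0 FB FL; have nl := normal_cV_law.
pose F' (z : 'I_k -> R) := F (\col_i z i).
have colK (x : vec) : \col_i x i 0 = x by apply/colP => i; rewrite mxE.
have mAG i : measurable_fun setT (fun w => (A *m G w s0) i 0).
  under eq_fun do rewrite mxE.
  apply: measurable_sum => j; apply: measurable_funM => //; exact: gp_coord gp s0 j.
have law (t : 'I_k -> R) (x : vec) :
    \sum_i t i * x i 0 = ((\col_i t i : vec)^T *m x) 0 0.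
  by rewrite mxE; apply: eq_bigr => i _; rewrite !mxE.
have [] := @cramer_wold R 'I_k _ _ _ _ (normal_cV Vh) Q
  (fun x i => (x : vec) i 0) (fun w i => (A *m G w s0) i 0) F' B L.
- exact: borelV_coord.
- exact: mAG.
- move=> t c.
  pose a : vec := \col_i t i.
  have l1 : has_normal_law (normal_cV Vh)
      (fun x : borelV R k => (a^T *m (x : vec)) 0 0) ((a^T *m Vh *m a) 0 0).
    split; last by move=> C mC; exact: nl.
    have m1 : measurable_fun setT
        (fun x : borelV R k => \sum_i t i * (x : vec) i 0).
      by apply: measurable_sum => i; apply: measurable_funM => //; exact: borelV_coord.
    by under eq_fun do rewrite -law.
  have l2 := gp_normal1 s0 gp (A^T *m a).
  transitivity (\int[normal_cV Vh]_x cos ((a^T *m (x : vec)) 0 0 + c)).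
    by apply: eq_Rintegral => x _; rewrite law.
  rewrite (Rintegral_normal_law l1 (cos_affine_bmeas c)).
  rewrite -AV.
  transitivity (\int[Q]_w cos (((A^T *m a)^T *m G w s0) 0 0 + c)); last first.
    by apply: eq_Rintegral => w _; rewrite law trmx_mul trmxK mulmxA.
  rewrite (Rintegral_normal_law l2 (cos_affine_bmeas c)).
  by rewrite trmx_mul trmxK !mulmxA.
- by move=> z; exact: FB.
- move=> z z'; apply: (le_trans (FL _ _)); rewrite ler_wpM2l//.
  exact: (@colv_dist_le R 'I_k k id).
have eF (x : vec) : F' (fun i => x i 0) = F x by rewrite /F' colK.
move=> b1 b2 e; split.
- by move: b1; congr bmeas; apply/funext => x; exact: eF.
- by move: b2; congr bmeas; apply/funext => w; exact: eF.
- transitivity (\int[normal_cV Vh]_x F' (fun i => (x : vec) i 0)).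
    by apply: eq_Rintegral => x _; rewrite eF.
  by rewrite e; apply: eq_Rintegral => w _; exact: eF.
Qed.

End NormalVectors.

(** * Tails of normal vectors and truncation of the statistic *)

Section Outliers.
Context {R : realType} {k : nat}.
Notation vec := ('cV[R]_k).

(** A union bound in functional form: it dominates the indicator of |x| > M, and its expectation is
    a sum of one-dimensional tails. *)
Definition outliers (M : R) (x : vec) : R := \sum_i (M < `|x i 0|)%R%:R.

Lemma outliers_ge0 M x : 0 <= outliers M x.
Proof. by apply: sumr_ge0 => i _. Qed.

Lemma outliers_ge1 M x : ~~ (`|x| <= M) -> 0 <= M -> 1 <= outliers M x.
Proof.
move=> xM M0; have [i xi] : exists i, M < `|x i 0|.
  apply: contrapT => nx; move/negP: xM; apply; apply: mxnorm_le => // i j.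
  by rewrite ord1 leNgt; apply/negP => h; apply: nx; exists i.
by rewrite /outliers (bigD1 i)//= xi lerDl sumr_ge0.
Qed.

Lemma outliers_tail (v0 eta : R) : 0 < v0 -> 0 < eta -> exists2 M0 : R, 0 < M0 &
  forall (d : measure_display) (W : measurableType d) (P : probability W R)
    (X : W -> vec) M, M0 <= M ->
    (forall i, exists2 v, 0 <= v <= v0 & has_normal_law P (fun w => X w i 0) v) ->
    bmeas (fun w => outliers M (X w)) /\ \int[P]_w outliers M (X w) <= eta.
Proof.
(* The level is shared among the k coordinates; k + 1 keeps the denominator positive when k = 0. *)
move=> v00 eta0; have e0 : 0 < eta / k.+1%:R by rewrite divr_gt0.
have [M0 M00 tail] := centered_normal_tail v00 e0.
exists M0 => // d W P X M MM0 lX.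
have mB : measurable [set y : R | M < `|y|].
  have -> : [set y : R | M < `|y|] = setT `&` (fun y : R => `|y|) @^-1` `]M, +oo[%classic.
    by rewrite setTI; apply/seteqP; split => y /=; rewrite in_itv/= andbT.
  have mn : measurable_fun setT (fun y : R => `|y|) by exact: measurableT_comp.
  by apply: mn => //; exact: measurable_itv.
pose D i := (fun w => X w i 0) @^-1` [set y : R | M < `|y|].
have mD i : measurable (D i).
  by have [v _ [mXi _]] := lX i; rewrite /D -[X in measurable X]setTI; exact: mXi.
have DE i w : (M < `|X w i 0|)%R%:R = \1_(D i) w :> R.
  rewrite indicE (_ : (w \in D i) = (M < `|X w i 0|)%R)//.
  by apply/idP/idP => h; [move: h; rewrite inE|exact: mem_set].
have lD i : \int[P]_w (\1_(D i) w : R) <= eta / k.+1%:R.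
  rewrite Rintegral_indicT//; have [v v0v [_ lawXi]] := lX i.
  have tl := tail v M v0v MM0; rewrite -lawXi// -/(D i) in tl.
  by rewrite -lee_fin fineK ?fin_num_measure.
suff h (s : seq 'I_k) : bmeas (fun w => \sum_(i <- s) (\1_(D i) w : R)) /\
    \int[P]_w (\sum_(i <- s) (\1_(D i) w : R)) <= (size s)%:R * (eta / k.+1%:R).
  have oE : (fun w => outliers M (X w)) = (fun w => \sum_i (\1_(D i) w : R)).
    by apply/funext => w; apply: eq_bigr => i _; rewrite DE.
  have [h1 h2] := h (index_enum 'I_k); rewrite oE; split=> //.
  apply: (le_trans h2); rewrite [index_enum _]unlock -enumT size_enum_ord.
  rewrite mulrCA -[leRHS]mulr1 ler_wpM2l ?(ltW eta0)// ler_pdivrMr// mul1r.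
  by rewrite ler_nat.
elim: s => [|i s [IH1 IH2]].
  have -> : (fun w => \sum_(i <- [::]) (\1_(D i) w : R)) = cst 0.
    by apply/funext => w; rewrite big_nil.
  by rewrite Rintegral_probability_cst mul0r; split=> //; exact: bmeas_cst.
have -> : (fun w => \sum_(j <- i :: s) (\1_(D j) w : R)) =
    (fun w => \1_(D i) w + \sum_(j <- s) (\1_(D j) w : R)).
  by apply/funext => w; rewrite big_cons.
have bi := bmeas_indic (R := R) (mD i).
split; first exact: bmeasD.
rewrite RintegralD//; [|exact: (bmeas_integrable P bi)|exact: (bmeas_integrable P IH1)].
by rewrite /= -natr1 mulrDl mul1r addrC lerD.
Qed.

End Outliers.

Section Truncation.
Context {R : realType} {k : nat}.
Notation vec := ('cV[R]_k).

Definition clampv (M : R) (x : vec) : vec := \col_i Num.max (- M) (Num.min M (x i 0)).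

Lemma clampv_dist M x y : `|clampv M x - clampv M y| <= `|x - y|.
Proof.
apply: mxnorm_le => // i j; rewrite !mxE.
have h : `|x i 0 - y i 0| <= `|x - y| by have := mxnorm_entry (x - y) i 0; rewrite !mxE.
by apply: dist_max_le; [rewrite subrr normr0|apply: dist_min_le => //; rewrite subrr normr0].
Qed.

Lemma clampv_le M x : 0 <= M -> `|clampv M x| <= M.
Proof.
move=> M0; apply: mxnorm_le => // i j; rewrite mxE ler_norml.
by rewrite le_max lexx/= ge_max ge_min lexx/= andbT; lra.
Qed.

Lemma clampv_id M x : `|x| <= M -> clampv M x = x.
Proof.
move=> xM; apply/colP => i; rewrite mxE.
have := le_trans (mxnorm_entry x i 0) xM; rewrite ler_norml => /andP[h1 h2].
by rewrite min_r// max_r.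
Qed.

Lemma quad_form_le (A : 'M[R]_k) (x : vec) :
  (x^T *m A *m x) 0 0 <= k%:R ^+ 2 * `|A| * `|x| ^+ 2.
Proof.
apply: (le_trans (ler_norm _)); apply: (le_trans (mxnorm_entry _ _ _)).
apply: (le_trans (mxnorm_mul _ _)).
have -> : k%:R ^+ 2 * `|A| * `|x| ^+ 2 = k%:R * (k%:R * `|x| * `|A|) * `|x| by ring.
rewrite ler_wpM2r// ler_wpM2l//; apply: (le_trans (mxnorm_mul _ _)).
by rewrite mxnorm_tr.
Qed.

Context {S : Type} (s0 : S).

Lemma fdist_le (h h' : S -> vec) D : (forall s, `|h s - h' s| <= D) ->
  (fdist h h' <= (k%:R * D)%:E)%E.
Proof.
move=> hh'; apply: ge_ereal_sup => _ [s _ <-]; rewrite lee_fin.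
by apply: (le_trans (enorm_le_mxnorm _)); rewrite ler_wpM2l.
Qed.

Lemma kdist_le (V V' : S -> S -> 'M[R]_k) D : (forall s t, `|V s t - V' s t| <= D) ->
  (kdist V V' <= (k%:R ^+ 2 * D)%:E)%E.
Proof.
move=> VV'; apply: ge_ereal_sup => _ [s _ [t _ <-]]; rewrite lee_fin.
by apply: (le_trans (opnorm_le_mxnorm _)); rewrite -expr2 ler_wpM2l ?exprn_ge0.
Qed.

Lemma fdist_entry (h h' : S -> vec) s : ((`|h s - h' s|)%:E <= fdist h h')%E.
Proof.
apply: (@le_trans _ _ (enorm (h s - h' s))%:E); first by rewrite lee_fin mxnorm_le_enorm.
by apply: ereal_sup_ubound; exists s.
Qed.

Lemma kdist_entry (V V' : S -> S -> 'M[R]_k) s t :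
  ((`|V s t - V' s t|)%:E <= kdist V V')%E.
Proof.
apply: (@le_trans _ _ (opnorm (V s t - V' s t))%:E).
  by rewrite lee_fin mxnorm_le_opnorm.
by apply: ereal_sup_ubound; exists s => //; exists t.
Qed.

Variable stat : vec -> (S -> vec) -> (S -> S -> 'M[R]_k) -> R.
Hypothesis h4 : bounded_lipschitz_stat s0 stat.

(* stat is only known to be bounded and Lipschitz for bounded first arguments
   and for functions vanishing at s0. *)
Definition tstat M V x (h : S -> vec) : R :=
  stat (clampv M x) (fun s => h s - h s0) V.

(** The constant precedes the covariance functions: it depends on them only through the eigenvalue
    bound, and so is common to the whole null family. *)
Lemma tstat_lipschitz lam M : 0 < lam -> 0 <= M -> exists2 K : R, 0 < K &
  forall V, covariance_function V -> eig_bounded lam V ->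
  (forall x h, `|tstat M V x h| <= K) /\
  forall V', covariance_function V' -> eig_bounded lam V' ->
  forall x x' h h' D D', (forall s, `|h s - h' s| <= D) ->
    (forall s t, `|V s t - V' s t| <= D') ->
    `|tstat M V x h - tstat M V' x' h'| <= K * (`|x - x'| + D + D').
Proof.
(* Bounds the quadratic form of the inverse at a clamped vector; the summand 1 makes C positive. *)
move=> lam0 M0; pose C := k%:R ^+ 2 * lam * M ^+ 2 + 1.
have C0 : 0 < C by rewrite ltr_wpDl// !mulr_ge0// ?exprn_ge0// ltW.
have [K [K0 [KB KL]]] := h4 C0 lam0.
have dom V x h : covariance_function V -> eig_bounded lam V ->
    stat_dom s0 lam C (clampv M x, (fun s => h s - h s0), V).
  move=> cV eV; split => //=; first by rewrite subrr.
  have fV := eig_bounded_form s0 lam0 cV eV.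
  apply: (le_trans (quad_form_le _ _)).
  apply: (@le_trans _ _ (k%:R ^+ 2 * lam * M ^+ 2)); last by rewrite /C lerDl.
  apply: ler_pM; [by rewrite mulr_ge0 ?exprn_ge0|exact: exprn_ge0| |].
    by rewrite ler_wpM2l ?exprn_ge0// form_bounded_invmx.
  by rewrite lerXn2r// ?nnegrE// clampv_le.
(* The distances of the hypothesis, in entrywise norms, cost k for vectors, 2 k for functions
   recentred at s0 and k^2 for operators. *)
pose K' := K * (1 + 2 * k%:R + k%:R ^+ 2).
have k0 : 0 <= k%:R :> R by [].
have k20 : 0 <= k%:R ^+ 2 :> R by exact: exprn_ge0.
have c1 : 1 <= 1 + 2 * k%:R + k%:R ^+ 2 :> R by lra.
exists K'; first by rewrite mulr_gt0//; exact: lt_le_trans c1.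
move=> V cV eV; split=> [x h|V' cV' eV' x x' h h' D D' hh' VV'].
  apply: (le_trans (KB _ _ _ (dom _ _ _ cV eV))).
  by rewrite /K' ler_peMr ?(ltW K0).
have D0 : 0 <= D by exact: le_trans (hh' s0).
have D0' : 0 <= D' by exact: le_trans (VV' s0 s0).
have := KL _ _ _ _ _ _ (dom V x h cV eV) (dom V' x' h' cV' eV').
have fd : (fdist (fun s => h s - h s0)%R (fun s => h' s - h' s0)%R <= (k%:R * (2 * D))%:E)%E.
  apply: fdist_le => s.
  rewrite (_ : h s - h s0 - (h' s - h' s0) = (h s - h' s) - (h s0 - h' s0)).
    by apply: (le_trans (ler_normB _ _)); have := hh' s; have := hh' s0; lra.
  by rewrite !opprB addrACA [RHS]addrACA; congr (_ + _); rewrite addrC.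
have kd := kdist_le VV'.
move=> h1; rewrite -lee_fin; apply: (le_trans h1).
apply: (@le_trans _ _ (K * (k%:R * `|x - x'| + k%:R * (2 * D) + k%:R ^+ 2 * D'))%:E).
  rewrite EFinM lee_wpmul2l// ?lee_fin ?(ltW K0)// !EFinD !leeD// lee_fin.
  apply: (le_trans (enorm_le_mxnorm _)); rewrite ler_wpM2l//.
  exact: clampv_dist.
rewrite lee_fin /K' -mulrA ler_wpM2l ?(ltW K0)//.
have := normr_ge0 (x - x').
move: (`|x - x'|) => X X0.
rewrite !mulrDl !mul1r.
have := mulr_ge0 k0 X0; have := mulr_ge0 k0 D0; have := mulr_ge0 k0 D0'.
have := mulr_ge0 k20 X0; have := mulr_ge0 k20 D0; have := mulr_ge0 k20 D0'.
by rewrite !mulrDr; lra.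
Qed.

Lemma tstat_id M V x h : `|x| <= M -> h s0 = 0 -> tstat M V x h = stat x h V.
Proof.
move=> xM h0; rewrite /tstat clampv_id//; congr (stat _ _ _).
by apply/funext => s; rewrite h0 subr0.
Qed.

Section CriticalValue.
Variables (V : S -> S -> 'M[R]_k) (lam : R) (h : S -> vec).
Hypotheses (lam0 : 0 < lam) (cV : covariance_function V) (eV : eig_bounded lam V).
Hypothesis h0 : h s0 = 0.

Let tstat_lip M : 0 <= M -> exists2 K : R, 0 < K &
  (forall x, `|tstat M V x h| <= K) /\
  forall x y, `|tstat M V x h - tstat M V y h| <= K * `|x - y|.
Proof.
move=> M0; have [K K0 /(_ V cV eV)[KB /(_ V cV eV) KL]] := tstat_lipschitz lam0 M0.
exists K => //; split => // x y.
apply: (le_trans (KL x y h h 0 0 _ _)).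
- by move=> s; rewrite subrr normr0.
- by move=> s t; rewrite subrr normr0.
- by rewrite !addr0.
Qed.

(** The statistic is Lipschitz only on bounded sets, but it is the pointwise limit of its
    truncations, which are eventually equal to it at each point. *)
Lemma stat_measurable : measurable_fun setT (fun x : borelV R k => stat x h V).
Proof.
have mn n : measurable_fun setT (fun x : borelV R k => tstat n%:R V x h).
  have [K K0 [_ KL]] := tstat_lip (ler0n R n).
  exact: borelV_lip_measurable KL.
apply: (measurable_fun_cvg mn) => x _; apply: cvg_near_cst.
exists (Num.truncn `|(x : vec)|).+1 => // n /= hn; rewrite tstat_id//.
by apply: (le_trans (ltW (truncnS_gt _))); rewrite ler_nat.
Qed.

Let N := normal_cV (V s0 s0).

Let mle (c : R) : measurable [set x : borelV R k | stat x h V <= c].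
Proof.
have -> : [set x : borelV R k | stat x h V <= c] =
    setT `&` (fun x : borelV R k => stat x h V) @^-1` `]-oo, c]%classic.
  by rewrite setTI; apply/seteqP; split => y /=; rewrite in_itv.
by apply: stat_measurable.
Qed.

(** The level c = stat(x0) - eps lies above the critical value, so the statistic exceeds c with
    probability at most alpha. The integrand of [pval] vanishes where the truncated statistic is at
    most c, and the truncation matters only on the outliers. *)
Lemma critical_value_tail alpha eta eps M x0 :
  alpha < 1 -> eta <= alpha -> 0 < eps -> 0 <= M -> `|x0| <= M ->
  bmeas (fun x : borelV R k => outliers M x) ->
  \int[N]_x outliers M x <= eta ->
  critical_value s0 alpha stat h V + eps < stat x0 h V ->
  pval N (fun x => tstat M V x h) eps (tstat M V x0 h) <= alpha + eta.
Proof.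
move=> a1 ea eps0 M0 x0M bout outN cv.
have [K K0 [KB KL]] := tstat_lip M0.
pose C := [set c : R | ((1 - alpha)%:E <= N [set x : vec | (stat x h V <= c)%R])%E].
have finN (c : R) : N [set x : vec | (stat x h V <= c)%R] =
    (fine (N [set x : vec | (stat x h V <= c)%R]))%:E.
  by rewrite fineK// fin_num_measure//; exact: mle.
have indN (c : R) : fine (N [set x : vec | (stat x h V <= c)%R]) =
    \int[N]_x (\1_[set x : vec | (stat x h V <= c)%R] x : R).
  by rewrite Rintegral_indicT//; exact: mle.
(* C must be nonempty for its infimum to be meaningful: the statistic is at most K off the outliers,
   whose weight is at most eta <= alpha. *)
have CK : C K.
  rewrite /C/= finN lee_fin indN.
  apply: (@le_trans _ _ (\int[N]_x (1 - outliers M x))).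
    rewrite RintegralB//; [|exact/bmeas_integrable/bmeas_cst|exact: bmeas_integrable].
    by rewrite Rintegral_probability_cst; lra.
  apply: Rintegral_le_mono.
  - by apply: bmeasB => //; exact: bmeas_cst.
  - by apply: bmeas_indic; exact: mle.
  - move=> x; rewrite indicE; have [xM|xM] := boolP (`|(x : vec)| <= M).
      rewrite mem_set/=; first by have := outliers_ge0 M (x : vec); lra.
      have := KB x; rewrite (tstat_id _ xM h0) => /(le_trans (ler_norm _)).
      exact.
    apply: (@le_trans _ _ 0); last by rewrite ler0n.
    by rewrite subr_le0; exact: outliers_ge1.
pose c := stat x0 h V - eps.
have Cc : C c.
  have [c1 Cc1 c1c] : exists2 c1, C c1 & c1 < c.
    (* Without a lower bound [inf C] is a mere default value, but then C has elements below c
       anyway. *)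
    have [lbC|nlbC] := pselect (has_lbound C).
      have cv' : inf C < c by rewrite /c ltrBrDr.
      have cv0 : 0 < c - inf C by rewrite subr_gt0.
      have [c1 Cc1] := inf_adherent cv0 (conj (ex_intro _ _ CK) lbC).
      by rewrite addrC subrK => c1c; exists c1.
    apply: contrapT => nc; apply: nlbC; exists c => c1 Cc1.
    by rewrite leNgt; apply/negP => c1c; apply: nc; exists c1.
  apply: le_trans Cc1 _; apply: le_measure; rewrite ?inE; [exact: mle|exact: mle|].
  by move=> x /= hx; apply: le_trans hx (ltW c1c).
have Ncc : fine (N [set x : vec | (stat x h V <= c)%R]) >= 1 - alpha.
  by move: Cc; rewrite /C/= finN lee_fin.
have br : bmeas (fun x : borelV R k => tstat M V x h).
  by split; [exact: borelV_lip_measurable KL|exists K].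
have bi : bmeas (\1_[set x : vec | (stat x h V <= c)%R] : borelV R k -> R).
  by apply: bmeas_indic; exact: mle.
apply: (@le_trans _ _ (\int[N]_x ((1 - \1_[set x : vec | (stat x h V <= c)%R] x) + outliers M x))).
  apply: Rintegral_le_mono.
  - exact: pval_integrand_bmeas.
  - by apply: bmeasD => //; apply: bmeasB => //; exact: bmeas_cst.
  - move=> x; rewrite indicE; have [xM|xM] := boolP (`|(x : vec)| <= M); last first.
      apply: (@le_trans _ _ 1); first exact: ramp_le1.
      apply: (le_trans (outliers_ge1 xM M0)); rewrite lerDr subr_ge0.
      by rewrite lern1 leq_b1.
    have o0 := outliers_ge0 M (x : vec).
    rewrite !tstat_id//; have [xc|xc] := boolP (x \in _).
      rewrite ramp_eq0; first by rewrite subrr add0r.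
      rewrite inE /= in xc; rewrite pmulr_lle0 ?invr_gt0 ?divr_gt0//.
      by rewrite /c in xc; lra.
    by rewrite subr0; apply: (le_trans (ramp_le1 _)); lra.
have b1 := bmeasB (bmeas_cst 1) bi.
rewrite RintegralD//; [|exact: (bmeas_integrable _ b1)|exact: bmeas_integrable].
rewrite RintegralB//; [|exact/bmeas_integrable/bmeas_cst|exact: (bmeas_integrable _ bi)].
by rewrite Rintegral_probability_cst -indN; lra.
Qed.

End CriticalValue.
End Truncation.

(** * Perturbation of the covariance *)

Lemma eig_bounded_le {R : realType} {S : Type} {k : nat} (lam lam' : R)
    (V : S -> S -> 'M[R]_k) : 0 < lam -> lam <= lam' -> eig_bounded lam V ->
  eig_bounded lam' V.
Proof.
move=> lam0 ll [h1 h2]; split; last by apply: (le_trans h2); rewrite lee_fin.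
apply: le_trans h1; rewrite lee_fin lef_pV2// posrE//; exact: lt_le_trans ll.
Qed.

Section ProjectionPerturbation.
Context {R : realType} {S : choiceType} {k : nat} (s0 : S).
Variables (V V' : S -> S -> 'M[R]_k) (lam delta : R).
Hypotheses (lam0 : 0 < lam) (cV : covariance_function V) (cV' : covariance_function V').
Hypothesis eV : eig_bounded lam V.
Hypothesis VV' : forall s t, `|V' s t - V s t| <= delta.
Hypotheses (d1 : k%:R ^+ 2 * delta <= (2 * lam)^-1) (d2 : k%:R ^+ 2 * delta <= lam).

Let fV s : form_bounded lam (V s s).
Proof. exact: eig_bounded_form. Qed.

Lemma perturb_form_bounded s : form_bounded (2 * lam) (V' s s).
Proof.
have h : k%:R ^+ 2 * `|V' s s - V s s| <= k%:R ^+ 2 * delta.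
  by rewrite ler_wpM2l// exprn_ge0.
by apply: (form_bounded_perturb lam0 (fV s)); apply: le_trans h _.
Qed.

Lemma perturb_eig_bounded : eig_bounded (2 * lam) V'.
Proof.
apply: form_bounded_eig => //; first exact: eig_bounded_dim s0 lam0 eV.
exact: perturb_form_bounded.
Qed.

Lemma proj_coef_le s : `|proj_coef s0 V s| <= k%:R * lam ^+ 2.
Proof.
apply: (le_trans (mxnorm_mul _ _)); rewrite -mulrA ler_wpM2l// expr2.
by apply: ler_pM => //; [exact: cov_entry_le|exact: form_bounded_invmx].
Qed.

(** Rests on the resolvent identity b' - b = b' (V - V') b for the inverses at (s0, s0), with |b| <=
    lam and |b'| <= 2 lam. *)
Lemma proj_coef_dist s : `|proj_coef s0 V' s - proj_coef s0 V s| <=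
  (2 * k%:R * lam + 2 * k%:R ^+ 3 * lam ^+ 3) * delta.
Proof.
have lam20 : 0 < 2 * lam by rewrite mulr_gt0.
have u := form_bounded_unit lam0 (fV s0).
have u' := form_bounded_unit lam20 (perturb_form_bounded s0).
have B := form_bounded_invmx lam0 (fV s0).
have B' := form_bounded_invmx lam20 (perturb_form_bounded s0).
set b := invmx (V s0 s0) in B *; set b' := invmx (V' s0 s0) in B' *.
have delta0 : 0 <= delta by exact: le_trans (VV' s0 s0).
have k0 : 0 <= k%:R :> R by [].
have -> : proj_coef s0 V' s - proj_coef s0 V s =
    (V' s s0 - V s s0) *m b' + V s s0 *m (b' *m (V s0 s0 - V' s0 s0) *m b).
  rewrite mulmxBr !mulmxBl -mulmxA mulmxV// mulmx1 mulVmx// mul1mx mulmxBr.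
  by rewrite /proj_coef -/b -/b' addrA subrK.
apply: (le_trans (ler_normD _ _)); rewrite mulrDl lerD//.
  apply: (le_trans (mxnorm_mul _ _)).
  have -> : 2 * k%:R * lam * delta = k%:R * delta * (2 * lam) by ring.
  by apply: ler_pM => //; rewrite ?mulr_ge0 ?ler_wpM2l.
apply: (le_trans (mxnorm_mul _ _)).
have -> : 2 * k%:R ^+ 3 * lam ^+ 3 * delta =
    k%:R * lam * (k%:R * (k%:R * (2 * lam) * delta) * lam) by ring.
apply: ler_pM; rewrite ?mulr_ge0//.
  by rewrite ler_wpM2l//; exact: cov_entry_le.
apply: (le_trans (mxnorm_mul _ _)); apply: ler_pM; rewrite ?mulr_ge0//.
rewrite ler_wpM2l//; apply: (le_trans (mxnorm_mul _ _)).
by apply: ler_pM; rewrite ?mulr_ge0 ?ler_wpM2l// distrC.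
Qed.

End ProjectionPerturbation.

Section PValueComparison.
Context {R : realType} {S : choiceType} {k : nat} (s0 : S).
Notation vec := ('cV[R]_k).
Context {d : measure_display} {W : measurableType d} (Q : probability W R).
Variables (G : W -> S -> vec) (V V' : S -> S -> 'M[R]_k) (lam delta : R).
Hypothesis gp : centered_gaussian_process Q G V.
Hypothesis tG : tight_borel Q G.
Hypotheses (lam0 : 0 < lam) (cV' : covariance_function V').
Hypothesis eV : eig_bounded lam V.
Hypothesis delta0 : 0 < delta.
Hypothesis VV' : forall s t, `|V' s t - V s t| <= delta.
Hypotheses (d1 : k%:R ^+ 2 * delta <= (2 * lam)^-1) (d2 : k%:R ^+ 2 * delta <= lam).
Hypothesis d3 : k%:R ^+ 2 * lam * delta <= 2^-1.

Let cV : covariance_function V := gp.1.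
Let fV s : form_bounded lam (V s s).
Proof. exact: eig_bounded_form. Qed.
Let fV' s : form_bounded (2 * lam) (V' s s).
Proof. exact: (perturb_form_bounded lam0 cV eV VV' d1 d2). Qed.

Lemma form_bounded_diag (lam' : R) (A : 'M[R]_k) i : 0 < lam' -> form_bounded lam' A ->
  0 <= ((delta_mx i 0 : vec)^T *m A *m (delta_mx i 0 : vec)) 0 0 <= lam'.
Proof.
move=> l0 fA; have := fA (delta_mx i 0 : vec)^T; rewrite trmxK.
have -> : ((delta_mx i 0 : vec)^T *m (delta_mx i 0 : vec)) 0 0 = 1.
  by rewrite trmx_delta mul_delta_mx mxE !eqxx.
rewrite !mulr1 => /andP[h1 ->]; rewrite andbT; apply: le_trans h1.
by rewrite invr_ge0 ltW.
Qed.

Lemma gp_coord_normal i : exists2 v, 0 <= v <= 2 * lam &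
  has_normal_law Q (fun w => G w s0 i 0) v.
Proof.
exists (((delta_mx i 0 : vec)^T *m V s0 s0 *m (delta_mx i 0 : vec)) 0 0).
  have /andP[-> h] := form_bounded_diag i lam0 (fV s0) => /=.
  by apply: (le_trans h); rewrite ler_peMl// ?ler1n// ltW.
have := gp_normal1 s0 gp (delta_mx i 0); congr (has_normal_law Q _ _).
by apply/funext => w; rewrite trmx_delta -rowE mxE.
Qed.

Let factor : exists A : 'M[R]_k, A *m V s0 s0 *m A^T = V' s0 s0 /\
  `|A - 1%:M| <= k%:R * delta * lam.
Proof.
apply: congruence_factor => //; try exact: cov_sym.
- exact: form_bounded_unit lam0 (fV s0).
- exact: form_bounded_invmx.
Qed.

Lemma normal_cV_coord_normal i : exists2 v, 0 <= v <= 2 * lam &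
  has_normal_law (normal_cV (V' s0 s0)) (fun x : borelV R k => (x : vec) i 0) v.
Proof.
exists (((delta_mx i 0 : vec)^T *m V' s0 s0 *m (delta_mx i 0 : vec)) 0 0).
  by apply: form_bounded_diag => //; rewrite mulr_gt0.
split; first exact: borelV_coord.
move=> B mB; have [A [AV _]] := factor.
rewrite -(normal_cV_law gp tG AV (delta_mx i 0) mB); congr (normal_cV _ _).
by apply/funext => x /=; rewrite trmx_delta -rowE mxE.
Qed.

Variable stat : vec -> (S -> vec) -> (S -> S -> 'M[R]_k) -> R.
Hypothesis h4 : bounded_lipschitz_stat s0 stat.
Variables (M K eps eta alpha : R).
Hypotheses (M0 : 0 <= M) (K0 : 0 < K) (eps0 : 0 < eps).
Hypothesis KL : forall V, covariance_function V -> eig_bounded (2 * lam) V ->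
  (forall x h, `|tstat s0 stat M V x h| <= K) /\
  forall V', covariance_function V' -> eig_bounded (2 * lam) V' ->
  forall x x' h h' D D', (forall s, `|h s - h' s| <= D) ->
    (forall s t, `|V s t - V' s t| <= D') ->
    `|tstat s0 stat M V x h - tstat s0 stat M V' x' h'| <= K * (`|x - x'| + D + D').
Hypotheses (a1 : alpha < 1) (ea : eta <= alpha).
Hypothesis tail : forall (d : measure_display) (W : measurableType d)
  (P : probability W R) (X : W -> vec),
  (forall i, exists2 v, 0 <= v <= 2 * lam & has_normal_law P (fun w => X w i 0) v) ->
  bmeas (fun w => outliers M (X w)) /\ \int[P]_w outliers M (X w) <= eta.

(** The price per unit of [delta]. The first summand pays for replacing V' and its residual by V and
    its residual, in the statistic and in the threshold; the second for replacing A G(s0) by G(s0)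
    inside the ball of radius M. *)
Definition comparison_const : R :=
  2 / eps * (2 * K) * (k%:R * (2 * k%:R * lam + 2 * k%:R ^+ 3 * lam ^+ 3) * M + 1) +
  2 / eps * K * (k%:R * (k%:R * lam) * M).

Let eV2 : eig_bounded (2 * lam) V.
Proof. by apply: (eig_bounded_le lam0 _ eV); rewrite ler_peMl ?ler1n// ltW. Qed.

Let eV'2 : eig_bounded (2 * lam) V'.
Proof. exact: (perturb_eig_bounded s0 lam0 cV cV' eV VV' d1 d2). Qed.

Let tL U : covariance_function U -> eig_bounded (2 * lam) U ->
  forall x x' h h' D, (forall s, `|h s - h' s| <= D) ->
  `|tstat s0 stat M U x h - tstat s0 stat M U x' h'| <= K * (`|x - x'| + D).
Proof.
move=> cU eU x x' h h' D hh'; rewrite -[X in K * X]addr0.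
by apply: (KL cU eU).2 => // s t; rewrite subrr normr0.
Qed.

(** A rejection bounds the p-value computed from N(0, V'(s0, s0)), V' and its residual by alpha +
    eta. The statistic is changed to V and its residual under the same law; then the law is changed
    to that of G(s0) through the factor A. *)
Lemma limit_pval_le (g : S -> vec) : `|g s0| <= M ->
  critical_value s0 alpha stat (residual s0 V' g) V' + eps <
    stat (g s0) (residual s0 V' g) V' ->
  limit_pval s0 Q G (tstat s0 stat M V) eps (g s0) (residual s0 V g) <=
    alpha + 2 * eta + comparison_const * delta.
Proof.
move=> gM crit.
have lam20 : 0 < 2 * lam by rewrite mulr_gt0.
have [A [AV A1]] := factor.
set N := normal_cV (V' s0 s0).
set hT := residual s0 V' g; set ht := residual s0 V g.
have u' := form_bounded_unit lam20 (fV' s0).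
have hT0 : hT s0 = 0 by rewrite /hT /residual /proj_coef mulmxV// mul1mx subrr.
have [bN oN] := tail normal_cV_coord_normal.
have [bQ oQ] := tail gp_coord_normal.
have step1 := critical_value_tail h4 lam20 cV' eV'2 hT0 a1 ea eps0 M0 gM bN oN crit.
pose rho := k%:R * (2 * k%:R * lam + 2 * k%:R ^+ 3 * lam ^+ 3) * delta * M.
have hTt s : `|ht s - hT s| <= rho.
  rewrite /hT /ht /residual opprD opprK addrACA subrr add0r addrC -mulmxBl.
  apply: (le_trans (mxnorm_mul _ _)); rewrite /rho; apply: ler_pM => //.
  by rewrite -mulrA ler_wpM2l//; exact: proj_coef_dist.
have k0 : 0 <= k%:R :> R by [].
have e2 : 0 <= 2 / eps by rewrite divr_ge0 ?(ltW eps0).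
pose c := tstat s0 stat M V (g s0) ht.
pose F x := ramp ((tstat s0 stat M V x ht - c + eps) / (eps / 2)).
have FL x y : `|F x - F y| <= 2 / eps * K * `|x - y|.
  apply: (le_trans (ramp_lip _ _)).
  have -> : (tstat s0 stat M V x ht - c + eps) / (eps / 2) -
      (tstat s0 stat M V y ht - c + eps) / (eps / 2) =
      2 / eps * (tstat s0 stat M V x ht - tstat s0 stat M V y ht).
    by field; rewrite gt_eqF.
  rewrite normrM ger0_norm// -mulrA ler_wpM2l// -[`|x - y|]addr0.
  by apply: (tL cV eV2) => s; rewrite subrr normr0.
have FB x : `|F x| <= 1 by rewrite ger0_norm ?ramp_ge0// ramp_le1.
have FL0 : 0 <= 2 / eps * K by rewrite mulr_ge0// ltW.
have [bF bFA eF] := normal_cV_Rintegral gp tG AV FL0 FB FL.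
have brV' h : bmeas (fun x : borelV R k => tstat s0 stat M V' x h).
  split; last by exists K => x; exact: (KL cV' eV'2).1.
  apply: (@borelV_lip_measurable _ _ _ K) => x y; rewrite -[`|x - y|]addr0.
  by apply: (tL cV' eV'2) => s; rewrite subrr normr0.
have brV h : bmeas (fun x : borelV R k => tstat s0 stat M V x h).
  split; last by exists K => x; exact: (KL cV eV2).1.
  apply: (@borelV_lip_measurable _ _ _ K) => x y; rewrite -[`|x - y|]addr0.
  by apply: (tL cV eV2) => s; rewrite subrr normr0.
have dT x : `|tstat s0 stat M V x ht - tstat s0 stat M V' x hT| <= K * (rho + delta).
  have := (KL cV eV2).2 V' cV' eV'2 x x ht hT rho delta hTt
    (fun s t => eq_ind _ (fun z => z <= delta) (VV' s t) _ (distrC _ _)).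
  by rewrite subrr normr0 add0r.
have step2 := pval_dist N c (tstat s0 stat M V' (g s0) hT) eps0 (brV ht) (brV' hT) dT.
have EF : pval N (fun x => tstat s0 stat M V x ht) eps c = \int[Q]_w F (A *m G w s0).
  exact: eF.
have bFQ : bmeas (fun w => F (G w s0)).
  split; last by exists 1 => w; exact: FB.
  apply: (tight_lip_measurable tG (F := fun g => F (g s0)) (L := 2 / eps * K)) => u v D uv.
  by apply: (le_trans (FL _ _)); rewrite ler_wpM2l.
pose r := 2 / eps * K * (k%:R * (k%:R * lam * delta) * M).
(* A - 1 moves G(s0) by a small amount only while G(s0) is bounded; elsewhere the outliers dominate
   F <= 1. *)
have step3 : \int[Q]_w F (G w s0) <= \int[Q]_w ((F (A *m G w s0) + r) + outliers M (G w s0)).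
  apply: Rintegral_le_mono => //.
    by apply: bmeasD => //; apply: bmeasD => //; exact: (bmeas_cst r).
  move=> w; have r0 : 0 <= r.
    by rewrite /r mulr_ge0// !mulr_ge0// ltW.
  have [GM|GM] := boolP (`|G w s0| <= M); last first.
    have := outliers_ge1 GM M0; have := ramp_le1 ((tstat s0 stat M V (G w s0) ht - c + eps) / (eps / 2)).
    have := ramp_ge0 ((tstat s0 stat M V (A *m G w s0) ht - c + eps) / (eps / 2)).
    by rewrite -/(F _) -/(F _); lra.
  have o0 := outliers_ge0 M (G w s0).
  suff : F (G w s0) - F (A *m G w s0) <= r by lra.
  apply: (le_trans (ler_norm _)); apply: (le_trans (FL _ _)); rewrite /r ler_wpM2l//.
  rewrite distrC -{2}[G w s0]mul1mx -mulmxBl; apply: (le_trans (mxnorm_mul _ _)).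
  have -> : k%:R * (k%:R * lam * delta) * M = k%:R * (k%:R * delta * lam) * M by ring.
  by apply: ler_pM; rewrite ?mulr_ge0 ?ler_wpM2l.
have bFr : bmeas (fun w => F (A *m G w s0) + r) by apply: bmeasD => //; exact: (bmeas_cst r).
rewrite RintegralD// in step3; [|exact: (bmeas_integrable Q bFr)|exact: (bmeas_integrable Q bQ)].
rewrite RintegralD// in step3; [|exact: (bmeas_integrable Q bFA)|exact: (bmeas_integrable Q (bmeas_cst r))].
rewrite Rintegral_probability_cst -EF in step3.
have step4 : `|c - tstat s0 stat M V' (g s0) hT| <= K * (rho + delta) by exact: dT.
have step5 : 2 / eps * (K * (rho + delta) + `|c - tstat s0 stat M V' (g s0) hT|) <=
    2 / eps * (2 * (K * (rho + delta))).
  by rewrite ler_wpM2l//; lra.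
have -> : comparison_const * delta = 2 / eps * (2 * (K * (rho + delta))) + r.
  by rewrite /comparison_const /rho /r; ring.
have : limit_pval s0 Q G (tstat s0 stat M V) eps (g s0) ht = \int[Q]_w F (G w s0) by [].
move=> ->.
have arith (p1 p2 I1 I2 z r' a e : R) : p2 <= a + e -> I1 <= p1 + r' + I2 -> I2 <= e ->
    p1 - p2 <= z -> I1 <= a + 2 * e + (z + r') by lra.
by apply: (arith _ _ _ _ _ _ _ _ step1 step3 oQ); exact: le_trans (ler_norm _) (le_trans step2 step5).
Qed.

End PValueComparison.

(** * Outer expectations and the size of the test *)

Section TailRamp.
Context {R : realType} {k : nat}.
Notation vec := ('cV[R]_k).

(** A Lipschitz substitute for [outliers]: each ramp rises from 0 at M/2 to 1 at M, so the sum lies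
    between the indicator of |x| > M and [outliers (M / 2)]. *)
Definition tail_ramp (M : R) (x : vec) : R := \sum_i ramp (2 * `|x i 0| / M - 1).

Lemma tail_ramp_ge0 M x : 0 <= tail_ramp M x.
Proof. by apply: sumr_ge0 => i _; exact: ramp_ge0. Qed.

Lemma tail_ramp_le M x : tail_ramp M x <= k%:R.
Proof.
apply: (@le_trans _ _ (\sum_(i < k) (1 : R))).
  by apply: ler_sum => i _; exact: ramp_le1.
by rewrite sumr_const card_ord.
Qed.

Lemma tail_ramp_ge1 M x : 0 < M -> ~~ (`|x| <= M) -> 1 <= tail_ramp M x.
Proof.
move=> M0 xM; have [i xi] : exists i, M < `|x i 0|.
  apply: contrapT => nx; move/negP: xM; apply; apply: mxnorm_le => [|i j]; first exact: ltW.
  by rewrite ord1 leNgt; apply/negP => h; apply: nx; exists i.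
rewrite /tail_ramp (bigD1 i)//= ramp_eq1; last first.
  by rewrite lerBrDr ler_pdivlMr// -[1 + 1]/(2 : R) ler_wpM2l// ltW.
by rewrite lerDl sumr_ge0// => j _; exact: ramp_ge0.
Qed.

Lemma tail_ramp_outliers M x : 0 < M -> tail_ramp M x <= outliers (M / 2) x.
Proof.
move=> M0; apply: ler_sum => i _; have [xi|xi] := ltP (M / 2) `|x i 0|.
  exact: ramp_le1.
rewrite ramp_eq0// subr_le0 ler_pdivrMr// mul1r mulrC -ler_pdivlMr//.
Qed.

Lemma tail_ramp_lip M x y : 0 < M ->
  `|tail_ramp M x - tail_ramp M y| <= k%:R * (2 / M) * `|x - y|.
Proof.
move=> M0; rewrite /tail_ramp -sumrB; apply: (le_trans (ler_norm_sum _ _ _)).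
apply: (@le_trans _ _ (\sum_(i < k) (2 / M * `|x - y|))); last first.
  by rewrite sumr_const card_ord -[leLHS]mulr_natl !mulrA.
apply: ler_sum => i _; apply: (le_trans (ramp_lip _ _)).
rewrite opprD opprK addrACA addNr addr0 -mulrBl -mulrBr !normrM.
rewrite (ger0_norm (x := 2))// (ger0_norm (x := M^-1)) ?invr_ge0 ?(ltW M0)//.
rewrite mulrAC ler_wpM2l ?divr_ge0 ?(ltW M0)//.
apply: (le_trans (ler_dist_dist _ _)).
by have := mxnorm_entry (x - y) i 0; rewrite !mxE.
Qed.

End TailRamp.

(** Markov's inequality holds for every measurable majorant U of X, and {c <= X} is contained in {c
    <= U}; the infimum over U follows. *)
Lemma outer_markov {R : realType} {d : measure_display} {W : measurableType d}
    (P : probability W R) (X : W -> R) (c : R) : 0 <= c -> (forall w, 0 <= X w) ->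
  (c%:E * mu_ext P [set w | (c <= X w)%R] <= outer_expectation P X)%E.
Proof.
move=> c0 X0; apply: le_ereal_inf_tmp => _ [U [mU _ XU] <-].
have U0 w : (0 <= U w)%E by apply: le_trans (XU w); rewrite lee_fin.
have mB : measurable [set w | (c%:E <= U w)%E].
  by rewrite -[X in measurable X]setTI; exact: emeasurable_fun_c_infty.
apply: (@le_trans _ _ (c%:E * P [set w | (c%:E <= U w)%E])%E).
  rewrite lee_wpmul2l ?lee_fin// -[leRHS]measurable_mu_extE//.
  apply: le_mu_ext => w /= cX; apply: le_trans (XU w); by rewrite lee_fin.
apply: (@le_trans _ _ (\int[P]_(w in [set w | (c%:E <= U w)%E]) U w)%E).
  rewrite -integral_cst//; apply: ge0_le_integral => //.
  - exact: measurable_funTS.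
by apply: ge0_subset_integral.
Qed.

Section FiniteSample.
Context {R : realType} {S : choiceType} {k : nat} (s0 : S).
Notation vec := ('cV[R]_k).
Variable stat : vec -> (S -> vec) -> (S -> S -> 'M[R]_k) -> R.
Hypothesis h4 : bounded_lipschitz_stat s0 stat.
Variables (lam alpha eps eta : R).
Hypotheses (lam0 : 0 < lam) (a0 : 0 < alpha) (a1 : alpha < 1) (eps0 : 0 < eps).
Hypotheses (eta0 : 0 < eta) (ea : eta <= alpha).

(** The quantitative statement for a single sample. [delta] and [slack] come before the spaces, the
    law, the mean and the covariance, which gives uniformity over the null family. *)
Lemma exceedance_bound : exists delta slack : R, [/\ 0 < delta, 0 < slack &
  forall (d : measure_display) (W : measurableType d) (P : probability W R)
    (d' : measure_display) (W' : measurableType d') (Q : probability W' R)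
    (G : W' -> S -> vec) (V : S -> S -> 'M[R]_k)
    (g : W -> S -> vec) (m : S -> vec) (Vh : W -> S -> S -> 'M[R]_k),
  centered_gaussian_process Q G V -> tight_borel Q G -> eig_bounded lam V ->
  m s0 = 0 -> (forall w, covariance_function (Vh w)) ->
  (forall f, BL1 f ->
    (`|outer_expectation P (fun w => f (g w \- m)%R) - 'E_Q[fun w => f (G w)]|
      <= slack%:E)%E) ->
  (mu_ext P [set w | (delta%:E < kdist (Vh w) V)%E] <= eta%:E)%E ->
  (mu_ext P [set w | (critical_value s0 alpha stat (hproc s0 (g w) (Vh w)) (Vh w) + eps
      < stat (g w s0) (hproc s0 (g w) (Vh w)) (Vh w))%R] <=
    (alpha + 7 * eta)%:E)%E].
Proof.
have lam20 : 0 < 2 * lam by rewrite mulr_gt0.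
have [M1 M10 tailM] := @outliers_tail R k _ _ lam20 eta0.
(* The tail ramp at M is controlled by the outliers at M/2 = M1, so the radius is doubled. *)
pose M := 2 * M1.
have M0 : 0 < M by rewrite mulr_gt0.
have M1M : M1 <= M by rewrite /M ler_peMl ?ler1n// ltW.
have M2 : M / 2 = M1 by rewrite /M mulrAC divff ?mul1r.
have [K K0 KL] := tstat_lipschitz h4 lam20 (ltW M0).
pose c := k%:R * lam ^+ 2.
have c0 : 0 <= c by rewrite mulr_ge0// exprn_ge0// ltW.
(* A rejection brings the p-value to at most alpha + 3 eta; one more eta makes the ramp of width eta
   equal to 1 there. *)
pose b := alpha + 4 * eta.
have b0 : 0 <= b by rewrite addr_ge0 ?mulr_ge0// ltW.
pose Lf := test_const K eps eta * (2 + k%:R * c) + k%:R * (2 / M).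
have Lf0 : 0 <= Lf.
  have t0 : 0 <= test_const K eps eta.
    by rewrite /test_const addr_ge0// divr_ge0 ?mulr_ge0// ltW.
  have kc : 0 <= k%:R * c by rewrite mulr_ge0.
  have kM : 0 <= k%:R * (2 / M) by rewrite mulr_ge0// divr_ge0// ltW.
  by rewrite addr_ge0// mulr_ge0// addr_ge0.
(* The test functional is bounded by 1 + k and Lipschitz with constant [Lf]; this factor brings it
   into BL_1. *)
pose a := (1 + k%:R + Lf)^-1.
have s1 : 0 < 1 + k%:R + Lf :> R by rewrite ltr_wpDr// ltr_wpDr.
have aa : 0 < a by rewrite invr_gt0.
pose C := comparison_const (k := k) lam M K eps.
(* With delta = 1/T, the four smallness conditions hold together, since T exceeds each reciprocal
   threshold. *)
pose T := k%:R ^+ 2 * (2 * lam) + k%:R ^+ 2 / lam + 2 * (k%:R ^+ 2 * lam) + `|C| / eta + 1.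
have T1 : 0 <= k%:R ^+ 2 * (2 * lam) by rewrite mulr_ge0 ?exprn_ge0// ltW.
have T2 : 0 <= k%:R ^+ 2 / lam by rewrite divr_ge0 ?exprn_ge0// ltW.
have T3 : 0 <= 2 * (k%:R ^+ 2 * lam) by rewrite !mulr_ge0 ?exprn_ge0// ltW.
have T4 : 0 <= `|C| / eta by rewrite divr_ge0// ltW.
have T0 : 0 < T by rewrite /T ltr_wpDl// !addr_ge0.
have small x y : 0 < y -> x / y <= T -> x * T^-1 <= y.
  by move=> y0; rewrite ler_pdivrMr// ler_pdivrMr// mulrC.
have d1 : k%:R ^+ 2 * T^-1 <= (2 * lam)^-1.
  by apply: small; rewrite ?invr_gt0// invrK /T; lra.
have d2 : k%:R ^+ 2 * T^-1 <= lam by apply: small => //; rewrite /T; lra.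
have d3 : k%:R ^+ 2 * lam * T^-1 <= 2^-1.
  by apply: small; rewrite ?invr_gt0// invrK [_ * 2]mulrC /T; lra.
have d4 : C * T^-1 <= eta.
  apply: small => //; apply: (@le_trans _ _ (`|C| / eta)); last by rewrite /T; lra.
  by rewrite ler_wpM2r ?invr_ge0 ?(ltW eta0)// ler_norm.
exists T^-1, (a * eta); split; rewrite ?invr_gt0 ?mulr_gt0//.
move=> d W P d' W' Q G V g m Vh gp tG eV m0 cVh weak close.
have delta0 : 0 < T^-1 by rewrite invr_gt0.
have cV : covariance_function V := gp.1.
have eV2 : eig_bounded (2 * lam) V.
  by apply: (eig_bounded_le lam0 _ eV); rewrite ler_peMl ?ler1n// ltW.
have V0unit : V s0 s0 \in unitmx := form_bounded_unit lam0 (eig_bounded_form s0 lam0 cV eV).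
have coef s : `|proj_coef s0 V s| <= c by exact: proj_coef_le.
pose St := tstat s0 stat M V.
have StB x h : `|St x h| <= K by exact: (KL V cV eV2).1.
have StL x x' (h h' : S -> vec) D : (forall s, `|h s - h' s| <= D) ->
    `|St x h - St x' h'| <= K * (`|x - x'| + D).
  move=> hh'; rewrite -[X in K * X]addr0.
  by apply: (KL V cV eV2).2 => // s t; rewrite subrr normr0.
pose lf := limit_functional s0 Q G V St m eps eta b.
pose f (X : S -> vec) : R := lf X + tail_ramp M (X s0).
have lf0 X : 0 <= lf X by exact: ramp_ge0.
have lf1 X : lf X <= 1 by exact: ramp_le1.
have f0 X : 0 <= f X by rewrite addr_ge0// tail_ramp_ge0.
have f1 X : f X <= 1 + k%:R by rewrite lerD// tail_ramp_le.
have fL X Y D : (forall s, `|X s - Y s| <= D) -> `|f X - f Y| <= Lf * D.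
  move=> XY; rewrite /f opprD addrACA; apply: (le_trans (ler_normD _ _)).
  rewrite mulrDl; apply: lerD.
    exact: (limit_functional_lip tG coef StB StL m b eps0 eta0 XY).
  apply: (le_trans (tail_ramp_lip _ _ M0)); rewrite ler_wpM2l//.
  by rewrite mulr_ge0// divr_ge0// ltW.
have BLf : BL1 (fun X : S -> vec => a * f X).
  split=> [X|X Y].
    rewrite ger0_norm ?mulr_ge0 ?(ltW aa)// mulrC ler_pdivrMr// mul1r.
    by apply: (le_trans (f1 X)); rewrite lerDl.
  have := fdist_entry X Y.
  (* An infinite distance makes the Lipschitz bound trivial; minus infinity is excluded because the
     index set contains s0. *)
  case: (fdist X Y) => [D| |] XY; last 2 first.
  - by rewrite leey.
  - by have := XY s0; rewrite leeNy_eq.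
  have fXY : `|f X - f Y| <= Lf * D by apply: fL => s; have := XY s; rewrite lee_fin.
  have D0 : 0 <= D by have := XY s0; rewrite lee_fin; exact: le_trans.
  rewrite lee_fin -mulrBr normrM (gtr0_norm aa) mulrC ler_pdivrMr// mulrC.
  apply: (le_trans fXY); rewrite ler_wpM2r//.
  by rewrite lerDr addr_ge0.
have cover : [set w | (critical_value s0 alpha stat (hproc s0 (g w) (Vh w)) (Vh w) + eps
      < stat (g w s0) (hproc s0 (g w) (Vh w)) (Vh w))%R] `<=`
    [set w | (T^-1%:E < kdist (Vh w) V)%E] `|` [set w | (a <= a * f (g w \- m)%R)%R].
  move=> w /= crit; have [kd|kd] := ltP (T^-1%:E) (kdist (Vh w) V); first by left.
  right; rewrite ler_peMr ?(ltW aa)// /f.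
  have gm : (g w \- m)%R s0 = g w s0 by rewrite /= m0 subr0.
  have [gM|gM] := boolP (`|g w s0| <= M); last first.
    by rewrite -[leLHS]add0r lerD// gm tail_ramp_ge1.
  rewrite -[leLHS]addr0 lerD ?tail_ramp_ge0//.
  rewrite /lf /limit_functional /limit_test ramp_eq1//.
  (* This is where m(s0) = 0 enters: the regression term is the same for g - m and g. *)
  have -> : (fun s => residual s0 V (g w \- m)%R s + m s) = residual s0 V (g w).
    by apply/funext => s; rewrite /residual gm /= addrAC subrK.
  rewrite gm ler_pdivlMr// mul1r.
  have VV s t : `|Vh w s t - V s t| <= T^-1.
    by rewrite -lee_fin; apply: le_trans (kdist_entry _ _ s t) kd.
  have := limit_pval_le gp tG lam0 (cVh w) eV delta0 VV d1 d2 d3 h4 (ltW M0) K0 eps0 KL a1 ea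
    (fun d W P X => tailM d W P X M M1M) gM crit.
  by rewrite -/C /St /b; lra.
have blf : bmeas (fun w => lf (G w)).
  split; last by exists 1 => w; rewrite ger0_norm.
  apply: (tight_lip_measurable tG (F := lf) (L := test_const K eps eta * (2 + k%:R * c))).
  exact: (limit_functional_lip tG coef StB StL m b eps0 eta0).
have btl : bmeas (fun w => tail_ramp M (G w s0)).
  split; last by exists k%:R => w; rewrite ger0_norm ?tail_ramp_ge0// tail_ramp_le.
  apply: (tight_lip_measurable tG (F := fun X => tail_ramp M (X s0)) (L := k%:R * (2 / M))).
  move=> X Y D XY; apply: (le_trans (tail_ramp_lip _ _ M0)); rewrite ler_wpM2l//.
  by rewrite mulr_ge0// divr_ge0// ltW.
have bf : bmeas (fun w => f (G w)) by exact: bmeasD.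
have int_f : \int[Q]_w f (G w) <= b + eta.
  rewrite RintegralD//; [|exact: (bmeas_integrable Q blf)|exact: (bmeas_integrable Q btl)].
  apply: lerD.
    exact: (limit_functional_bound gp tG V0unit coef StB StL m eps0 eta0 b0).
  have [bo ho] := tailM _ _ Q (fun w => G w s0) (M / 2)
    (eq_ind_r (fun z => M1 <= z) (lexx M1) M2) (gp_coord_normal s0 gp lam0 eV).
  apply: le_trans ho; apply: Rintegral_le_mono => // w; exact: tail_ramp_outliers.
have Ef : 'E_Q[fun w => (a * f (G w))%R]%E = (a * \int[Q]_w f (G w))%:E.
  rewrite unlock -RintegralZl//; last exact: (bmeas_integrable Q bf).
  rewrite /Rintegral fineK//; apply: integrable_fin_num => //.
  exact: (bmeas_integrable Q (bmeasZ a bf)).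
apply: (le_trans (le_mu_ext P cover)); apply: (le_trans (outer_measureU2 (mu_ext P) _ _)).
have -> : alpha + 7 * eta = eta + (alpha + 6 * eta) by ring.
rewrite EFinD; apply: leeD => //.
(* Markov's inequality is applied to the scaled functional at level [a], and the factor cancels at
   the end. *)
rewrite -(@lee_pmul2l _ a%:E)//.
have aF0 w : 0 <= a * f (g w \- m)%R by rewrite mulr_ge0// ltW.
apply: (le_trans (outer_markov P (ltW aa) aF0)).
have := weak _ BLf; rewrite Ef -EFinM.
have arith : a * \int[Q]_w f (G w) + a * eta <= a * (alpha + 6 * eta).
  by rewrite -mulrDr ler_wpM2l ?(ltW aa)//; rewrite /b in int_f; lra.
(* The outer expectation is an extended real; its finite distance to the limit rules out plus
   infinity. *)
case: (outer_expectation _ _) => [z| |] h.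
- by move: h; rewrite !lee_fin ler_distl => /andP[_ h]; exact: le_trans h arith.
- by move: h; rewrite leye_eq.
- exact: leNye.
Qed.

End FiniteSample.

Theorem theorem1 (R : realType) (q k : nat)
  (Theta : set 'cV[R]_q) (theta0 : Theta) (alpha : R)
  (halpha0 : 0 < alpha) (halpha1 : alpha < 1)
  (d : measure_display) (W : measurableType d) (P0 : set (probability W R))
  (g : nat -> W -> Theta -> 'cV[R]_k)
  (hg : forall T theta i, measurable_fun setT (fun w => g T w theta i 0))
  (m : nat -> probability W R -> Theta -> 'cV[R]_k)
  (hm : forall T P, P0 P -> m T P theta0 = 0)
  (Sigma : probability W R -> Theta -> Theta -> 'M[R]_k)
  (dG : measure_display) (WG : probability W R -> measurableType dG)
  (Q : forall P, probability (WG P) R)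
  (G : forall P, WG P -> Theta -> 'cV[R]_k)
  (hG : forall P, P0 P ->
     centered_gaussian_process (Q P) (G P) (Sigma P) /\
     tight_borel (Q P) (G P))
  (h1 : (fun T => ereal_sup
           [set `|outer_expectation P (fun w => f (g T w \- m T P)%R)
                  - 'E_(Q P)[fun w => f (G P w)]|%E
           | P in P0 & f in @BL1 R Theta k]) @ \oo --> 0%E)
  (h2 : exists lam : R, 0 < lam /\
     forall P, P0 P -> eig_bounded lam (Sigma P))
  (Sigmahat : nat -> W -> Theta -> Theta -> 'M[R]_k)
  (hSigmahat : forall T w, covariance_function (Sigmahat T w))
  (h3 : forall eps : R, 0 < eps ->
     (fun T => ereal_sup
        [set mu_ext P [set w | (eps%:E < kdist (Sigmahat T w) (Sigma P))%E]
        | P in P0]) @ \oo --> 0%E)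
  (stat : 'cV[R]_k -> (Theta -> 'cV[R]_k) -> (Theta -> Theta -> 'M[R]_k) -> R)
  (h4 : bounded_lipschitz_stat theta0 stat) :
  forall eps : R, 0 < eps ->
    (limn_esup (fun T => ereal_sup
       [set mu_ext P [set w |
          let hT := hproc theta0 (g T w) (Sigmahat T w) in
          (critical_value theta0 alpha stat hT (Sigmahat T w) + eps <
          stat (g T w theta0) hT (Sigmahat T w))%R]
       | P in P0]) <= alpha%:E)%E.
Proof.
move=> eps eps0; have [lam [lam0 eS]] := h2.
apply/lee_addgt0Pr => e e0.
(* [eta] <= alpha keeps the critical value meaningful, and 7 eta <= e is the total excess over
   alpha. *)
pose eta := Num.min alpha (e / 7).
have eta0 : 0 < eta by rewrite lt_min halpha0 divr_gt0.
have etaa : eta <= alpha by rewrite ge_min lexx.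
have etae : 7 * eta <= e.
  by rewrite mulrC -ler_pdivlMr// ge_min lexx orbT.
have [delta [slack [delta0 slack0 bound]]] :=
  exceedance_bound h4 lam0 halpha0 halpha1 eps0 eta0 etaa.
have slackE : (0 < slack%:E)%E by rewrite lte_fin.
have etaE : (0 < eta%:E)%E by rewrite lte_fin.
have [N1 _ H1] : \forall T \near \oo, (ereal_sup
           [set `|outer_expectation P (fun w => f (g T w \- m T P)%R)
                  - 'E_(Q P)[fun w => f (G P w)]|%E
           | P in P0 & f in @BL1 R Theta k] < slack%:E)%E.
  exact: (h1 _ (open_nbhs_nbhs (conj (@open_ereal_lt_ereal R slack%:E) slackE))).
have [N2 _ H2] : \forall T \near \oo, (ereal_sup
        [set mu_ext P [set w | (delta%:E < kdist (Sigmahat T w) (Sigma P))%E]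
        | P in P0] < eta%:E)%E.
  exact: (h3 delta delta0 _ (open_nbhs_nbhs (conj (@open_ereal_lt_ereal R eta%:E) etaE))).
(* The limit superior is an infimum of suprema over sets of the filter, among them the tail beyond
   both thresholds. *)
apply: ge_ereal_inf; eexists; first by exists [set n | (maxn N1 N2 <= n)%N];
  [exists (maxn N1 N2)|reflexivity].
apply: ge_ereal_sup => _ [T /= NT <-]; apply: ge_ereal_sup => _ [P PP0 <-].
have [gp tG] := hG P PP0.
apply: (@le_trans _ _ (alpha + 7 * eta)%:E); last by rewrite -EFinD lee_fin lerD2l.
apply: (bound _ _ P _ _ (Q P) (G P) (Sigma P) (g T) (m T P) (Sigmahat T)) => //.
- exact: eS.
- exact: hm.
- move=> f Bf; apply/ltW; apply: le_lt_trans (H1 T _); last first.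
    by rewrite /= (leq_trans _ NT)// leq_maxl.
  by apply: ereal_sup_ubound; exists P => //; exists f.
- apply/ltW; apply: le_lt_trans (H2 T _); last first.
    by rewrite /= (leq_trans _ NT)// leq_maxr.
  by apply: ereal_sup_ubound; exists P.
Qed.
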